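(* The loops $$p_{\alpha,\mathcal C}(\lambda)=\frac{\lambda-\bar\alpha}{\lambda-\alpha}\,\pi_{\overline{\mathcal C}}+\pi_{\mathcal A}+\frac{\lambda-\alpha}{\lambda-\bar\alpha}\,\pi_{\mathcal C},\qquad \mathcal A=(\mathcal C\oplus\overline{\mathcal C})^\perp,$$ where $\alpha$ ranges over $\mathbb C\setminus\mathbb R$ and $\mathcal C$ ranges over the complex coassociative planes in $\mathbb C^7$, generate the group $\mathcal L_-^\tau(\mathbb G_2,\mathbb C^7)$.
   Context: Let $\mathbb O$ be the octonions with their standard inner product, and identify $\mathbb R^7=\mathrm{Im}(\mathbb O)$ and $\mathbb C^7=\mathrm{Im}(\mathbb O)\otimes\mathbb C$. Let $\langle\cdot,\cdot\rangle$ be the complex bilinear extension of the inner product to $\mathbb C^7$, with $\perp$ taken with respect to it; isotropic means that $\langle\cdot,\cdot\rangle$ vanishes. $\mathbb G_2\subset\mathrm{SO}(7,\mathbb C)$ is the automorphism group of $\mathbb O\otimes\mathbb C$ acting on $\mathbb C^7$. For $x,y\in\mathbb C^7$, $x\cdot y\in\mathbb C^7$ denotes the imaginary part of their octonionic product. A complex coassociative plane is an isotropic $2$-dimensional complex subspace $\mathcal C\subset\mathbb C^7$ with $\mathcal C\cdot\mathcal C=0$; for such $\mathcal C$ one has $\mathbb C^7=\mathcal C\oplus\mathcal A\oplus\overline{\mathcal C}$, and the $\pi$'s are the corresponding projections. Loops in $\mathbb G_2$ are holomorphic maps $g:U\to\mathbb G_2$ with $U\subset\mathbb{CP}^1$ open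 and dense; loops agreeing on an open dense set are identified, and multiplication is pointwise. With $\tau(A)=\bar A$, the group $\mathcal L_-^\tau(\mathbb G_2,\mathbb C^7)$ consists of the loops that are rational ($g:\mathbb{CP}^1\to\mathrm{End}(\mathbb C^7)$ meromorphic), negative (holomorphic at $\infty$ with $g(\infty)=\mathrm{Id}$) and satisfy the reality condition $\tau(g(\bar\lambda))=g(\lambda)$. The loops $p_{\alpha,\mathcal C}$ belong to this group and are called simple elements. *)

(* Defs.v *)
From HB Require Import structures.
From mathcomp Require Import all_boot all_order all_algebra.
From mathcomp Require Import complex ring.
From mathcomp Require Import all_classical all_reals all_analysis.

Set Implicit Arguments.
Unset Strict Implicit.
Unset Printing Implicit Defensive.

Import Order.TTheory GRing.Theory Num.Theory.
Import numFieldNormedType.Exports.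

Local Open Scope classical_set_scope.
Local Open Scope ring_scope.

(* R[i], declared at type numClosedFieldType so that the topology which
   mathcomp-analysis puts on every numFieldType is inferred for it. *)
Definition Cplx (R : realType) : numClosedFieldType := R[i].

(* Vectors are rows, so that a subspace is the row space of a matrix.  A matrix
   acts by [mxact], so that the product of matrices is composition of maps:
   mxact (g *m h) v = mxact g (mxact h v). *)
Definition mxact (K : comPzRingType) (n : nat) (g : 'M[K]_n) (v : 'rV[K]_n) :
  'rV[K]_n := v *m g^T.

Definition dotv (K : comPzRingType) (n : nat) (u v : 'rV[K]_n) : K :=
  \sum_i u 0 i * v 0 i.

(* Octonions with coefficients in K: (a, u) : K * K^7 stands for a + sum_i u_i e_i,
   where the imaginary units e_i, with i taken modulo 7, satisfy e_i ^ 2 = -1 and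
   anticommute, and (e_i, e_(i+1), e_(i+3)) multiply cyclically like the
   quaternions i, j, k.  With K = R these are the octonions, with K = C their
   complexification. *)
Definition octonion (K : Type) : Type := 'rV[K]_(1 + 7).

(* The sum of u_i v_j e_i e_j over i != j.  Additions in 'I_7 are modulo 7. *)
Definition imcross (K : comPzRingType) (u v : 'rV[K]_7) : 'rV[K]_7 :=
  \row_(k < 7)
    ((u 0 (k + 1) * v 0 (k + 3%:R) - u 0 (k + 3%:R) * v 0 (k + 1))
   + (u 0 (k + 2%:R) * v 0 (k + 6%:R) - u 0 (k + 6%:R) * v 0 (k + 2%:R))
   + (u 0 (k + 4%:R) * v 0 (k + 5%:R) - u 0 (k + 5%:R) * v 0 (k + 4%:R))).

Definition octmul (K : comPzRingType) (x y : octonion K) : octonion K :=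
  let a := lsubmx x 0 0 in let u := rsubmx x in
  let b := lsubmx y 0 0 in let v := rsubmx y in
  row_mx (a * b - dotv u v)%:M (a *: v + b *: u + imcross u v).

Definition oct_of_im (K : comPzRingType) (v : 'rV[K]_7) : octonion K :=
  row_mx 0 v.

Definition improd (K : comPzRingType) (u v : 'rV[K]_7) : 'rV[K]_7 :=
  rsubmx (octmul (oct_of_im u) (oct_of_im v)).

(* The multiplication table above is that of a composition algebra. *)
Lemma dotv_octmul (K : comPzRingType) (x y : octonion K) :
  dotv (octmul x y) (octmul x y) = dotv x x * dotv y y.
Proof.
have dotE (z : octonion K) : dotv z z =
    lsubmx z 0 0 * lsubmx z 0 0 + dotv (rsubmx z) (rsubmx z).
  rewrite -[z in LHS]hsubmxK /dotv big_split_ord /= big_ord1 !row_mxEl.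
  by congr (_ + _); apply: eq_bigr => i _; rewrite !row_mxEr.
rewrite !dotE /octmul row_mxKl row_mxKr.
move: (lsubmx x) (rsubmx x) (lsubmx y) (rsubmx y) => a u b v.
have rowE (w : 'rV[K]_7) : exists f : nat -> K, forall i, w 0 i = f (val i).
  by exists (fun n => w 0 (inord n)) => i; rewrite inord_val.
rewrite /dotv !big_ord_recl !big_ord0 !mxE eqxx mulr1n.
have [[f uE] [g vE]] := (rowE u, rowE v).
rewrite !uE !vE /= /bump /=; move: (a 0 0) (b 0 0) => {}a {}b.
move: (f 0%N) (f 1%N) (f 2%N) (f 3%N) (f 4%N) (f 5%N) (f 6%N) => ? ? ? ? ? ? ?.
move: (g 0%N) (g 1%N) (g 2%N) (g 3%N) (g 4%N) (g 5%N) (g 6%N) => ? ? ? ? ? ? ?.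
ring.
Qed.

Definition oct_aut (K : comUnitRingType) (f : 'M[K]_(1 + 7)) : Prop :=
  f \in unitmx /\
  forall x y : octonion K, mxact f (octmul x y) = octmul (mxact f x) (mxact f y).

Definition G2 (K : comUnitRingType) : set 'M[K]_7 :=
  [set g | exists f : 'M[K]_(1 + 7),
     oct_aut f /\ forall v, mxact f (oct_of_im v) = oct_of_im (mxact g v)].

Definition cplx_conjmx (K : numClosedFieldType) (m n : nat) (A : 'M[K]_(m, n)) :
  'M[K]_(m, n) := map_mx Num.conj A.

Definition perp (K : fieldType) (n : nat) (U : 'M[K]_n) : 'M[K]_n :=
  kermx U^T.

Definition isotropic (K : fieldType) (n : nat) (U : 'M[K]_n) : Prop :=
  forall x y : 'rV[K]_n, (x <= U)%MS -> (y <= U)%MS -> dotv x y = 0.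

Definition coassociative (K : fieldType) (U : 'M[K]_7) : Prop :=
  [/\ \rank U = 2, isotropic U
    & forall x y : 'rV[K]_7, (x <= U)%MS -> (y <= U)%MS -> improd x y = 0].

(* The projection onto U along V, for the action [mxact]. *)
Definition proj_along (K : fieldType) (n : nat) (U V : 'M[K]_n) : 'M[K]_n :=
  (proj_mx U V)^T.

Definition CP1 (R : realType) : topologicalType :=
  one_point_compactification (Cplx R).

Definition pt (R : realType) (z : Cplx R) : CP1 R := Some z.
Definition infty (R : realType) : CP1 R := None.

(* The chart w |-> 1 / w around infinity. *)
Definition chart_infty (R : realType) (w : Cplx R) : CP1 R :=
  if w == 0 then infty R else pt w^-1.

(* A property of the germ at p of a function on CP1, read in a chart around p. *)
Definition in_chart (R : realType) (T : Type)
    (P : (Cplx R -> T) -> Cplx R -> Prop) (f : CP1 R -> T) (p : CP1 R) : Prop :=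
  match p with
  | Some a => P (f \o @pt R) a
  | None => P (f \o @chart_infty R) 0
  end.

(* [derivable] over the field of complex numbers: complex differentiability. *)
Definition holomorphic (R : realType) (f : Cplx R -> Cplx R) (a : Cplx R) : Prop :=
  \forall z \near a, derivable f z 1.

Definition meromorphic (R : realType) (f : Cplx R -> Cplx R) (a : Cplx R) : Prop :=
  exists (n : nat) (h : Cplx R -> Cplx R),
    holomorphic h a /\ \forall z \near a^', f z = h z / (z - a) ^+ n.

Definition mx_holomorphic (R : realType) (g : CP1 R -> 'M[Cplx R]_7)
    (p : CP1 R) : Prop :=
  forall i j, in_chart (@holomorphic R) (fun q => g q i j) p.

Definition mx_meromorphic (R : realType) (g : CP1 R -> 'M[Cplx R]_7)
    (p : CP1 R) : Prop :=
  forall i j, in_chart (@meromorphic R) (fun q => g q i j) p.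

(* A loop g : U -> G2 is represented by any total function extending it; the
   values outside of U are irrelevant, since only [loop_eq]-invariant properties
   of loops are considered. *)
Definition loop_rep (R : realType) : Type := CP1 R -> 'M[Cplx R]_7.

Definition loop_eq (R : realType) (g h : loop_rep R) : Prop :=
  exists V : set (CP1 R), [/\ open V, dense V & forall p, V p -> g p = h p].

Definition is_loop (R : realType) (g : loop_rep R) : Prop :=
  exists U : set (CP1 R), [/\ open U, dense U,
    forall p, U p -> mx_holomorphic g p & forall p, U p -> @G2 (Cplx R) (g p)].

Definition loop_one (R : realType) : loop_rep R := fun _ => 1%:M.
Definition loop_mul (R : realType) (g h : loop_rep R) : loop_rep R :=
  fun p => g p *m h p.
Definition loop_inv (R : realType) (g : loop_rep R) : loop_rep R :=
  fun p => invmx (g p).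

Definition rational_loop (R : realType) (g : loop_rep R) : Prop :=
  exists m : CP1 R -> 'M[Cplx R]_7, loop_eq g m /\ forall p, mx_meromorphic m p.

Definition negative_loop (R : realType) (g : loop_rep R) : Prop :=
  exists h : loop_rep R,
    [/\ loop_eq g h, mx_holomorphic h (infty R) & h (infty R) = 1%:M].

Definition conjCP1 (R : realType) (p : CP1 R) : CP1 R :=
  if p is Some z then pt z^* else infty R.

Definition real_loop (R : realType) (g : loop_rep R) : Prop :=
  loop_eq (fun p => cplx_conjmx (g (conjCP1 p))) g.

Definition Lminus_tau (R : realType) : set (loop_rep R) :=
  [set g | [/\ is_loop g, rational_loop g, negative_loop g & real_loop g]].

(* (lambda - a) / (lambda - b), with its limit 1 at infinity. *)
Definition linear_ratio (R : realType) (a b : Cplx R) (p : CP1 R) : Cplx R :=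
  if p is Some z then (z - a) / (z - b) else 1.

Definition simple_element (R : realType) (alpha : Cplx R) (U : 'M[Cplx R]_7) :
    loop_rep R :=
  let V := cplx_conjmx U in
  let A := perp (U + V)%MS in
  fun p => linear_ratio alpha^* alpha p *: proj_along V (U + A)%MS
         + proj_along A (U + V)%MS
         + linear_ratio alpha alpha^* p *: proj_along U (A + V)%MS.

Definition simple_elements (R : realType) : set (loop_rep R) :=
  [set g | exists (alpha : Cplx R) (U : 'M[Cplx R]_7),
     [/\ alpha \isn't Num.real, coassociative U & g = simple_element alpha U]].

(* The subgroup generated by S in the group of loops modulo [loop_eq]. *)
Inductive loop_generated (R : realType) (S : set (loop_rep R)) :
    loop_rep R -> Prop :=
| Gen_incl g of S g : loop_generated S g
| Gen_one : loop_generated S (@loop_one R)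
| Gen_mul g h of loop_generated S g & loop_generated S h :
    loop_generated S (loop_mul g h)
| Gen_inv g of loop_generated S g : loop_generated S (loop_inv g)
| Gen_eq g h of loop_generated S g & loop_eq g h : loop_generated S h.

(* Main.v *)
Require Import Defs.
From mathcomp Require Import all_boot all_order all_algebra.
From mathcomp Require Import all_classical all_reals all_analysis.
From mathcomp Require Import complex ring lra.

(** Both sides of the equivalence are compared with an algebraic condition,
    [rational_G2_loop]: up to equality on an open dense set, the loop is M / q with
    M a 7 x 7 matrix of polynomials and q a nonzero polynomial ([loop_frac]), where
    M^T M = q^2, M u x M v = q M (u x v), conj(q) M = q conj(M), and the entries of
    M - q have smaller degree than q.

    Analysis is only needed to see that an element of the group has this form
    ([Lminus_rational_G2_loop]): its entries are meromorphic on the sphere, hence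
    rational ([meromorphic_rational]).  Multiplying by a polynomial that clears the
    poles leaves an entire function of polynomial growth, and such a function is a
    polynomial ([growth_poly]).  That rests on Goursat's theorem for rectangles,
    including functions that are merely continuous at finitely many points: if f
    decays like 1 / |z| and f b <> 0, then (f z - f b) / (z - b) is, up to a factor,
    close to 1 / (z - b) on a large square around b, so its contour integral cannot
    vanish as Goursat's theorem demands.  Conversely, fractions M / q with these
    properties are loops in the group ([rational_G2_loop_Lminus]), they are closed
    under the group operations, and simple elements are of this form, because the
    map that scales by t, 1 and 1 / t on conj(U), A and U is an automorphism of the
    octonions for every coassociative plane U ([coass_scale_G2]).

    The substance is to factor M / q into simple elements, by induction on the degree
    of q, which may be taken real ([real_frac_generated]).  At a real root of q the
    equations force M to vanish, so that a factor of M and q cancels.  Let alpha be a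
    nonreal root at which M does not vanish, and let P0 and P1 be the first two Taylor
    coefficients of M there.  The image of P0 is isotropic with zero products, hence
    has dimension at most two ([null_rank_le2]).  The simple element p of
    (alpha, U) removes the pole when U contains the image of P0 and is orthogonal to
    the image of P1 ([simple_factor_cancels]); then p M / q has a representation with
    the same denominator whose numerator vanishes at alpha, and two factors cancel.
    Such a U exists when the image is a line, spanned by w say: U is spanned by w and a
    suitable vector of the three-dimensional annihilator of w ([cancelling_rank1]).
    When the image is a plane, it is itself the only candidate, and it works if and
    only if the skew form B(u, v) = <P0 u, P1 v> vanishes ([cancelling_rank2]).  If B
    does not vanish, a preliminary factor, attached to a plane that meets the image of
    P0 in a line and is adapted to it by a Hermitian condition, makes B vanish without
    changing q ([untilting_plane], [simple_factor_untilts]), which leads back to the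
    other cases. *)

Set Implicit Arguments.
Unset Strict Implicit.
Unset Printing Implicit Defensive.

Import Order.TTheory GRing.Theory Num.Theory.
Import numFieldNormedType.Exports.

Local Open Scope classical_set_scope.
Local Open Scope ring_scope.

Local Notation Re := complex.Re.
Local Notation Im := complex.Im.

(** * Antiderivatives and integrals over segments *)

Section Antiderivative.
Variable R : realType.
Implicit Types f F G : R -> R.

(** By the mean value theorem the difference is constant; only the open interval is
    used, since the antiderivatives below are first built on half-lines. *)
Lemma eq_derive_cst (G F f : R -> R) (a b x y : R) :
  (forall z : R, z \in `]a, b[ -> is_derive z 1 F (f z)) ->
  (forall z : R, z \in `]a, b[ -> is_derive z 1 G (f z)) ->
  a < x < b -> a < y < b -> F x - G x = F y - G y.
Proof.
move=> dF dG.
wlog xy : x y / x <= y.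
  by move=> H hx hy; have [/H|/ltW/H h] := leP x y; [exact|rewrite h].
move=> /andP[ax xb] /andP[ay yb].
pose H z := F z - G z.
have dH z : z \in `]a, b[ -> is_derive z 1 H 0.
  move=> zab; rewrite -(subrr (f z)).
  by apply: (@is_deriveB _ _ _ F G); [exact: dF|exact: dG].
have sub z : z \in `[x, y] -> z \in `]a, b[.
  by rewrite !in_itv /= => /andP[h1 h2]; apply/andP; split; lra.
have cH : {within `[x, y], continuous H}.
  apply: derivable_within_continuous => z /sub /dH h.
  by have [] := h.
have dH' z : z \in `]x, y[ -> is_derive z 1 H 0.
  by move=> zxy; apply/dH/sub; apply: subset_itv_oo_cc zxy.
have [c _] := @MVT_segment R H (fun=> 0) x y xy dH' cH.
by rewrite mul0r => /eqP; rewrite subr_eq0 => /eqP.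
Qed.

(** The integral from a is an antiderivative to the right of a only: the fundamental
    theorem is applied on the segment from a to x + 1. *)
Lemma right_antiderivative f (a : R) : continuous f ->
  exists F, forall x : R, a < x -> is_derive x 1 F (f x).
Proof.
move=> cf; exists (fun y => \int[lebesgue_measure]_(t in [set` `[a, y]]) f t) => x ax.
have int : lebesgue_measure.-integrable `[a, x + 1] (EFin \o f).
  apply: continuous_compact_integrable; first exact: segment_compact.
  exact: continuous_subspaceT.
have x1 : x < x + 1 by rewrite ltrDl.
have [d1 d2] := @continuous_FTC1_closed R f a x (x + 1) x1 int ax (cf x).
apply: DeriveDef; first exact: d1.
by rewrite -derive1E; exact: d2.
Qed.

(** An antiderivative for x < 1, obtained by reflection, is glued at 0 with one for
    x > -1; on the overlap they differ by a constant. *)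
Lemma antiderivative f : continuous f ->
  exists F, forall x : R, is_derive x 1 F (f x).
Proof.
move=> cf.
have [F1 dF1] := right_antiderivative (-1) cf.
have cfN : continuous (fun x => - f (- x)).
  by move=> x; apply: continuousN; apply: continuous_comp;
    [exact: oppr_continuous|exact: cf].
have [F2 dF2] := right_antiderivative (-1) cfN.
pose G x := F2 (- x).
have dG (x : R) : x < 1 -> is_derive x 1 G (f x).
  move=> x1; have h : is_derive (- x) 1 F2 (- f x).
    by have := dF2 (- x); rewrite opprK; apply; rewrite ltrN2.
  have -> : f x = - f x * (-1) by rewrite mulrN1 opprK.
  by apply: is_derive1_comp.
pose F x := if 0 <= x then F1 x - F1 0 else G x - G 0.
have eqF x : -1 < x < 1 -> F1 x - F1 0 = G x - G 0.
  move=> /andP[x1 x2]; have := @eq_derive_cst G F1 f (-1) 1 x 0.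
  have h (z : R) : z \in `](-1)%R, 1%R[ -> is_derive z 1 F1 (f z).
    by rewrite in_itv /= => /andP[z1 _]; exact: dF1.
  have h' (z : R) : z \in `](-1)%R, 1%R[ -> is_derive z 1 G (f z).
    by rewrite in_itv /= => /andP[_ z1]; exact: dG.
  move=> /(_ h h'); rewrite x1 x2 /= ltrN10 ltr01 => /(_ isT isT) /eqP.
  by move=> /eqP e; lra.
exists F => x; have [x0|x0] := leP 0 x.
- apply: (@near_eq_is_derive _ _ _ (fun x => F1 x - F1 0)); last first.
    have -> : f x = f x - 0 by rewrite subr0.
    by apply: is_deriveB; apply: dF1; lra.
  near=> y; rewrite /F; case: ifPn => //; rewrite -ltNge => y0.
  apply: eqF; apply/andP; split; last by lra.
  by near: y; apply: lt_nbhsr; lra.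
- apply: (@near_eq_is_derive _ _ _ (fun x => G x - G 0)); last first.
    have -> : f x = f x - 0 by rewrite subr0.
    by apply: is_deriveB; apply: dG; lra.
  near=> y; rewrite /F; case: ifPn => // y0.
  by rewrite eqF //; apply/andP; split; [lra|near: y; apply: lt_nbhsl; lra].
Unshelve. all: by end_near. Qed.

End Antiderivative.

Section Integral.
Variable R : realType.
Implicit Types (f g F : R -> R) (p q : R -> R[i]) (a b c : R).

(** Integrals are increments of a chosen antiderivative: additivity over intervals
    of either orientation is then immediate, and no integrability is to be checked. *)
Definition primitive f : R -> R :=
  if pselect (continuous f) is left cf then sval (cid (antiderivative cf))
  else cst 0.

Lemma primitiveP f : continuous f ->
  forall x : R, is_derive x 1 (primitive f) (f x).
Proof.
by move=> cf; rewrite /primitive; case: pselect => // ?; case: cid.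
Qed.

Definition rint f a b : R := primitive f b - primitive f a.

Lemma rintE f F a b : continuous f -> (forall x : R, is_derive x 1 F (f x)) ->
  rint f a b = F b - F a.
Proof.
move=> cf dF; rewrite /rint.
pose m := - (`|a| + `|b| + 1).
have ha := ler_norm a; have hb := ler_norm b.
have ha' : - `|a| <= a by rewrite lerNl -normrN ler_norm.
have hb' : - `|b| <= b by rewrite lerNl -normrN ler_norm.
have na := normr_ge0 a; have nb := normr_ge0 b.
have := @eq_derive_cst R F (primitive f) f m (- m) b a.
move=> /(_ (fun z _ => primitiveP cf z) (fun z _ => dF z)) H.
have /H h1 : m < b < - m by apply/andP; rewrite /m; split; lra.
have h2 : m < a < - m by apply/andP; rewrite /m; split; lra.
by have := h1 h2; lra.
Qed.

Lemma rint_cat f a b c : rint f a b + rint f b c = rint f a c.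
Proof. by rewrite /rint; lra. Qed.

Lemma rint_swap f a b : rint f b a = - rint f a b.
Proof. by rewrite /rint; lra. Qed.

Lemma rintxx f a : rint f a a = 0.
Proof. by rewrite /rint subrr. Qed.

Lemma rint_lin f g (k l : R) a b : continuous f -> continuous g ->
  rint (fun x => k * f x + l * g x) a b = k * rint f a b + l * rint g a b.
Proof.
move=> cf cg.
have ch : continuous (fun x => k * f x + l * g x).
  by move=> x; apply: cvgD; apply: cvgM;
    [exact: cvg_cst|exact: cf|exact: cvg_cst|exact: cg].
have dF (x : R) :
    is_derive x 1 (k *: primitive f + l *: primitive g) (k * f x + l * g x).
  by apply: is_deriveD; apply: is_deriveZ; exact: primitiveP.
rewrite (rintE a b ch dF) -[LHS]/(k * primitive f b + l * primitive g b
  - (k * primitive f a + l * primitive g a)) /rint; ring.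
Qed.

Lemma rint_mvt f a b : a <= b -> continuous f ->
  exists2 c, a <= c <= b & rint f a b = f c * (b - a).
Proof.
move=> ab cf; have [||c] := @MVT_segment R (primitive f) f a b ab.
- by move=> x _; exact: primitiveP.
- apply: derivable_within_continuous => z _.
  by have [] := primitiveP cf z.
by rewrite in_itv /=; exists c.
Qed.

Lemma rint_le f a b (M : R) : continuous f ->
  (forall x, `|x - a| <= `|b - a| -> `|x - b| <= `|b - a| -> `|f x| <= M) ->
  `|rint f a b| <= M * `|b - a|.
Proof.
move=> cf.
wlog ab : a b / a <= b.
  move=> H h; have [|/ltW ba] := leP a b; first by move=> /H; apply.
  rewrite rint_swap normrN (distrC b a); apply: H => // x h1 h2.
  by apply: h; rewrite (distrC b a).
move=> H; have ba : 0 <= b - a by rewrite subr_ge0.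
have [x /andP[ax xb] ->] := rint_mvt ab cf.
rewrite normrM ler_wpM2r //; apply: H; rewrite (ger0_norm ba).
  by rewrite ger0_norm; lra.
by rewrite ler0_norm; lra.
Qed.

Definition cint p a b : R[i] :=
  Complex (rint (fun t => Re (p t)) a b) (rint (fun t => Im (p t)) a b).

Definition cpath p := continuous (fun t => Re (p t)) /\ continuous (fun t => Im (p t)).

Lemma cint_cat p a b c : cint p a b + cint p b c = cint p a c.
Proof. by rewrite /cint -!(rint_cat _ a b c). Qed.

Lemma cintxx p a : cint p a a = 0.
Proof. by rewrite /cint !rintxx. Qed.

Lemma cpathZ p (k : R[i]) : cpath p -> cpath (fun t => k * p t).
Proof.
move=> [p1 p2]; case: k => k l; split => t.
  rewrite (_ : (fun t => _) = (fun t => k * Re (p t) - l * Im (p t))); last first.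
    by apply/funext => s; case: (p s).
  by apply: cvgB; apply: cvgM;
    [exact: cvg_cst|exact: p1|exact: cvg_cst|exact: p2].
rewrite (_ : (fun t => _) = (fun t => k * Im (p t) + l * Re (p t))); last first.
  by apply/funext => s; case: (p s).
by apply: cvgD; apply: cvgM;
  [exact: cvg_cst|exact: p2|exact: cvg_cst|exact: p1].
Qed.

Lemma cintD p q a b : cpath p -> cpath q ->
  cint (fun t => p t + q t) a b = cint p a b + cint q a b.
Proof.
move=> [p1 p2] [q1 q2]; rewrite /cint.
rewrite (_ : (fun t => Re _) = (fun t => 1 * Re (p t) + 1 * Re (q t))); last first.
  by apply/funext => s; rewrite !mul1r; case: (p s) (q s) => ? ? [].
rewrite (_ : (fun t => Im _) = (fun t => 1 * Im (p t) + 1 * Im (q t))); last first.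
  by apply/funext => s; rewrite !mul1r; case: (p s) (q s) => ? ? [].
by rewrite !rint_lin // !mul1r.
Qed.

Lemma cintZ p (k : R[i]) a b : cpath p ->
  cint (fun t => k * p t) a b = k * cint p a b.
Proof.
move=> [p1 p2]; rewrite /cint; case: k => k l.
rewrite (_ : (fun t => Re _) = (fun t => k * Re (p t) + (- l) * Im (p t))); last first.
  by apply/funext => s; rewrite mulNr; case: (p s).
rewrite (_ : (fun t => Im _) = (fun t => k * Im (p t) + l * Re (p t))); last first.
  by apply/funext => s; case: (p s).
by rewrite !rint_lin // mulNr.
Qed.

(** The norm |Re z| + |Im z|: equivalent to the modulus, but piecewise linear. *)
Definition nrm (z : R[i]) : R := `|Re z| + `|Im z|.

Lemma nrm_ge0 z : 0 <= nrm z.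
Proof. by rewrite addr_ge0. Qed.

Lemma nrm0 : nrm 0 = 0.
Proof. by rewrite /nrm /= normr0 addr0. Qed.

Lemma nrmN z : nrm (- z) = nrm z.
Proof. by case: z => a b; rewrite /nrm /= !normrN. Qed.

Lemma nrmD y z : nrm (y + z) <= nrm y + nrm z.
Proof.
case: y z => a b [c d]; rewrite /nrm /=.
by have := ler_normD a c; have := ler_normD b d; lra.
Qed.

Lemma nrmM y z : nrm (y * z) <= nrm y * nrm z.
Proof.
case: y z => a b [c d]; rewrite /nrm /= mulrDl !mulrDr -!normrM.
by have := ler_normB (a * c) (b * d); have := ler_normD (a * d) (b * c); lra.
Qed.

Lemma nrm_gt0 z : z != 0 -> 0 < nrm z.
Proof.
case: z => a b; rewrite eq_complex /= negb_and /nrm /=.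
rewrite -!normr_gt0 => /orP[] h; have ha := normr_ge0 a; have hb := normr_ge0 b.
  lra.
lra.
Qed.

Lemma nrmV z : nrm z^-1 * nrm z <= 2.
Proof.
have [->|z0] := eqVneq z 0; first by rewrite nrm0 mulr0.
case: z z0 => a b z0; rewrite /nrm /=.
have : 0 < a ^+ 2 + b ^+ 2.
  move: z0; rewrite eq_complex /= negb_and => /orP[] h.
    by rewrite ltr_pwDl ?exprn_even_gt0 ?h ?sqr_ge0.
  by rewrite ltr_wpDl ?exprn_even_gt0 ?h ?sqr_ge0.
have [d de] : exists d, d = a ^+ 2 + b ^+ 2 by exists (a ^+ 2 + b ^+ 2).
rewrite -de => d0.
rewrite normrN !normrM normfV (gtr0_norm d0).
rewrite -mulrDl mulrAC -expr2 ler_pdivrMr //.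
have -> : d = `|a| ^+ 2 + `|b| ^+ 2 by rewrite !real_normK ?num_real ?de.
have : 0 <= (`|a| - `|b|) ^+ 2 by apply: sqr_ge0.
by rewrite sqrrB sqrrD; lra.
Qed.

Lemma cint_le p a b (M : R) : cpath p ->
  (forall x, `|x - a| <= `|b - a| -> `|x - b| <= `|b - a| -> nrm (p x) <= M) ->
  nrm (cint p a b) <= 2 * M * `|b - a|.
Proof.
move=> [p1 p2] H; rewrite /nrm /=.
have h1 : `|rint (fun t => Re (p t)) a b| <= M * `|b - a|.
  by apply: rint_le => // x xa xb; apply: le_trans (H x xa xb); rewrite lerDl.
have h2 : `|rint (fun t => Im (p t)) a b| <= M * `|b - a|.
  by apply: rint_le => // x xa xb; apply: le_trans (H x xa xb); rewrite lerDr.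
by rewrite -mulrA mulr2n mulrDl mul1r; lra.
Qed.

End Integral.

Local Open Scope complex_scope.

(** * Goursat's theorem on rectangles *)

Section Goursat.
Variable R : realType.
Implicit Types (f g : R[i] -> R[i]) (z w p d k : R[i]) (x y a b : R).

(** Continuity and complex differentiability in terms of the norm nrm, which suits
    estimates on rectangles with sides parallel to the axes. *)
Definition ccont f z := forall e, 0 < e -> exists2 r, 0 < r &
  forall w, nrm (w - z) < r -> nrm (f w - f z) < e.

Definition cderiv f z d := forall e, 0 < e -> exists2 r, 0 < r &
  forall w, nrm (w - z) < r -> nrm (f w - f z - d * (w - z)) <= e * nrm (w - z).

Lemma ccont_cpath f (s : R -> R[i]) :
  (forall z, ccont f z) -> (forall t u, nrm (s t - s u) = `|t - u|) ->
  cpath (fun t => f (s t)).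
Proof.
move=> cf ls; split => t; apply/cvgrPdist_lt => e e0;
  have [r r0 H] := cf (s t) e e0; near=> u;
  (have /H : nrm (s u - s t) < r by
    (rewrite ls distrC; near: u; apply/nbhs_ballP; exists r));
  apply: le_lt_trans; rewrite distrC; case: (f _) (f _) => ? ? [? ?];
  by rewrite /nrm /= ?(lerDl, lerDr).
Unshelve. all: by end_near. Qed.

Lemma cpath_h f y : (forall z, ccont f z) -> cpath (fun t => f (t +i* y)).
Proof.
by move=> cf; apply: ccont_cpath => // t u; rewrite /nrm /= subrr normr0 addr0.
Qed.

Lemma cpath_v f x : (forall z, ccont f z) -> cpath (fun t => f (x +i* t)).
Proof.
by move=> cf; apply: ccont_cpath => // t u; rewrite /nrm /= subrr normr0 add0r.
Qed.

Definition rect f a b x y : R[i] :=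
  cint (fun t => f (t +i* x)) a b + 'i * cint (fun t => f (b +i* t)) x y
  - cint (fun t => f (t +i* y)) a b - 'i * cint (fun t => f (a +i* t)) x y.

Lemma rect_catx f a b c x y : rect f a b x y + rect f b c x y = rect f a c x y.
Proof. by rewrite /rect -!(cint_cat _ a b c); ring. Qed.

Lemma rect_caty f a b x y c : rect f a b x y + rect f a b y c = rect f a b x c.
Proof. by rewrite /rect -!(cint_cat _ x y c); ring. Qed.

Lemma rectxx f a x y : rect f a a x y = 0.
Proof. by rewrite /rect !cintxx; ring. Qed.

Lemma rectyy f a b x : rect f a b x x = 0.
Proof. by rewrite /rect !cintxx; ring. Qed.

Lemma rect_swapx f a b x y : rect f b a x y = - rect f a b x y.
Proof. by apply/eqP; rewrite -subr_eq0 opprK rect_catx rectxx. Qed.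

Lemma rect_swapy f a b x y : rect f a b y x = - rect f a b x y.
Proof. by apply/eqP; rewrite -subr_eq0 opprK rect_caty rectyy. Qed.

Lemma rectD f g a b x y : (forall z, ccont f z) -> (forall z, ccont g z) ->
  rect (fun z => f z + g z) a b x y = rect f a b x y + rect g a b x y.
Proof.
move=> cf cg; have hf c := cpath_h c cf; have hg c := cpath_h c cg.
have vf c := cpath_v c cf; have vg c := cpath_v c cg.
by rewrite /rect !cintD //; ring.
Qed.

Lemma cpath_cst k : cpath (fun _ : R => k).
Proof. by split => t; exact: cvg_cst. Qed.

Lemma cint_cst k a b : cint (fun=> k) a b = k * (b - a)%:C.
Proof.
have e c : rint (fun=> c) a b = c * (b - a).
  have dF (t : R) : is_derive t 1 (c *: (@id R)) c.
    by rewrite -[X in is_derive _ _ _ X]mulr1; apply: is_deriveZ.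
  have cc : continuous (fun _ : R => c) by move=> t; exact: cvg_cst.
  by rewrite (rintE a b cc dF) mulrBr.
case: k => k l; rewrite /cint !e; apply/eqP; rewrite eq_complex /=.
by apply/andP; split; apply/eqP; ring.
Qed.

Lemma rint_id a b : rint id a b = (b ^+ 2 - a ^+ 2) / 2.
Proof.
have dF (t : R) : is_derive t 1 (2^-1 *: ((@id R) * (@id R))) t.
  have {2}-> : t = 2^-1 *: (t *: 1 + t *: 1) :> R.
    by rewrite /GRing.scale /=; field.
  by apply: is_deriveZ.
have cc : continuous (fun t : R => t) by move=> t; exact: cvg_id.
by rewrite (rintE a b cc dF) -[LHS]/(2^-1 * (b * b) - 2^-1 * (a * a)); field.
Qed.

Lemma cint_h y a b : cint (fun t => t +i* y) a b =
  ((b ^+ 2 - a ^+ 2) / 2) +i* (y * (b - a)).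
Proof.
have := cint_cst (y%:C) a b; rewrite /cint /= => -[e _].
by rewrite -rint_id -[y * _]subr0 -[in RHS](mul0r 0) -e.
Qed.

Lemma cint_v x a b : cint (fun t => x +i* t) a b =
  (x * (b - a)) +i* ((b ^+ 2 - a ^+ 2) / 2).
Proof.
have := cint_cst (x%:C) a b; rewrite /cint /= => -[e _].
by rewrite -rint_id -[x * _]subr0 -[in RHS](mul0r 0) -e.
Qed.

(** The base of Goursat's theorem: near a point a differentiable function is affine
    up to an error of first order. *)
Lemma rect_affine k d a b x y : rect (fun z => k + d * z) a b x y = 0.
Proof.
have ph c : cpath (fun t : R => t +i* c).
  by split => t; [exact: cvg_id|exact: cvg_cst].
have pv c : cpath (fun t : R => c +i* t).
  by split => t; [exact: cvg_cst|exact: cvg_id].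
have pk := cpath_cst k; have qh c := cpathZ d (ph c); have qv c := cpathZ d (pv c).
rewrite /rect !cintD //.
rewrite !cintZ // !cint_cst !cint_h !cint_v.
case: k {pk} => k l; case: d {qh qv} => m n; apply/eqP; rewrite eq_complex /=.
by apply/andP; split; apply/eqP; field.
Qed.

(** Endpoints are not ordered, so that rectangles may be cut at a point without
    distinguishing cases. *)
Definition btw a b x := (a <= x <= b) || (b <= x <= a).

Definition inrect a b x y z := btw a b (Re z) && btw x y (Im z).

Lemma btw_dist a b x : `|x - a| <= `|b - a| -> `|x - b| <= `|b - a| -> btw a b x.
Proof.
have [ab|ba] := leP 0 (b - a).
  by rewrite (ger0_norm ab) !ler_norml => /andP[? ?] /andP[? ?];
    apply/orP; left; apply/andP; split; lra.
by rewrite (ltr0_norm ba) !ler_norml => /andP[? ?] /andP[? ?];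
    apply/orP; right; apply/andP; split; lra.
Qed.

Lemma dist_btw a b x (p : R) : btw a b x -> btw a b p -> `|x - p| <= `|b - a|.
Proof.
have [ab|ba] := leP 0 (b - a).
  rewrite (ger0_norm ab) ler_norml.
  by case/orP=> /andP[? ?] /orP[] /andP[? ?]; apply/andP; split; lra.
rewrite (ltr0_norm ba) ler_norml.
by case/orP=> /andP[? ?] /orP[] /andP[? ?]; apply/andP; split; lra.
Qed.

Lemma btwl a b : btw a b a.
Proof. by rewrite /btw lexx /= andbT; case: leP => // /ltW ->. Qed.

Lemma btwr a b : btw a b b.
Proof. by rewrite /btw lexx /= andbT; case: leP => // /ltW ->. Qed.

Lemma btwC a b x : btw a b x = btw b a x.
Proof. by rewrite /btw orbC. Qed.

Lemma btw_trans a b (p x : R) : btw a b p -> btw p b x -> btw a b x.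
Proof.
by case/orP=> /andP[? ?] /orP[] /andP[? ?]; apply/orP; first
  [left; apply/andP; split; lra|right; apply/andP; split; lra].
Qed.

Lemma rect_le f a b x y (M : R) : (forall z, ccont f z) ->
  (forall z, inrect a b x y z -> nrm (f z) <= M) ->
  nrm (rect f a b x y) <= 4 * M * (`|b - a| + `|y - x|).
Proof.
move=> cf H.
have h c : btw x y c -> nrm (cint (fun t => f (t +i* c)) a b) <= 2 * M * `|b - a|.
  move=> xyc; apply: cint_le; first exact: cpath_h.
  by move=> t ta tb; apply: H; rewrite /inrect /= xyc btw_dist.
have v c : btw a b c -> nrm ('i * cint (fun t => f (c +i* t)) x y) <= 2 * M * `|y - x|.
  move=> abc; apply: le_trans (nrmM _ _) _.
  rewrite {1}/nrm /= normr0 normr1 add0r mul1r.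
  apply: cint_le; first exact: cpath_v.
  by move=> t ta tb; apply: H; rewrite /inrect /= abc btw_dist.
have h1 := h _ (btwl x y); have h2 := h _ (btwr x y).
have v1 := v _ (btwl a b); have v2 := v _ (btwr a b).
rewrite /rect; move: h1 h2 v1 v2.
set A := cint _ _ _; set C := cint _ _ _; set D := 'i * _; set B := 'i * _.
move=> h1 h2 v1 v2; have n1 := nrmD (A + B - C) (- D).
have n2 := nrmD (A + B) (- C); have n3 := nrmD A B.
rewrite !nrmN in n1 n2 *; rewrite mulrDr (_ : 4 * M = 2 * M + 2 * M); last by ring.
by rewrite !mulrDl; lra.
Qed.

Lemma nested_intervals (u v : nat -> R) : (forall n, u n <= u n.+1) ->
  (forall n, v n.+1 <= v n) -> (forall n, u n <= v n) ->
  exists p : R, forall n, u n <= p <= v n.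
Proof.
move=> uu vv uv.
have um : {homo u : m n / (m <= n)%N >-> m <= n}.
  by apply: homo_leq => //; exact: le_trans.
have vm : {homo v : m n / (m <= n)%N >-> n <= m}.
  by apply: homo_leq => // x y z h1 h2; exact: le_trans h2 h1.
have uvmn m n : u m <= v n.
  apply: le_trans (um _ _ (leq_maxl m n)) _.
  by apply: le_trans (uv _) _; exact: vm (leq_maxr m n).
have hu : has_ubound (range u) by exists (v 0) => _ [m _ <-].
exists (sup (range u)) => n; apply/andP; split.
  by apply: ub_le_sup => //; exists n.
by apply: ge_sup; [exists (u 0); exists 0|move=> _ [m _ <-]].
Qed.

Lemma exists_small_pow (c r : R) : 0 < r -> exists n, c / 2 ^+ n < r.
Proof.
move=> r0; have [n hn] : exists n : nat, c / r < n%:R.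
  exists (Num.bound `|c / r|).
  by apply: le_lt_trans (ler_norm _) _; exact: archi_boundP.
exists n; rewrite ltr_pdivrMr ?exprn_gt0 // -ltr_pdivrMl // mulrC.
apply: lt_trans hn _; rewrite -natrX ltr_nat; exact: ltn_expl.
Qed.

Lemma quarter_le (N n1 n2 n3 n4 : R) : N <= n1 + n2 + (n3 + n4) ->
  [\/ N <= 4 * n1, N <= 4 * n2, N <= 4 * n3 | N <= 4 * n4].
Proof.
move=> le; have [h1|h1] := leP N (4 * n1); first exact: Or41.
have [h2|h2] := leP N (4 * n2); first exact: Or42.
have [h3|h3] := leP N (4 * n3); first exact: Or43.
by apply: Or44; lra.
Qed.

(** Bisection: the quarter with the largest integral is retained at each step, so that
    the integral loses at most a factor 4 each time.  Around the limit point the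
    affine approximation contributes nothing, and the integral of the error is bounded
    by an arbitrarily small multiple of 4^-n. *)
Lemma goursat_pos f a x (w h : R) : 0 <= w -> 0 <= h -> (forall z, ccont f z) ->
  (forall z, inrect a (a + w) x (x + h) z -> exists d, cderiv f z d) ->
  rect f a (a + w) x (x + h) = 0.
Proof.
move=> w0 h0 cf df.
pose W n := w / 2 ^+ n; pose H n := h / 2 ^+ n.
have WS n : W n = W n.+1 + W n.+1.
  by rewrite /W exprS; field; rewrite expf_neq0 // pnatr_eq0.
have HS n : H n = H n.+1 + H n.+1.
  by rewrite /H exprS; field; rewrite expf_neq0 // pnatr_eq0.
have W0 n : 0 <= W n by rewrite divr_ge0 ?exprn_ge0.
have H0 n : 0 <= H n by rewrite divr_ge0 ?exprn_ge0.
pose E (s : nat * (R * R)) :=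
  rect f s.2.1 (s.2.1 + W s.1) s.2.2 (s.2.2 + H s.1).
have /choice[step stepP] (s : nat * (R * R)) : exists t : R * R,
    [/\ s.2.1 <= t.1 <= s.2.1 + W s.1.+1,
        s.2.2 <= t.2 <= s.2.2 + H s.1.+1 &
        nrm (E s) <= 4 * nrm (E (s.1.+1, t))].
  case: s => [n [b y]] /=.
  have e : E (n, (b, y)) = E (n.+1, (b, y)) + E (n.+1, (b + W n.+1, y))
     + (E (n.+1, (b, y + H n.+1)) + E (n.+1, (b + W n.+1, y + H n.+1))).
    have eW t : t + W n.+1 + W n.+1 = t + W n by rewrite -addrA -WS.
    have eH t : t + H n.+1 + H n.+1 = t + H n by rewrite -addrA -HS.
    by rewrite /E /= !rect_catx !eW rect_caty eH.
  set e1 := E (n.+1, _) in e; set e2 := E (n.+1, (b + _, y)) in e.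
  set e3 := E (n.+1, (b, y + _)) in e; set e4 := E (n.+1, (b + _, y + _)) in e.
  have hW := W0 n.+1; have hH := H0 n.+1.
  have le : nrm (E (n, (b, y))) <= nrm e1 + nrm e2 + (nrm e3 + nrm e4).
    rewrite e; apply: le_trans (nrmD _ _) _.
    by apply: lerD; exact: nrmD.
  case: (quarter_le le) => h1; [exists (b, y)|exists (b + W n.+1, y)|
    exists (b, y + H n.+1)|exists (b + W n.+1, y + H n.+1)]; split => //=;
    by rewrite ?lexx ?lerDl ?hW ?hH.
pose s := fix s n := if n is m.+1 then step (m, s m) else (a, x).
have sP n := stepP (n, s n).
have [px pxP] : exists p : R, forall n, (s n).1 <= p <= (s n).1 + W n.
  apply: nested_intervals => n; last by rewrite lerDl.
    by have [/andP[]] := sP n.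
  by have [/andP[_ /= h1] _ _] := sP n; rewrite [in leRHS]WS; lra.
have [py pyP] : exists p : R, forall n, (s n).2 <= p <= (s n).2 + H n.
  apply: nested_intervals => n; last by rewrite lerDl.
    by have [_ /andP[]] := sP n.
  by have [_ /andP[_ /= h1] _] := sP n; rewrite [in leRHS]HS; lra.
have W_0 : W 0 = w by rewrite /W expr0 divr1.
have H_0 : H 0 = h by rewrite /H expr0 divr1.
have [d dP] : exists d, cderiv f (px +i* py) d.
  apply: df; rewrite /inrect /btw /=.
  by have /= := pxP 0; have /= := pyP 0; rewrite W_0 H_0 => -> ->.
(* c is the modulus to be shown zero; e is small enough for the final
   estimate to bound it by less than c / 2 *)
set c := nrm (rect f a (a + w) x (x + h)).
have cn n : c <= 4 ^+ n * nrm (E (n, s n)).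
  elim: n => [|n IH]; first by rewrite expr0 mul1r /E /= W_0 H_0.
  apply: le_trans IH _; have [_ _ /= h1] := sP n.
  by rewrite exprSr -mulrA ler_wpM2l ?exprn_ge0.
have [c0|c0] := leP c 0.
  by apply/eqP/negP => /negP /nrm_gt0; rewrite -/c => h1; lra.
pose q := w + h; have q0 : 0 <= q by rewrite addr_ge0.
have Q0 : 0 < 8 * (q ^+ 2 + 1) by rewrite mulr_gt0 // ltr_wpDl ?sqr_ge0.
have e0 : 0 < c / (8 * (q ^+ 2 + 1)) by rewrite divr_gt0.
set e := c / _ in e0; have [r r0 rP] := dP e e0.
have [n nP] := exists_small_pow q r0.
pose g z := f (px +i* py) - d * (px +i* py) + d * z.
have cg z : ccont g z.
  move=> t t0; exists (t / (nrm d + 1)).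
    by rewrite divr_gt0 // ltr_wpDl ?nrm_ge0.
  move=> u hu; have -> : g u - g z = d * (u - z) by rewrite /g; ring.
  apply: le_lt_trans (nrmM _ _) _.
  have d1 : 0 < nrm d + 1 by rewrite ltr_wpDl ?nrm_ge0.
  apply: le_lt_trans (_ : (nrm d + 1) * nrm (u - z) < _).
    by rewrite ler_wpM2r ?nrm_ge0 // lerDl.
  by rewrite mulrC -ltr_pdivlMr.
have cfg z : ccont (fun z => f z + (- 1) * g z) z.
  move=> t t0; have t2 : 0 < t / 2 by rewrite divr_gt0.
  have [r1 r10 h1] := cf z _ t2; have [r2 r20 h2] := cg z _ t2.
  exists (Num.min r1 r2); first by rewrite lt_min r10.
  move=> u; rewrite lt_min => /andP[/h1 k1 /h2 k2].
  have -> : f u + -1 * g u - (f z + -1 * g z) = (f u - f z) + - (g u - g z) by ring.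
  by have := nrmD (f u - f z) (- (g u - g z)); rewrite nrmN; lra.
have cg' z : ccont (fun z => (-1) * g z) z.
  move=> t /(cg z)[r1 r10 h1]; exists r1 => // u /h1.
  by rewrite -mulrBr mulN1r nrmN.
have : rect (fun z => f z + (-1) * g z) (s n).1 ((s n).1 + W n) (s n).2 ((s n).2 + H n)
     = E (n, s n).
  rewrite rectD // /E /= -[RHS]addr0; congr (_ + _).
  have -> : (fun z => -1 * g z) =
      (fun z => (- f (px +i* py) + d * (px +i* py)) + (- d) * z).
    by apply/funext => z; rewrite /g; ring.
  exact: rect_affine.
set E' := E _ => eE'.
have eW : (s n).1 + W n - (s n).1 = W n by rewrite addrAC subrr add0r.
have eH : (s n).2 + H n - (s n).2 = H n by rewrite addrAC subrr add0r.
have qn : W n + H n = q / 2 ^+ n by rewrite /W /H -mulrDl.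
have : nrm E' <= 4 * (e * (q / 2 ^+ n)) * (`|(s n).1 + W n - (s n).1| + `|(s n).2 + H n - (s n).2|).
  rewrite -eE'; apply: rect_le => // z /andP[zx zy].
  have bx : btw (s n).1 ((s n).1 + W n) px by rewrite /btw pxP.
  have by_ : btw (s n).2 ((s n).2 + H n) py by rewrite /btw pyP.
  have hz : nrm (z - (px +i* py)) <= q / 2 ^+ n.
    have h1 := dist_btw zx bx; have h2 := dist_btw zy by_.
    rewrite eW (ger0_norm (W0 n)) in h1; rewrite eH (ger0_norm (H0 n)) in h2.
    by rewrite -qn; case: z {zx zy} h1 h2 => z1 z2 /=; exact: lerD.
  have -> : f z + -1 * g z = f z - f (px +i* py) - d * (z - (px +i* py)).
    by rewrite /g; ring.
  apply: le_trans (rP _ _) _; first exact: le_lt_trans hz nP.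
  by rewrite ler_wpM2l // ltW.
rewrite eW eH (ger0_norm (W0 n)) (ger0_norm (H0 n)) qn => hE.
have : c <= 4 * (e * q) * q.
  apply: le_trans (cn n) _.
  apply: le_trans (ler_wpM2l (exprn_ge0 n (ler0n R 4)) hE) _.
  have -> : 4 ^+ n = 2 ^+ n * 2 ^+ n :> R by rewrite -exprMn -natrM.
  rewrite le_eqVlt; apply/orP; left; apply/eqP; field.
  by rewrite expf_neq0 // pnatr_eq0.
have -> : 4 * (e * q) * q = c * (4 * q ^+ 2) / (8 * (q ^+ 2 + 1)).
  by rewrite /e; field; rewrite gt_eqF // ltr_wpDl ?sqr_ge0.
rewrite ler_pdivlMr // ler_pM2l //.
by have := sqr_ge0 q; move=> h1 h2; exfalso; lra.
Qed.

Lemma goursat f a b x y : (forall z, ccont f z) ->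
  (forall z, inrect a b x y z -> exists d, cderiv f z d) ->
  rect f a b x y = 0.
Proof.
move=> cf.
wlog ab : a b / a <= b.
  move=> H h; have [|/ltW ba] := leP a b; first by move=> /H; apply.
  rewrite rect_swapx H ?oppr0 // => z hz; apply: h.
  by rewrite /inrect btwC.
wlog xy : x y / x <= y.
  move=> H h; have [|/ltW ba] := leP x y; first by move=> /H; apply.
  rewrite rect_swapy H ?oppr0 // => z hz; apply: h.
  by rewrite /inrect [btw x y _]btwC.
move=> df; have eb : b = a + (b - a) by rewrite addrC subrK.
have ey : y = x + (y - x) by rewrite addrC subrK.
by rewrite eb ey goursat_pos ?subr_ge0 // -eb -ey.
Qed.

Definition avoids a b x y (s : seq R[i]) := all (fun p => ~~ inrect a b x y p) s.

Lemma avoids_sub a b x y a' b' x' y' s :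
  (forall z, inrect a' b' x' y' z -> inrect a b x y z) ->
  avoids a b x y s -> avoids a' b' x' y' s.
Proof. by move=> sub; apply: sub_all => p; apply: contra; exact: sub. Qed.

Lemma btw_scale a b (t : R) : 0 <= t <= 1 -> btw a b (a + t * (b - a)).
Proof.
move=> /andP[t0 t1]; have [ab|ba] := leP a b; apply/orP; [left|right].
  have h1 : 0 <= t * (b - a) by rewrite mulr_ge0 ?subr_ge0.
  have h2 : t * (b - a) <= b - a by rewrite ler_piMl ?subr_ge0.
  by apply/andP; split; lra.
have h1 : 0 <= t * (a - b) by rewrite mulr_ge0 ?subr_ge0 // ltW.
have h2 : t * (a - b) <= a - b by rewrite ler_piMl ?subr_ge0 // ltW.
by apply/andP; split; lra.
Qed.

Lemma btw_escape a b (t : R) : 0 < t -> a != b -> ~~ btw (a + t * (b - a)) b a.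
Proof.
move=> t0 ab; apply/negP; case/orP => /andP[h1 h2].
  have : t * (b - a) <= 0 by lra.
  by rewrite pmulr_rle0 // => h3; move/eqP: ab; apply; lra.
have : t * (a - b) <= 0 by lra.
by rewrite pmulr_rle0 // => h3; move/eqP: ab; apply; lra.
Qed.

(** A point at which the function is only continuous can be cut off in a corner
    of arbitrarily small perimeter. *)
Lemma rect_corner f s (px py b y : R) : (forall z, ccont f z) ->
  (forall a b x y, avoids a b x y ((px +i* py) :: s) -> rect f a b x y = 0) ->
  avoids px b py y s -> rect f px b py y = 0.
Proof.
move=> cf H hs.
have [->|pb] := eqVneq px b; first exact: rectxx.
have [->|py'] := eqVneq py y; first exact: rectyy.
pose X t := px + t * (b - px); pose Y t := py + t * (y - py).
have e t : 0 < t <= 1 -> rect f px b py y = rect f px (X t) py (Y t).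
  move=> /andP[t0 t1]; have t01 : 0 <= t <= 1 by rewrite ltW.
  have bX := btw_scale px b t01; have bY := btw_scale py y t01.
  have XX u : btw px (X t) u -> btw px b u.
    by rewrite btwC => h; rewrite btwC; apply: btw_trans h; rewrite btwC.
  have XX' u : btw (X t) b u -> btw px b u by exact: btw_trans.
  have YY' u : btw (Y t) y u -> btw py y u by exact: btw_trans.
  rewrite -(rect_catx f px (X t)) -(rect_caty f px (X t) py (Y t)).
  rewrite (H (X t) b) ?(H px (X t) (Y t)) ?addr0 //=.
    rewrite /inrect /= negb_and btw_escape //= orbT /=.
    by apply: avoids_sub hs => z /andP[/XX h1 /YY' h2]; rewrite /inrect h1.
  rewrite /inrect /= negb_and btw_escape //=.
  by apply: avoids_sub hs => z /andP[/XX' h1 h2]; rewrite /inrect h1.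
have [r r0 Hr] := cf (px +i* py) 1 ltr01.
apply/eqP/negP => /negP /nrm_gt0; set c := nrm _ => c0.
pose q := `|b - px| + `|y - py|; have q0 : 0 <= q by rewrite addr_ge0.
pose M := nrm (f (px +i* py)) + 1.
have M0 : 0 < M by rewrite ltr_wpDl ?nrm_ge0.
have bound t : 0 < t <= 1 -> t * q < r -> c <= 4 * M * (t * q).
  move=> /[dup] t01 /andP[t0 t1] tq; rewrite /c (e t t01).
  have eX : `|X t - px| = t * `|b - px|.
    by rewrite /X addrAC subrr add0r normrM gtr0_norm.
  have eY : `|Y t - py| = t * `|y - py|.
    by rewrite /Y addrAC subrr add0r normrM gtr0_norm.
  apply: (le_trans (rect_le (M := M) cf _)); last first.
    by rewrite eX eY -mulrDr.
  case=> z1 z2 /andP[/= h1 h2].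
  have hz : nrm ((z1 +i* z2) - (px +i* py)) < r.
    apply: le_lt_trans tq; rewrite /q mulrDr -eX -eY.
    by apply: lerD; apply: dist_btw => //; exact: btwl.
  have := Hr _ hz; have := nrmD (f (z1 +i* z2) - f (px +i* py)) (f (px +i* py)).
  by rewrite subrK /M => k1 k2; lra.
pose m := Num.min 1 (Num.min (r / (q + 1)) (c / (8 * M * (q + 1)))).
have q1 : 0 < q + 1 by rewrite ltr_wpDl.
have m0 : 0 < m by rewrite !lt_min ltr01 !divr_gt0 ?mulr_gt0.
have m1 : m <= 1 by rewrite ge_min lexx.
have mr : m * (q + 1) <= r by rewrite -ler_pdivlMr // !ge_min lexx orbT.
have mc : m * (8 * M * (q + 1)) <= c.
  by rewrite -ler_pdivlMr ?mulr_gt0 // !ge_min lexx !orbT.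
have m01 : 0 < m <= 1 by rewrite m0.
have mq : m * q < r by apply: lt_le_trans mr; rewrite ltr_pM2l // ltrDl.
have := bound m m01 mq.
have h0 : 0 <= M * (m * q) by rewrite !mulr_ge0 // ltW.
have h1 : 0 < m * M by rewrite mulr_gt0.
have -> : 4 * M * (m * q) = 4 * (M * (m * q)) by ring.
have : m * (8 * M * (q + 1)) = 8 * (M * (m * q)) + 8 * (m * M) by ring.
by clearbody c; move: h0 h1 mc c0; clear; move=> *; lra.
Qed.

Lemma btw_sub (a b u v x : R) : btw a b u -> btw a b v -> btw u v x -> btw a b x.
Proof.
by case/orP=> /andP[? ?] /orP[] /andP[? ?] /orP[] /andP[? ?];
  apply/orP; first [left; apply/andP; split; lra|right; apply/andP; split; lra].
Qed.

(** Induction on the exceptional points: a rectangle containing such a point p is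
    split into four rectangles having p as a corner. *)
Lemma goursat_except f (s : seq R[i]) : (forall z, ccont f z) ->
  (forall z, z \notin s -> exists d, cderiv f z d) ->
  forall a b x y, rect f a b x y = 0.
Proof.
move=> cf df.
have : forall a b x y, avoids a b x y s -> rect f a b x y = 0.
  move=> a b x y hs; apply: goursat => // z hz; apply: df.
  by apply: contraL hz => zs; exact: (allP hs).
elim: s {df} => [|p s IH] H; first by move=> a b x y; exact: H.
apply: IH => a b x y hs.
have [/andP[pab pxy]|np] := boolP (inrect a b x y p); last first.
  by apply: H; rewrite /= np.
case: p H pab pxy => p q H /= pab pxy.
have corner b' y' : btw a b b' -> btw x y y' -> rect f p b' q y' = 0.
  move=> ab' xy'; apply: rect_corner (s) _ _ _ _ cf H _.
  apply: avoids_sub hs => z /andP[h1 h2]; apply/andP; split.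
    exact: btw_sub h1.
  exact: btw_sub h2.
have caty u v : rect f u v x y = rect f u v q y - rect f u v q x.
  by rewrite -(rect_caty f u v x q y) (rect_swapy f u v q x) addrC.
have -> : rect f a b x y = rect f p b x y - rect f p a x y.
  by rewrite -(rect_catx f a p b) (rect_swapx f p a) addrC.
rewrite !caty (corner b y) ?(corner b x) ?(corner a y) ?(corner a x);
  by rewrite ?btwl ?btwr ?subrr.
Qed.

End Goursat.

(** * Complex differentiability and difference quotients *)

Section Transfer.
Variable R : realType.
Local Notation K := (Cplx R).
Implicit Types (f g : K -> K) (z w d : K) (s : seq K).

(** The two norms bound each other, so they define the same neighbourhoods. *)
Lemma normc_le_nrm z : `|z| <= (nrm z)%:C.
Proof.
case: z => a b; rewrite normc_def lecR /nrm /= -[leRHS]ger0_norm ?addr_ge0 //.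
rewrite -sqrtr_sqr ler_wsqrtr // sqrrD !real_normK ?num_real //.
have : 0 <= `|a| * `|b| by rewrite mulr_ge0.
by move: (_ * _) (_ ^+ 2) (_ ^+ 2) => u v w; lra.
Qed.

Lemma nrm_le_normc z : (nrm z)%:C <= 2 * `|z|.
Proof.
case: z => a b; rewrite normc_def /nrm /=.
have -> : 2 = 2%:C :> R[i] by rewrite rmorphMn rmorph1.
rewrite -rmorphM lecR mulr_natl mulr2n.
have h (c d : R) : `|c| <= Num.sqrt (c ^+ 2 + d ^+ 2) :> R.
  by rewrite -sqrtr_sqr ler_wsqrtr // lerDl sqr_ge0.
by apply: lerD => //; rewrite addrC.
Qed.

Lemma posC (e : K) : 0 < e -> 0 < Re e /\ e = (Re e)%:C.
Proof.
by case: e => a b; rewrite ltcE /= => /andP[/eqP -> ?].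
Qed.

Lemma near_nrm (P : set K) z : (\forall w \near z, P w) <->
  exists2 r : R, 0 < r & forall w, nrm (w - z) < r -> P w.
Proof.
split.
  move=> /nbhs_ballP[e /posC[e0 ee] H]; exists (Re e) => // w hw; apply: H.
  rewrite /ball /= distrC ee; apply: le_lt_trans (normc_le_nrm _) _.
  by rewrite ltcR.
move=> [r r0 H]; apply/nbhs_ballP; exists (r / 2)%:C => /=.
  by rewrite ltcR divr_gt0.
move=> w; rewrite /ball /= distrC => hw; apply: H.
rewrite -ltcR; apply: le_lt_trans (nrm_le_normc _) _.
by rewrite -ltr_pdivlMl // mulrC; move: hw; rewrite fmorph_div rmorphMn rmorph1.
Qed.

Lemma near'_nrm (P : set K) z : (\forall w \near z^', P w) <->
  exists2 r : R, 0 < r & forall w, w != z -> nrm (w - z) < r -> P w.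
Proof.
split=> [h|[r r0 H]].
  have /near_nrm[r r0 H] : \forall w \near z, w != z -> P w := h.
  by exists r => // w h1 h2; exact: H.
have : \forall w \near z, w != z -> P w.
  by apply/near_nrm; exists r => // w h1 h2; exact: H.
done.
Qed.

Lemma continuous_ccont f z : {for z, continuous f} <-> ccont f z.
Proof.
split.
  move=> cf e e0.
  have e20 : 0 < (e / 2)%:C :> K by rewrite ltcR divr_gt0.
  move: cf => /cvgrPdist_lt/(_ _ e20)/near_nrm[r r0 H].
  exists r => // w /H; rewrite distrC => h; rewrite -ltcR.
  apply: le_lt_trans (nrm_le_normc _) _; rewrite -ltr_pdivlMl // mulrC.
  by move: h; rewrite fmorph_div rmorphMn rmorph1.
move=> cf; apply/(cvgrPdist_lt (F := nbhs z)) => e /posC[e0 ee].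
have [r r0 H] := cf _ e0; apply/near_nrm; exists r => // w /H h.
by rewrite distrC ee; apply: le_lt_trans (normc_le_nrm _) _; rewrite ltcR.
Qed.

Lemma derivable_cderiv f z : derivable f z 1 -> exists d, cderiv f z d.
Proof.
move=> /cvg_ex[d hd]; exists d => e e0.
have e20 : 0 < (e / 2)%:C :> K by rewrite ltcR divr_gt0.
move: hd => /cvgrPdist_lt/(_ _ e20)/near'_nrm[r r0 H].
exists r => // w hw; have [->|wz] := eqVneq w z.
  by rewrite !subrr mulr0 subr0 nrm0 mulr0.
have wz0 : w - z != 0 by rewrite subr_eq0.
have := H (w - z) wz0; rewrite subr0 => /(_ hw).
rewrite /= scaler1 subrK distrC => h.
have -> : f w - f z - d * (w - z) = ((w - z)^-1 *: (f w - f z) - d) * (w - z).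
  by rewrite mulrBl /GRing.scale /= mulrAC mulVf // mul1r.
apply: le_trans (nrmM _ _) _; rewrite ler_wpM2r ?nrm_ge0 //.
rewrite -lecR; apply: le_trans (nrm_le_normc _) _.
rewrite -ler_pdivlMl // mulrC; apply: ltW; move: h.
by rewrite fmorph_div rmorphMn rmorph1.
Qed.

Lemma derivable_continuous f z : derivable f z 1 -> {for z, continuous f}.
Proof. by move=> /derivable1_diffP/differentiable_continuous. Qed.

(** The difference quotient at b, with value d at b itself: it is differentiable
    where f is, except at b, where it is only continuous if f is differentiable there
    with derivative d.  This is why Goursat's theorem is needed with exceptions. *)
Definition divdiff f b d z : K := if z == b then d else (f z - f b) / (z - b).

Lemma near_neq (z b : K) : z != b -> \forall w \near z, w != b.
Proof.
move=> zb; apply/near_nrm; exists (nrm (z - b)).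
  by rewrite nrm_gt0 // subr_eq0.
by move=> w; apply: contraTneq => ->; rewrite -nrmN opprB ltxx.
Qed.

Lemma divdiff_eq f b d z : z != b ->
  \forall w \near z, (f w - f b) / (w - b) = divdiff f b d w.
Proof.
move=> /near_neq; apply: filterS => w wb.
by rewrite /divdiff (negPf wb).
Qed.

Lemma derivable_divdiff f b d z : z != b -> derivable f z 1 ->
  derivable (divdiff f b d) z 1.
Proof.
move=> zb df; apply: near_eq_derivable (divdiff_eq f d zb) _.
apply: (@derivableM _ _ (fun w => f w - f b) (fun w => (w - b)^-1)).
  exact: (@derivableB K K K f (fun=> f b) z 1 df (derivable_cst _ _ _)).
apply: derivableV; first by rewrite subr_eq0.
have hb : derivable ((id : K -> K) - (fun=> b)) z 1.
  by apply: derivableB; [exact: derivable_id|exact: derivable_cst].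
exact: hb.
Qed.

Lemma continuous_divdiff f b d : continuous f -> cderiv f b d ->
  continuous (divdiff f b d).
Proof.
move=> cf df z; have [->|zb] := eqVneq z b.
  apply/continuous_ccont => e e0.
  have e40 : 0 < e / 4 by rewrite divr_gt0.
  have [r r0 H] := df _ e40; exists r => // w hw.
  rewrite {2}/divdiff eqxx /divdiff; case: eqVneq => [_|wb].
    by rewrite subrr nrm0.
  have wb0 : w - b != 0 by rewrite subr_eq0.
  have -> : (f w - f b) / (w - b) - d = (f w - f b - d * (w - b)) / (w - b).
    by rewrite [RHS]mulrBl mulfK.
  apply: le_lt_trans (nrmM _ _) _.
  apply: le_lt_trans (ler_wpM2r (nrm_ge0 _) (H w hw)) _.
  have h := nrmV (w - b).
  apply: (@le_lt_trans _ _ ((e / 4) * (nrm (w - b)^-1 * nrm (w - b)))).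
    by rewrite le_eqVlt; apply/orP; left; apply/eqP; ring.
  apply: (@le_lt_trans _ _ (e / 4 * 2)); first by rewrite ler_wpM2l // ltW.
  by clear -e0; lra.
have hn : {for z, continuous (f - (fun=> f b))}.
  by apply: continuousB; [exact: cf|exact: cst_continuous].
have hd : {for z, continuous ((id : K -> K) - (fun=> b))}.
  by apply: continuousB; [exact: cvg_id|exact: cst_continuous].
have zb0 : ((id : K -> K) - (fun=> b)) z != 0.
  by rewrite [X in X != 0](_ : _ = z - b) ?subr_eq0.
have h : {for z, continuous (fun w => (f w - f b) / (w - b))}.
  exact: continuousM hn (continuousV zb0 hd).
have e := divdiff_eq f d zb.
have ez : (f z - f b) / (z - b) = divdiff f b d z.
  by rewrite /divdiff (negPf zb).
have h' : (f w - f b) / (w - b) @[w --> z] --> (f z - f b) / (z - b) := h.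
by rewrite ez in h'; exact: (cvg_trans (near_eq_cvg e) h').
Qed.

End Transfer.

(** * Entire functions of polynomial growth *)

Section Growth.
Variable R : realType.
Local Notation K := (Cplx R).
Implicit Types (f g : K -> K) (z w d : K) (s : seq K).

Lemma notin_exists s : exists a, a \notin s.
Proof.
exists (1 + \sum_(x <- s) `|x|); apply/negP => h.
have : `|1 + \sum_(x <- s) `|x| : K| <= \sum_(x <- s) `|x|.
  move: h; set a := 1 + _ => h; rewrite [leRHS](perm_big _ (perm_to_rem h)) /=.
  by rewrite big_cons lerDl sumr_ge0.
rewrite ger0_norm ?addr_ge0 ?sumr_ge0 // gerDr => /le_lt_trans/(_ ltr01).
by rewrite ltxx.
Qed.

(** If m is within 1 / (4 L) of 1 / (z - b) on the boundary of the square of half-side L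
    around b, each side contributes at least 1 / 2 to the imaginary part of the
    contour integral: 1 / (z - b) alone contributes at least 1 on each. *)
Lemma rect_pole_neq0 m (b1 b2 L : R) : 0 < L -> (forall z, ccont m z) ->
  (forall z, inrect (b1 - L) (b1 + L) (b2 - L) (b2 + L) z ->
     L <= nrm (z - (b1 +i* b2)) ->
     nrm (m z - (z - (b1 +i* b2))^-1) <= 1 / (4 * L)) ->
  rect m (b1 - L) (b1 + L) (b2 - L) (b2 + L) != 0.
Proof.
move=> L0 cm H.
have L4 : 1 / (4 * L) * (b1 + L - (b1 - L)) = 1 / 2.
  by field; rewrite gt_eqF.
have L4' : 1 / (4 * L) * (b2 + L - (b2 - L)) = 1 / 2.
  by field; rewrite gt_eqF.
have inv (p q : R) : `|p| = L -> `|q| <= L -> 1 / (2 * L) <= `|p| / (p ^+ 2 + q ^+ 2).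
  move=> pL qL; have q2 : q ^+ 2 <= L ^+ 2.
    by rewrite -[q ^+ 2]real_normK ?num_real // lerXn2r // ?nnegrE // ltW.
  have p2 : p ^+ 2 = L ^+ 2 by rewrite -pL real_normK ?num_real.
  have L2 : 0 < L ^+ 2 by rewrite exprn_gt0.
  have q20 := sqr_ge0 q.
  rewrite p2 pL ler_pdivlMr; last by lra.
  rewrite mulrAC ler_pdivrMr ?mulr_gt0 // mul1r [leRHS](_ : _ = 2 * L ^+ 2); last by ring.
  lra.
have inL : btw (b1 - L) (b1 + L) (b1 - L) /\ btw (b2 - L) (b2 + L) (b2 - L).
  by split; exact: btwl.
have inR : btw (b1 - L) (b1 + L) (b1 + L) /\ btw (b2 - L) (b2 + L) (b2 + L).
  by split; exact: btwr.
have L42 : 1 / (2 * L) = 2 * (1 / (4 * L)) by field; rewrite gt_eqF.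
have btwL (c t : R) : c - L <= t <= c + L -> `|t - c| <= L /\ btw (c - L) (c + L) t.
  move=> /[dup] h /andP[h1 h2]; split; last by rewrite /btw h.
  by rewrite ler_norml; apply/andP; split; lra.
(* On a vertical side only the real part of m matters, on a horizontal side only its
   imaginary part; p and q are the coordinates of z - b. *)
have side (p q c : R) z : z - (b1 +i* b2) = p +i* q ->
    inrect (b1 - L) (b1 + L) (b2 - L) (b2 + L) z ->
    (`|p| = L -> `|q| <= L -> `|Re (m z) - p / (p ^+ 2 + q ^+ 2)| <= 1 / (4 * L)) /\
    (`|q| = L -> `|p| <= L -> `|Im (m z) + q / (p ^+ 2 + q ^+ 2)| <= 1 / (4 * L)).
  move=> ez hz; have := H z hz; rewrite ez {1}/nrm /=.
  case: (m z) => u v; rewrite /nrm /= opprK => h; split=> [pL qL|qL pL].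
    have /h : L <= `|p| + `|q| by rewrite pL lerDl.
    by apply: le_trans; rewrite lerDl.
  have /h : L <= `|p| + `|q| by rewrite qL lerDr.
  by apply: le_trans; rewrite lerDr.
have nL : `|L| = L by rewrite gtr0_norm.
have nNL : `|- L| = L by rewrite normrN.
have cr x : continuous (fun t => Re (m (x +i* t))) by have [] := cpath_v x cm.
have ci y : continuous (fun t => Im (m (t +i* y))) by have [] := cpath_h y cm.
have l1 : b1 - L <= b1 + L by lra.
have l2 : b2 - L <= b2 + L by lra.
have nz t c : c - L <= t <= c + L -> `|t - c| <= L by case/btwL.
have right : 1 / 2 <= rint (fun t => Re (m ((b1 + L) +i* t))) (b2 - L) (b2 + L).
  have [t tb ->] := rint_mvt l2 (cr (b1 + L)); have [t1 t2] := btwL _ _ tb.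
  rewrite -L4' ler_wpM2r ?subr_ge0 //.
  have [||h _] := @side L (t - b2) 0 ((b1 + L) +i* t).
  - by apply/eqP; rewrite eq_complex /= eqxx andbT; apply/eqP; ring.
  - by rewrite /inrect /= t2 inR.1.
  have := inv _ _ nL t1; have := h nL t1.
  by rewrite nL ler_norml L42 => /andP[k1 k2] k3; lra.
have left : rint (fun t => Re (m ((b1 - L) +i* t))) (b2 - L) (b2 + L) <= - (1 / 2).
  have [t tb ->] := rint_mvt l2 (cr (b1 - L)); have [t1 t2] := btwL _ _ tb.
  rewrite -L4' -mulNr ler_wpM2r ?subr_ge0 //.
  have [||h _] := @side (- L) (t - b2) 0 ((b1 - L) +i* t).
  - by apply/eqP; rewrite eq_complex /= eqxx andbT; apply/eqP; ring.
  - by rewrite /inrect /= t2 inL.1.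
  have := inv _ _ nNL t1; have := h nNL t1.
  by rewrite nNL ler_norml L42 mulNr => /andP[k1 k2] k3; lra.
have bottom : 1 / 2 <= rint (fun t => Im (m (t +i* (b2 - L)))) (b1 - L) (b1 + L).
  have [t tb ->] := rint_mvt l1 (ci (b2 - L)); have [t1 t2] := btwL _ _ tb.
  rewrite -L4 ler_wpM2r ?subr_ge0 //.
  have [||_ h] := @side (t - b1) (- L) 0 (t +i* (b2 - L)).
  - by apply/eqP; rewrite eq_complex /= eqxx /=; apply/eqP; ring.
  - by rewrite /inrect /= t2 inL.2.
  have := inv _ _ nNL t1; have := h nNL t1.
  by rewrite nNL ler_norml L42 mulNr (addrC ((t - b1) ^+ 2)) => /andP[k1 k2] k3; lra.
have top : rint (fun t => Im (m (t +i* (b2 + L)))) (b1 - L) (b1 + L) <= - (1 / 2).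
  have [t tb ->] := rint_mvt l1 (ci (b2 + L)); have [t1 t2] := btwL _ _ tb.
  rewrite -L4 -mulNr ler_wpM2r ?subr_ge0 //.
  have [||_ h] := @side (t - b1) L 0 (t +i* (b2 + L)).
  - by apply/eqP; rewrite eq_complex /= eqxx /=; apply/eqP; ring.
  - by rewrite /inrect /= t2 inR.2.
  have := inv _ _ nL t1; have := h nL t1.
  by rewrite nL ler_norml L42 (addrC ((t - b1) ^+ 2)) => /andP[k1 k2] k3; lra.
apply/eqP => /(congr1 (@complex.Im R)); rewrite /rect /cint /=.
move: bottom top left right; clear.
move: (rint _ _ _) (rint _ _ _) (rint _ _ _) (rint _ _ _) => x y z w.
by rewrite !mul0r !mul1r !add0r; lra.
Qed.

Lemma rect_pole_center_neq0 m b (L : R) : 0 < L -> (forall z, ccont m z) ->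
  (forall z, L <= nrm (z - b) -> nrm (m z - (z - b)^-1) <= 1 / (4 * L)) ->
  rect m (Re b - L) (Re b + L) (Im b - L) (Im b + L) != 0.
Proof.
by case: b => b1 b2 L0 cm H; apply: rect_pole_neq0 => // z _; exact: H.
Qed.

(** Otherwise - (f z - f b) / (f b (z - b)) has vanishing contour integrals by Goursat's
    theorem, while the decay of f puts it close to 1 / (z - b) on large squares. *)
Lemma decay_eq0 f s (B C : R) b : continuous f ->
  (forall z, z \notin s -> derivable f z 1) ->
  (forall z, B <= nrm z -> nrm (f z) * nrm z <= C) -> b \notin s -> f b = 0.
Proof.
move=> cf df H bs; apply/eqP/negP => /negP fb0.
have [d dP] := derivable_cderiv (df b bs).
pose m z := (- (f b)^-1) * divdiff f b d z.
have cdd := continuous_divdiff cf dP.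
have ck : (-%R (f b)^-1 : K) = - (f b)^-1 by [].
have cm z : ccont m z.
  apply/continuous_ccont; apply: (@continuousM _ _ (fun=> - (f b)^-1) (divdiff f b d)).
    exact: cst_continuous.
  exact: cdd.
have dm z : z \notin b :: s -> exists d', cderiv m z d'.
  rewrite inE negb_or => /andP[zb zs]; apply: derivable_cderiv.
  apply: (@derivableM K K (fun=> - (f b)^-1) (divdiff f b d)).
    exact: derivable_cst.
  by apply: derivable_divdiff => //; exact: df.
have R0 := goursat_except cm dm.
pose c := nrm (f b)^-1; have c0 : 0 < c by rewrite nrm_gt0 // invr_eq0.
have [C0 CC] : 0 <= Num.max C 0 /\ C <= Num.max C 0 by rewrite !le_max !lexx orbT.
set C' := Num.max C 0 in C0 CC.
have B0 := normr_ge0 B; have BB := ler_norm B.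
have b0 := nrm_ge0 b; have cC : 0 <= c * C' by rewrite mulr_ge0 // ltW.
pose L := 2 * (nrm b + `|B| + 16 * (c * C') + 1).
have L0 : 0 < L by rewrite /L; clearbody c C'; lra.
suff : forall z, L <= nrm (z - b) -> nrm (m z - (z - b)^-1) <= 1 / (4 * L).
  by move/(rect_pole_center_neq0 L0 cm); rewrite R0 eqxx.
move=> z Lz; have zb : z != b.
  by apply: contraTneq Lz => ->; rewrite subrr nrm0 leNgt L0.
have -> : m z - (z - b)^-1 = - (f z * ((f b)^-1 * (z - b)^-1)).
  rewrite /m /divdiff (negPf zb); field. by rewrite fb0 subr_eq0 zb.
have N1 : nrm (z - b) <= nrm z + nrm b by rewrite -(nrmN b) nrmD.
have z0 : 0 < nrm z by move: cC B0 b0 Lz N1; rewrite /L; clear; lra.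
have Lz2 : L / 2 <= nrm z by move: cC B0 b0 Lz N1; rewrite /L; clear; lra.
have Bz : B <= nrm z by move: cC BB B0 b0 Lz N1; rewrite /L; clear; lra.
have fz : nrm (f z) <= 2 * C' / L.
  rewrite ler_pdivlMr //; have := le_trans (H z Bz) CC.
  have : nrm (f z) * (L / 2) <= nrm (f z) * nrm z by rewrite ler_wpM2l ?nrm_ge0.
  by rewrite mulrA; clear; lra.
have zV : nrm (z - b)^-1 <= 2 / L.
  rewrite ler_pdivlMr //; apply: le_trans (nrmV (z - b)).
  by rewrite ler_wpM2l ?nrm_ge0.
rewrite nrmN; apply: le_trans (nrmM _ _) _.
apply: (@le_trans _ _ (2 * C' / L * (c * (2 / L)))).
  apply: ler_pM => //; rewrite ?nrm_ge0 //.
  by apply: le_trans (nrmM _ _) _; rewrite ler_pM2l.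
rewrite [leLHS](_ : _ = 4 * (c * C') / L / L); last by field; rewrite gt_eqF.
rewrite [leRHS](_ : _ = 1 / 4 / L); last by field; rewrite gt_eqF.
rewrite ler_pM2r ?invr_gt0 // ler_pdivrMr //.
by move: cC B0 b0; rewrite /L; clear; lra.
Qed.

(** Induction on n: the difference quotient at a point a grows with one degree less,
    and f z = f a + (z - a) divdiff f a d z. *)
Lemma growth_poly n f s (B C : R) : continuous f ->
  (forall z, z \notin s -> derivable f z 1) ->
  (forall z, B <= nrm z -> nrm (f z) * nrm z <= C * nrm z ^+ n) ->
  exists (p : {poly K}) (t : seq K), forall z, z \notin t -> f z = p.[z].
Proof.
elim: n f s B C => [|n IH] f s B C cf df H.
  exists 0, s => z zs; rewrite horner0.
  apply: (@decay_eq0 f s B C) => // w /H; by rewrite expr0 mulr1.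
have [a aS] := notin_exists s.
have [d dP] := derivable_cderiv (df a aS).
pose B' := `|B| + 2 * nrm a + 1; pose C' := 4 * (`|C| + nrm (f a)).
have [|||p [t pP]] := IH (divdiff f a d) (a :: s) B' C'.
- exact: continuous_divdiff.
- move=> z; rewrite inE negb_or => /andP[za zs].
  by apply: derivable_divdiff => //; exact: df.
- move=> z hz; have B0 := normr_ge0 B; have BB := ler_norm B.
  have a0 := nrm_ge0 a; have fa0 := nrm_ge0 (f a).
  have N1 : nrm z <= nrm (z - a) + nrm a.
    by have := nrmD (z - a) a; rewrite subrK.
  have z1 : 1 <= nrm z by move: B0 a0 hz; rewrite /B'; clear; lra.
  have z0 : 0 < nrm z by exact: lt_le_trans z1.
  have Bz : B <= nrm z by move: BB B0 a0 hz; rewrite /B'; clear; lra.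
  have z2 : nrm z <= 2 * nrm (z - a).
    by move: N1 B0 a0 hz; rewrite /B'; clear; lra.
  have za : z != a.
    by apply/eqP => e; move: z2; rewrite e subrr nrm0 mulr0 leNgt -e z0.
  have fz : nrm (f z) <= `|C| * nrm z ^+ n.
    rewrite -(ler_pM2r z0); apply: le_trans (H z Bz) _.
    rewrite exprSr mulrA ler_pM2r // ler_wpM2r ?exprn_ge0 ?nrm_ge0 //.
    exact: ler_norm.
  have zn : 1 <= nrm z ^+ n by rewrite exprn_ege1.
  rewrite /divdiff (negPf za).
  have h1 : nrm (f z - f a) <= (`|C| + nrm (f a)) * nrm z ^+ n.
    apply: le_trans (nrmD _ _) _; rewrite nrmN mulrDl lerD //.
    by rewrite ler_peMr.
  have h2 : nrm (z - a)^-1 * nrm z <= 4.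
    apply: le_trans (_ : nrm (z - a)^-1 * (2 * nrm (z - a)) <= _).
      by rewrite ler_wpM2l ?nrm_ge0.
    by have := nrmV (z - a); rewrite mulrCA; clear; lra.
  apply: le_trans (_ : nrm (f z - f a) * nrm (z - a)^-1 * nrm z <= _).
    by rewrite ler_wpM2r ?nrmM // ltW.
  rewrite -mulrA; apply: le_trans (_ : nrm (f z - f a) * 4 <= _).
    by rewrite ler_wpM2l ?nrm_ge0.
  by rewrite /C' mulrC -mulrA ler_pM2l.
exists (('X - a%:P) * p + (f a)%:P), (a :: t) => z; rewrite inE negb_or => /andP[za zt].
rewrite !hornerE -pP // /divdiff (negPf za); field.
by rewrite subr_eq0.
Qed.

End Growth.

(** * Meromorphic functions on the sphere *)

Section Rational.
Variable R : realType.
Local Notation K := (Cplx R).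
Implicit Types (f g : K -> K) (z w d : K) (s : seq K).

(** Compactness of a disc, in the form needed to find finitely many poles. *)
Lemma finite_cover (B : R) (r : K -> R) : (forall a, 0 < r a) ->
  exists s, forall z, nrm z <= B -> exists2 a, a \in s & nrm (z - a) < r a.
Proof.
move=> r0; pose I := `[- B, B]%classic : set R.
pose c (p : R * R) : K := p.1 +i* p.2.
have cc : continuous c.
  move=> p P /near_nrm[e e0 H]; apply/nbhs_ballP.
  exists (e / 2) => /=; first by rewrite divr_gt0.
  case: p H => p1 p2 H [q1 q2] [/= h1 h2]; apply: H.
  by move: h1 h2; rewrite /ball /= (distrC p1) (distrC p2) /nrm /=; lra.
have : compact (c @` (I `*` I)).
  apply: continuous_compact; first exact: continuous_subspaceT.
  by apply: compact_setX; exact: segment_compact.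
rewrite compact_cover => /(_ _ setT (fun a => [set z | nrm (z - a) < r a])) [||D _ cov].
- move=> a _; rewrite openE => z /= za; apply/near_nrm.
  exists (r a - nrm (z - a)); first by rewrite subr_gt0.
  move=> w; rewrite ltrBrDr => h /=; apply: le_lt_trans h.
  by apply: le_trans (nrmD _ _); rewrite addrA subrK.
- by move=> z _; exists z => //=; rewrite subrr nrm0.
exists (finmap.enum_fset D) => z zB.
have [|a aD za] := cov z; last by exists a.
exists (Re z, Im z); last by case: z {zB}.
move: zB; rewrite /nrm => h; have a0 := normr_ge0 (Re z); have b0 := normr_ge0 (Im z).
by split; rewrite /I /= in_itv /= -ler_norml; move: h a0 b0; clear; lra.
Qed.

Lemma derivable_poly (p : {poly K}) z : derivable (horner p) z 1.
Proof.
elim/poly_ind: p => [|p c IH].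
  have -> : horner (0 : {poly K}) = fun=> 0 by apply/funext => w; rewrite horner0.
  exact: derivable_cst.
have -> : horner (p * 'X + c%:P) = horner p * id + (fun=> c).
  by apply/funext => w; rewrite !hornerE.
apply: derivableD; last exact: derivable_cst.
have did : derivable (id : K -> K) z 1 by exact: derivable_id.
exact: (derivableM IH did).
Qed.

Lemma derivable_hornerM (p : {poly K}) f z : derivable f z 1 ->
  derivable (fun w => p.[w] * f w) z 1.
Proof.
move=> df; have h : derivable (horner p * f) z 1.
  by apply: derivableM; [exact: derivable_poly|exact: df].
exact: h.
Qed.

Lemma derivable_inv f z : z != 0 -> derivable f z^-1 1 ->
  derivable (fun w => f w^-1) z 1.
Proof.
move=> z0 df; apply/derivable1_diffP.
have did : derivable (id : K -> K) z 1 by exact: derivable_id.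
have dV : derivable (fun w : K => (id w)^-1) z 1 by exact: derivableV.
have d1 : differentiable (fun w : K => w^-1) z by exact/derivable1_diffP.
move/derivable1_diffP: df => d2.
by apply: (differentiable_comp d1).
Qed.

Lemma nrm_horner (p : {poly K}) : exists C : R, forall z, 1 <= nrm z ->
  nrm p.[z] <= C * nrm z ^+ (size p).
Proof.
elim/poly_ind: p => [|p c [C IH]].
  by exists 0 => z _; rewrite horner0 nrm0 mul0r.
exists (`|C| + nrm c) => z z1; have z0 : 0 <= nrm z by exact: le_trans z1.
have e (x : R) : (`|C| + nrm c) * x = `|C| * x + nrm c * x by exact: mulrDl.
rewrite hornerMXaddC; have [->|p0] := eqVneq p 0.
  rewrite horner0 mul0r !add0r mul0r add0r size_polyC.
  case: eqVneq => [->|_] /=; rewrite ?nrm0 ?expr1 ?expr0 ?mulr1 ?addr_ge0 //.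
  rewrite e; apply: ler_wpDl; first by rewrite mulr_ge0.
  by rewrite ler_peMr ?nrm_ge0.
rewrite -cons_poly_def size_cons_poly; case: ifP => [/andP[/nilP/eqP]|_].
  by rewrite -polyseq0 val_eqE (negPf p0).
apply: le_trans (nrmD _ _) _; rewrite e lerD //; last first.
  by rewrite ler_peMr ?nrm_ge0 // exprn_ege1.
apply: le_trans (nrmM _ _) _; rewrite exprSr mulrA ler_wpM2r //.
apply: le_trans (IH z z1) _; rewrite ler_wpM2r ?exprn_ge0 //.
exact: ler_norm.
Qed.

Lemma near_notin s z : \forall w \near z, w \in s -> w = z.
Proof.
elim: s => [|a s IH]; first by apply/near_nrm; exists 1.
have [->|az] := eqVneq a z.
  by apply: filterS IH => w h; rewrite inE => /predU1P[|/h].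
have /near_neq za : z != a by rewrite eq_sym.
apply: filterS2 za IH => w wa h.
by rewrite inE (negPf wa).
Qed.

Lemma eq_accumulation f g z : {for z, continuous f} -> {for z, continuous g} ->
  (forall r : R, 0 < r -> exists2 w, nrm (w - z) < r & f w = g w) -> f z = g z.
Proof.
move=> /continuous_ccont cf /continuous_ccont cg fg.
apply/eqP; rewrite -subr_eq0; apply/negP => /negP /nrm_gt0.
set e := nrm _ => e0; have e20 : 0 < e / 2 by rewrite divr_gt0.
have [r1 r10 H1] := cf _ e20; have [r2 r20 H2] := cg _ e20.
have [|w] := fg (Num.min r1 r2); first by rewrite lt_min r10.
rewrite lt_min => /andP[/H1 h1 /H2 h2] efg; rewrite efg in h1.
have := nrmD (g w - g z) (- (g w - f z)).
have -> : g w - g z + - (g w - f z) = f z - g z by ring.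
by rewrite nrmN -/e; move: h1 h2; clear; lra.
Qed.

(** Two local continuations of the same function off a finite set agree everywhere;
    this glues the local numerators below into one entire function. *)
Lemma eq_off_finite f g s z : {for z, continuous f} -> {for z, continuous g} ->
  (\forall w \near z, w \notin s -> f w = g w) -> f z = g z.
Proof.
move=> cf cg fg; apply: eq_accumulation => // t0 t00.
have /near_nrm[r r0 H] : \forall w \near z, w != z -> f w = g w.
  apply: filterS2 fg (near_notin s z) => w h1 h2 wz; apply: h1.
  by apply: contraNN wz => /h2 ->.
pose t := Num.min r t0; have tp : 0 < t by rewrite lt_min r0.
pose w : K := z + (t / 2)%:C.
have wz : w - z = (t / 2)%:C by rewrite /w addrAC subrr add0r.
have wt : nrm (w - z) < t.
  by rewrite wz /nrm /= normr0 addr0 gtr0_norm ?divr_gt0 //; lra.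
exists w; first by apply: lt_le_trans wt _; rewrite ge_min lexx orbT.
apply: H; first by apply: lt_le_trans wt _; rewrite ge_min lexx.
by rewrite -subr_eq0 wz eq_complex /= eqxx andbT gt_eqF ?divr_gt0.
Qed.

Lemma ndist a b : nrm (a - b) = nrm (b - a) :> R.
Proof. by rewrite -nrmN opprB. Qed.

Lemma meromorphic_near f a : meromorphic f a ->
  exists (n : nat) (h : K -> K) (r : R), 0 < r /\ forall w, nrm (w - a) < r ->
    derivable h w 1 /\ (w != a -> f w = h w / (w - a) ^+ n).
Proof.
move=> [n [h [/near_nrm[r1 r10 H1] /near'_nrm[r2 r20 H2]]]].
exists n, h, (Num.min r1 r2); split; first by rewrite lt_min r10.
by move=> w; rewrite lt_min => /andP[h1 h2]; split=> [|wa]; [exact: H1|exact: H2].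
Qed.

(** The pole at infinity controls f outside a disc, which is covered by finitely many
    neighbourhoods of poles.  Multiplied by the product q of the corresponding factors,
    f extends to an entire function E of polynomial growth. *)
Lemma meromorphic_rational (f : CP1 R -> K) :
  (forall p, in_chart (@meromorphic R) f p) ->
  exists (P q : {poly K}) (t : seq K), forall z, z \notin t ->
    q.[z] != 0 /\ f (pt z) = P.[z] / q.[z].
Proof.
move=> mf.
have [n [h [r [r0 hP]]]] := meromorphic_near (mf (infty R)).
have /choice[N NP] (a : K) := meromorphic_near (mf (pt a)).
move: NP => /choice[H /choice[e eP]].
have e0 a : 0 < e a by have [] := eP a.
have {}eP a := (eP a).2.
pose B := 2 / r + 1; have r20 : 0 < 2 / r by rewrite divr_gt0.
have B1 : 1 <= B by rewrite /B lerDr ltW.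
have farr z : B <= nrm z -> nrm (z^-1 - 0) < r.
  move=> Bz; have z0 : 0 < nrm z by move: Bz r20; rewrite /B; clear; lra.
  rewrite subr0 -(ltr_pM2r z0); apply: le_lt_trans (nrmV z) _.
  rewrite mulrC -ltr_pdivrMr //; move: Bz; rewrite /B; clear; lra.
have far0 z : B <= nrm z -> z != 0.
  by apply: contraTneq => ->; rewrite nrm0 leNgt (lt_le_trans ltr01 B1).
have fz z : B <= nrm z -> f (pt z) = h z^-1 * z ^+ n.
  move=> Bz; have z0 := far0 z Bz; have := (hP _ (farr z Bz)).2.
  rewrite invr_eq0 => /(_ z0); rewrite /= /chart_infty invr_eq0 (negPf z0) invrK.
  by move=> ->; rewrite subr0 exprVn invrK.
have [s sP] := finite_cover (B + 1) e0.
pose q : {poly K} := \prod_(a <- undup s) ('X - a%:P) ^+ N a.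
have q0 z : z \notin s -> q.[z] != 0.
  move=> zs; rewrite horner_prod prodf_seq_neq0; apply/allP => a.
  rewrite mem_undup => aS; apply/implyP => _.
  by rewrite horner_exp !hornerE expf_neq0 // subr_eq0; apply: contraNneq zs => ->.
pose F z := q.[z] * f (pt z).
(* F extends over its removable singularities: G a is the extension near a. *)
have locF a : exists G : K -> K, exists2 t : R, 0 < t & forall w, nrm (w - a) < t ->
    derivable G w 1 /\ (w \notin s -> F w = G w).
  have [aB|aB] := leP (nrm a) (B + 1).
    have [b bs ab] := sP a aB; pose q' := \prod_(c <- rem b (undup s)) ('X - c%:P) ^+ N c.
    exists (fun w => q'.[w] * H b w), (e b - nrm (a - b)); first by rewrite subr_gt0.
    move=> w; rewrite ltrBrDr => wt.
    have wb : nrm (w - b) < e b.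
      by apply: le_lt_trans wt; apply: le_trans (nrmD _ _); rewrite addrA subrK.
    have [dw fw] := eP b w wb; split; first exact: derivable_hornerM.
    move=> ws; have wnb : w != b by apply: contraNneq ws => ->.
    rewrite /F /q (big_rem b) ?mem_undup //= -/q' hornerM horner_exp !hornerE.
    have /= -> := fw wnb; field; by rewrite expf_neq0 // subr_eq0.
  exists (fun w => q.[w] * (('X^n).[w] * h w^-1)), 1 => // w wa.
  have Bw : B <= nrm w.
    have : nrm a <= nrm (a - w) + nrm w by have := nrmD (a - w) w; rewrite subrK.
    by rewrite ndist; move: aB wa; clear; lra.
  have w0 := far0 w Bw; split; last by move=> _; rewrite /F fz // hornerXn; ring.
  apply: derivable_hornerM; apply: derivable_hornerM.
  by apply: derivable_inv => //; exact: (hP _ (farr w Bw)).1.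
have /choice[G GP] := locF.
pose E a := G a a.
have EF z : z \notin s -> E z = F z.
  move=> zs; have [t t0 tP] := GP z; have [|_] := tP z; first by rewrite subrr nrm0.
  by move=> /(_ zs) ->.
have locE a : \forall w \near a, G a w = E w.
  have [t t0 tP] := GP a; apply/near_nrm; exists t => // w wt.
  have [u u0 uP] := GP w.
  have ww : nrm (w - w) < u by rewrite subrr nrm0.
  apply: (@eq_off_finite (G a) (G w) s).
  - exact: derivable_continuous (tP w wt).1.
  - exact: derivable_continuous (uP w ww).1.
  apply/near_nrm; exists (Num.min u (t - nrm (w - a))).
    by rewrite lt_min u0 subr_gt0.
  move=> v; rewrite lt_min ltrBrDr => /andP[vu vt] vs.
  rewrite -(uP v vu).2 // -(tP v _).2 //; apply: le_lt_trans vt.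
  by apply: le_trans (nrmD _ _); rewrite addrA subrK.
have dE a : derivable E a 1.
  apply: near_eq_derivable (locE a) _; have [t t0 tP] := GP a.
  by have [] := tP a; rewrite ?subrr ?nrm0.
have cE : continuous E by move=> a; exact/derivable_continuous/dE.
have [C CP] := nrm_horner q.
have /continuous_ccont/(_ 1 ltr01)[t t0 tP] : {for 0, continuous h}.
  by apply: derivable_continuous; have [] := hP 0; rewrite ?subrr ?nrm0.
pose M := nrm (h 0) + 1.
have M0 : 0 <= M by rewrite addr_ge0 ?nrm_ge0.
have hM w : nrm w < t -> nrm (h w) <= M.
  rewrite -{1}[w]subr0 => /tP k; rewrite -[h w](subrK (h 0)).
  by apply: le_trans (nrmD _ _) _; rewrite addrC lerD2l ltW.
have [As AsP] : exists A : R, forall z, A <= nrm z -> z \notin s.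
  exists (1 + \sum_(x <- s) nrm x) => z; apply: contraTN => zs.
  rewrite -ltNge (big_rem z) //= addrCA ltrDl ltr_wpDr ?sumr_ge0 // => *.
  exact: nrm_ge0.
have [||p [u uP]] := @growth_poly R (size q + n).+1 E [::] (Num.max As (Num.max B (2 / t + 1))) (C * M) cE.
- by move=> z _; exact: dE.
- move=> z; rewrite !ge_max => /and3P[zA zB zt].
  have z1 : 1 <= nrm z by exact: le_trans zB.
  have z0 : 0 < nrm z by exact: lt_le_trans z1.
  have zVt : nrm z^-1 < t.
    rewrite -(ltr_pM2r z0); apply: le_lt_trans (nrmV z) _.
    by rewrite mulrC -ltr_pdivrMr //; move: zt; clear; lra.
  rewrite exprSr mulrA ler_pM2r // EF ?AsP // /F fz //.
  have -> : C * M * nrm z ^+ (size q + n) = C * nrm z ^+ size q * (M * nrm z ^+ n).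
    by rewrite exprD mulrACA.
  apply: le_trans (nrmM _ _) _; apply: ler_pM; rewrite ?nrm_ge0 //.
    exact: CP.
  apply: le_trans (nrmM _ _) _; apply: ler_pM; rewrite ?nrm_ge0 //.
    exact: hM.
  elim: {CP hP fz} n => [|n IH]; first by rewrite !expr0 /nrm /= normr1 normr0 addr0.
  rewrite !exprS; apply: le_trans (nrmM _ _) _.
  by rewrite ler_wpM2l ?nrm_ge0.
exists p, q, (s ++ u) => z; rewrite mem_cat negb_or => /andP[zs zu].
split; first exact: q0.
by rewrite -uP // EF // /F mulrC mulKf // q0.
Qed.

End Rational.

(** * Open dense sets and equality of loops *)

Section DenseSets.
Variable T : topologicalType.
Implicit Types A B : set T.

Lemma open_denseI A B : open A -> dense A -> open B -> dense B ->
  open (A `&` B) /\ dense (A `&` B).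
Proof.
move=> oA dA oB dB; split; first exact: openI.
move=> O O0 oO; have := dB (O `&` A) (dA O O0 oO) (openI oO oA).
by rewrite setIA.
Qed.

End DenseSets.

Section LoopTopology.
Variable R : realType.
Local Notation K := (Cplx R).
Implicit Types (z w : K) (D : set K) (V : set (CP1 R)) (g h k : loop_rep R).

Lemma open_trace V : open V -> open [set z | V (pt z)].
Proof. by rewrite !openE => oV z /= /oV. Qed.

Lemma openP_nrm D : open D <-> forall z, D z ->
  exists2 r : R, 0 < r & forall w, nrm (w - z) < r -> D w.
Proof. by rewrite openE; split=> h z /h /near_nrm. Qed.

Lemma denseP_nrm D : dense D <-> forall z (r : R), 0 < r ->
  exists2 w, nrm (w - z) < r & D w.
Proof.
split=> [dD z r r0|h O [z Oz] /openP_nrm/(_ z Oz)[r r0 H]].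
  have [||w [/= w1 w2]] := dD [set w | nrm (w - z) < r].
  - by exists z; rewrite /= subrr nrm0.
  - apply/openP_nrm => w /= wr; exists (r - nrm (w - z)); first by rewrite subr_gt0.
    move=> v; rewrite ltrBrDr; apply: le_lt_trans.
    by apply: le_trans (nrmD _ _); rewrite addrA subrK.
  - by exists w.
by have [w wr Dw] := h z r r0; exists w; split => //; exact: H.
Qed.

Lemma dense_trace V : dense V -> dense [set z | V (pt z)].
Proof.
move=> dV O [z Oz] oO; have [||p [[w Ow <-] Vp]] := dV (Some @` O).
- by exists (Some z), z.
- exact: one_point_compactification_open_some.
by exists w.
Qed.

Lemma open_image D : open D -> open (@pt R @` D).
Proof. exact: one_point_compactification_open_some. Qed.

(** Every neighbourhood of infinity contains points of the plane, because the plane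
    is not compact. *)
Lemma dense_image D : dense D -> dense (@pt R @` D).
Proof.
move=> dD O [p Op] oO.
have [z Oz] : exists z, O (pt z).
  case: p Op => [z Oz|Op]; first by exists z.
  have /(_ _ Op)[C [cC _] CO] : O `<=` interior O by move: oO; rewrite openE.
  have [z Cz] : exists z, ~ C z.
    apply/not_existsP => H.
    move: cC; rewrite compact_cover.
    move=> /(_ _ setT (fun n : nat => [set z | nrm z < n%:R])) [||F _ cov].
    - move=> n _; apply/openP_nrm => z /= zn; exists (n%:R - nrm z).
        by rewrite subr_gt0.
      move=> w; rewrite ltrBrDr; apply: le_lt_trans.
      by have := nrmD (w - z) z; rewrite subrK.
    - move=> z _; exists (Num.bound (nrm z)) => //=.
      by apply: archi_boundP; exact: nrm_ge0.
    pose M := (\sum_(n <- finmap.enum_fset F) n)%N.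
    have CM : C (M%:R%:C) by apply: contrapT; exact: H.
    have [n nF /= Hn] := cov _ CM.
    move: Hn; have -> : nrm (M%:R%:C : K) = M%:R.
      by rewrite /nrm /= normr0 addr0 ger0_norm ?ler0n.
    by rewrite ltr_nat ltnNge /M (big_rem n) //= leq_addr.
  by exists z; apply: CO; left; exists z.
have [||w [Ow Dw]] := dD [set z | O (pt z)].
- by exists z.
- exact: open_trace.
by exists (pt w); split => //; exists w.
Qed.

Lemma cofinite_open_dense (s : seq K) :
  open [set z | z \notin s] /\ dense [set z | z \notin s].
Proof.
split.
  apply/openP_nrm => z /= zs; apply/near_nrm.
  by apply: filterS (near_notin s z) => w h; apply: contra zs => /[dup] /h ->.
apply/denseP_nrm => z r r0; have /near_nrm[e e0 H] := near_notin s z.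
pose t := Num.min r e; have t0 : 0 < t by rewrite lt_min r0.
pose w : K := z + (t / 2)%:C.
have wz : w - z = (t / 2)%:C by rewrite /w addrAC subrr add0r.
have wt : nrm (w - z) < t.
  by rewrite wz /nrm /= normr0 addr0 gtr0_norm ?divr_gt0 //; lra.
have wr : nrm (w - z) < r by apply: lt_le_trans wt _; rewrite ge_min lexx.
have we : nrm (w - z) < e by apply: lt_le_trans wt _; rewrite ge_min lexx orbT.
exists w => //=; apply: contraPN (H w we) => ws /(_ ws) e1.
move: wz; rewrite e1 subrr => /eqP; rewrite eq_complex /= eqxx andbT.
by rewrite lt_eqF // divr_gt0.
Qed.

Lemma nonroots_open_dense (p : {poly K}) : p != 0 ->
  open [set z | p.[z] != 0] /\ dense [set z | p.[z] != 0].
Proof.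
move=> p0; have [s /= e] := closed_field_poly_normal p.
have -> : [set z | p.[z] != 0] = [set z | z \notin s].
  apply/seteqP; split => z /=; rewrite e hornerZ mulf_eq0 lead_coef_eq0 (negPf p0) /=.
    by rewrite -rootE root_prod_XsubC.
  by rewrite -rootE root_prod_XsubC.
exact: cofinite_open_dense.
Qed.

Lemma dense_poly0 (p : {poly K}) D : dense D -> (forall z, D z -> p.[z] = 0) -> p = 0.
Proof.
move=> dD H; apply/eqP/negP => /negP p0.
have [oD' dD'] := nonroots_open_dense p0.
have [|z [/= zp Dz]] := dD [set z | p.[z] != 0] _ oD'.
  have [z [_ zp]] := dD' setT (ex_intro _ 0 I) openT.
  by exists z.
by rewrite (H z Dz) eqxx in zp.
Qed.

Lemma conj_open_dense D : open D -> dense D ->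
  open [set z : K | D (Num.conj z)] /\ dense [set z : K | D (Num.conj z)].
Proof.
have nJ (z : K) : nrm (Num.conj z) = nrm z by case: z => a b; rewrite /nrm /= normrN.
move=> /openP_nrm oD /denseP_nrm dD; split.
  apply/openP_nrm => z /= /oD[r r0 H]; exists r => // w wz; apply: H.
  by rewrite -rmorphB nJ.
apply/denseP_nrm => z r r0; have [w wz Dw] := dD (Num.conj z) r r0.
exists (Num.conj w) => /=; last by rewrite conjCK.
by rewrite -[z]conjCK -rmorphB nJ.
Qed.

(** The point at infinity does not matter for the equality of loops. *)
Lemma loop_eqP g h : loop_eq g h <-> exists D : set K,
  [/\ open D, dense D & forall z, D z -> g (pt z) = h (pt z)].
Proof.
split=> [[V [oV dV H]]|[D [oD dD H]]].
  exists [set z | V (pt z)]; split; [exact: open_trace|exact: dense_trace|].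
  by move=> z; exact: H.
exists (@pt R @` D); split; [exact: open_image|exact: dense_image|].
by move=> _ [z Dz <-]; exact: H.
Qed.

Lemma loop_eq_sym g h : loop_eq g h -> loop_eq h g.
Proof. by move=> [V [oV dV H]]; exists V; split => // p /H. Qed.

Lemma loop_eq_trans g h k : loop_eq g h -> loop_eq h k -> loop_eq g k.
Proof.
move=> [V [oV dV H]] [W [oW dW H']]; exists (V `&` W).
have [? ?] := open_denseI oV dV oW dW; split => // p [/H -> /H'].
by [].
Qed.

Lemma loop_eq_mul g h g' h' : loop_eq g g' -> loop_eq h h' ->
  loop_eq (loop_mul g h) (loop_mul g' h').
Proof.
move=> [V [oV dV H]] [W [oW dW H']]; exists (V `&` W).
have [? ?] := open_denseI oV dV oW dW; split => // p [/H e /H' e'].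
by rewrite /loop_mul e e'.
Qed.

Lemma loop_eq_inv g g' : loop_eq g g' -> loop_eq (loop_inv g) (loop_inv g').
Proof.
by move=> [V [oV dV H]]; exists V; split => // p /H; rewrite /loop_inv => ->.
Qed.

End LoopTopology.

Local Close Scope complex_scope.

(** * The equations of G2 *)

Section G2Equations.
Variable K : fieldType.
Implicit Types (u v w : 'rV[K]_7) (g : 'M[K]_7).

Lemma dotvE n (u v : 'rV[K]_n) : (dotv u v)%:M = u *m v^T :> 'M[K]_1.
Proof.
apply/matrixP => i j; rewrite !ord1 !mxE eqxx mulr1n.
by apply: eq_bigr => k _; rewrite mxE.
Qed.

Lemma dotvC n (u v : 'rV[K]_n) : dotv u v = dotv v u.
Proof. by apply: eq_bigr => i _; rewrite mulrC. Qed.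

Lemma dotvDl n (u v w : 'rV[K]_n) : dotv (u + v) w = dotv u w + dotv v w.
Proof. by rewrite -big_split; apply: eq_bigr => i _; rewrite mxE mulrDl. Qed.

Lemma dotvZl n a (u w : 'rV[K]_n) : dotv (a *: u) w = a * dotv u w.
Proof. by rewrite mulr_sumr; apply: eq_bigr => i _; rewrite mxE mulrA. Qed.

Lemma dotvDr n (u v w : 'rV[K]_n) : dotv w (u + v) = dotv w u + dotv w v.
Proof. by rewrite dotvC dotvDl !(dotvC w). Qed.

Lemma dotvZr n a (u w : 'rV[K]_n) : dotv w (a *: u) = a * dotv w u.
Proof. by rewrite dotvC dotvZl (dotvC w). Qed.

Lemma dotv0l n (u : 'rV[K]_n) : dotv 0 u = 0.
Proof. by rewrite -[0](scale0r 0) dotvZl mul0r. Qed.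

Lemma dotvNl n (u w : 'rV[K]_n) : dotv (- u) w = - dotv u w.
Proof. by rewrite -scaleN1r dotvZl mulN1r. Qed.

Lemma dotv_delta n (u : 'rV[K]_n) i : dotv u (delta_mx 0 i) = u 0 i.
Proof.
rewrite /dotv (bigD1 i) //= big1 => [|j ji]; rewrite mxE eqxx /=.
  by rewrite eqxx mulr1 addr0.
by rewrite (negPf ji) mulr0.
Qed.

Lemma dotvI n (u v : 'rV[K]_n) : (forall w : 'rV[K]_n, dotv u w = dotv v w) -> u = v.
Proof. by move=> h; apply/rowP => i; rewrite -!dotv_delta h. Qed.

Lemma dotv_mulmx m n (u : 'rV[K]_m) (A : 'M[K]_(m, n)) (v : 'rV[K]_n) :
  dotv (u *m A) v = dotv u (v *m A^T).
Proof.
have : (dotv (u *m A) v)%:M = (dotv u (v *m A^T))%:M :> 'M[K]_1.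
  by rewrite !dotvE trmx_mul trmxK mulmxA.
by move/matrixP/(_ 0 0); rewrite !mxE eqxx !mulr1n.
Qed.

Lemma imcrossDl u v w : imcross (u + v) w = imcross u w + imcross v w.
Proof. by apply/rowP => i; rewrite !mxE; ring. Qed.

Lemma imcrossZl a u w : imcross (a *: u) w = a *: imcross u w.
Proof. by apply/rowP => i; rewrite !mxE; ring. Qed.

Lemma imcrossC u v : imcross u v = - imcross v u.
Proof. by apply/rowP => i; rewrite !mxE; ring. Qed.

Lemma imcrossDr u v w : imcross w (u + v) = imcross w u + imcross w v.
Proof. by rewrite imcrossC imcrossDl opprD -!(imcrossC w). Qed.

Lemma imcrossZr a u w : imcross w (a *: u) = a *: imcross w u.
Proof. by rewrite imcrossC imcrossZl -scalerN -imcrossC. Qed.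

Lemma imcross0l u : imcross 0 u = 0.
Proof. by apply/rowP => i; rewrite !mxE; ring. Qed.

Lemma imcross0r u : imcross u 0 = 0.
Proof. by apply/rowP => i; rewrite !mxE; ring. Qed.

Lemma improdE u v : improd u v = imcross u v.
Proof.
rewrite /improd /octmul /oct_of_im !row_mxKr !row_mxKl !mxE.
by rewrite !scale0r !add0r.
Qed.

Lemma mxactD n (g : 'M[K]_n) (u v : 'rV[K]_n) : mxact g (u + v) = mxact g u + mxact g v.
Proof. exact: mulmxDl. Qed.

Lemma mxactZ n (g : 'M[K]_n) a (u : 'rV[K]_n) : mxact g (a *: u) = a *: mxact g u.
Proof. by rewrite /mxact scalemxAl. Qed.

Let one : octonion K := row_mx 1%:M 0.

Let one00 : (1%:M : 'M[K]_1) 0 0 = 1.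
Proof. by rewrite mxE eqxx. Qed.

Lemma octmul1l (x : octonion K) : octmul one x = x.
Proof.
rewrite /octmul row_mxKl row_mxKr one00 mul1r dotv0l subr0 scale1r scaler0 addr0.
by rewrite imcross0l addr0 -mx11_scalar hsubmxK.
Qed.

Lemma octmul1r (x : octonion K) : octmul x one = x.
Proof.
rewrite /octmul row_mxKl row_mxKr one00 mulr1 dotvC dotv0l subr0 scale1r scaler0 add0r.
by rewrite imcross0r addr0 -mx11_scalar hsubmxK.
Qed.

(** An automorphism fixes the unit, hence the real part of a product of
    imaginary octonions, which is the inner product up to sign. *)
Lemma G2P g : G2 g <-> g^T *m g = 1%:M /\
  forall u v, imcross (mxact g u) (mxact g v) = mxact g (imcross u v).
Proof.
split=> [[f [[fu fM] fg]]|[gg gM]].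
  have f1 : mxact f one = one.
    pose x := one *m invmx f^T.
    have fx : mxact f x = one by rewrite /mxact mulmxKV ?unitmx_tr.
    by have := fM one x; rewrite octmul1l fx octmul1r.
  have mulE u v : octmul (oct_of_im u) (oct_of_im v) =
      - dotv u v *: one + oct_of_im (imcross u v).
    rewrite /octmul /oct_of_im /one !row_mxKr !row_mxKl !mxE !scale0r !add0r mul0r sub0r.
    rewrite scale_row_mx scaler0 add_row_mx addr0 add0r; congr row_mx.
    by apply/matrixP => i j; rewrite !ord1 !mxE eqxx !mulr1n mulr1.
  have H u v : - dotv u v *: one + oct_of_im (mxact g (imcross u v)) =
      - dotv (mxact g u) (mxact g v) *: one + oct_of_im (imcross (mxact g u) (mxact g v)).
    by rewrite -mulE -!fg -fM mulE mxactD mxactZ f1 fg.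
  have Hd u v : dotv u v = dotv (mxact g u) (mxact g v).
    have /(congr1 lsubmx)/matrixP/(_ 0 0) := H u v.
    rewrite /one /oct_of_im !scale_row_mx !add_row_mx !row_mxKl !mxE eqxx !mulr1n !mulr1 !addr0.
    exact: oppr_inj.
  split=> [|u v]; last first.
    have /(congr1 rsubmx) := H u v.
    by rewrite /one /oct_of_im !scale_row_mx !add_row_mx !row_mxKr !scaler0 !add0r.
  apply/trmx_inj; rewrite trmx_mul trmxK trmx1; apply/row_matrixP => i.
  rewrite row1 rowE; apply: dotvI => w.
  by rewrite mulmxA dotv_mulmx -Hd.
have gu : g^T \in unitmx by have [] := mulmx1_unit gg.
exists (block_mx 1%:M 0 0 g).
have fE (a : 'M[K]_1) u : mxact (block_mx 1%:M 0 0 g) (row_mx a u) = row_mx a (mxact g u).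
  by rewrite /mxact tr_block_mx mul_row_block !trmx0 trmx1 !mulmx0 mulmx1 addr0 add0r.
split; last by move=> v; rewrite /oct_of_im fE.
split; first by rewrite unitmxE det_ublock det1 mul1r -unitmxE -unitmx_tr.
have gd u v : dotv (mxact g u) (mxact g v) = dotv u v.
  rewrite /mxact dotv_mulmx -mulmxA trmxK.
  by move/(congr1 trmx): (gg); rewrite trmx_mul trmxK trmx1 => ->; rewrite mulmx1.
move=> x y; rewrite -[x]hsubmxK -[y]hsubmxK.
move: (lsubmx x) (rsubmx x) (lsubmx y) (rsubmx y) => a u b v.
rewrite {1}/octmul !fE /octmul !row_mxKl !row_mxKr gM gd.
by rewrite !mxactD !mxactZ.
Qed.

End G2Equations.

(** * Matrices of polynomials and rational loops *)

Section Evaluation.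
Variable K : fieldType.
Implicit Types (z : K) (q : {poly K}).

Definition ev z m n (M : 'M[{poly K}]_(m, n)) : 'M[K]_(m, n) :=
  map_mx (horner_eval z) M.

Definition cst_mx m n (A : 'M[K]_(m, n)) : 'M[{poly K}]_(m, n) := map_mx polyC A.

Lemma evE z m n (M : 'M[{poly K}]_(m, n)) i j : ev z M i j = (M i j).[z].
Proof. by rewrite mxE. Qed.

Lemma ev_cst z m n (A : 'M[K]_(m, n)) : ev z (cst_mx A) = A.
Proof. by apply/matrixP => i j; rewrite !mxE /horner_eval hornerC. Qed.

Lemma evM z m n p (A : 'M[{poly K}]_(m, n)) (B : 'M[_]_(n, p)) :
  ev z (A *m B) = ev z A *m ev z B.
Proof. exact: map_mxM. Qed.

Lemma ev_tr z m n (A : 'M[{poly K}]_(m, n)) : ev z A^T = (ev z A)^T.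
Proof. by rewrite /ev map_trmx. Qed.

Lemma evZ z m n q (A : 'M[{poly K}]_(m, n)) : ev z (q *: A) = q.[z] *: ev z A.
Proof. by apply/matrixP => i j; rewrite !mxE /horner_eval hornerM. Qed.

Lemma ev_scalar z n q : ev z (q%:M : 'M[{poly K}]_n) = (q.[z])%:M.
Proof. exact: map_scalar_mx. Qed.

Lemma ev_mxact z (M : 'M[{poly K}]_7) u : ev z (mxact M u) = mxact (ev z M) (ev z u).
Proof. by rewrite /mxact evM ev_tr. Qed.

Lemma ev_imcross z (u v : 'rV[{poly K}]_7) :
  ev z (imcross u v) = imcross (ev z u) (ev z v).
Proof. by apply/rowP => i; rewrite !mxE /horner_eval !hornerE. Qed.

(** The equations of G2 for the matrix M / q, cleared of denominators. *)
Definition G2_poly (M : 'M[{poly K}]_7) q := M^T *m M = (q ^+ 2)%:M /\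
  forall u v : 'rV[K]_7, imcross (mxact M (cst_mx u)) (mxact M (cst_mx v)) =
    q *: mxact M (cst_mx (imcross u v)).

Lemma G2_scale (a : K) (A : 'M[K]_7) : a != 0 -> G2 (a^-1 *: A) <->
  A^T *m A = (a ^+ 2)%:M /\
  forall u v, imcross (mxact A u) (mxact A v) = a *: mxact A (imcross u v).
Proof.
move=> a0; have aV : a^-1 != 0 by rewrite invr_eq0.
have actZ w : mxact (a^-1 *: A) w = a^-1 *: mxact A w.
  by rewrite /mxact linearZ /= -scalemxAr.
have trZ : (a^-1 *: A)^T *m (a^-1 *: A) = (a^-1 * a^-1) *: (A^T *m A).
  have -> : (a^-1 *: A)^T = a^-1 *: A^T by rewrite linearZ.
  by rewrite -scalemxAl -scalemxAr scalerA.
rewrite G2P trZ.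
split=> -[h1 h2]; split.
- have -> : A^T *m A = (a ^+ 2) *: 1%:M.
    by rewrite -h1 scalerA -invfM -expr2 mulfV ?scale1r // expf_neq0.
  by rewrite scalemx1.
- move=> u v; have := h2 u v; rewrite !actZ imcrossZl imcrossZr scalerA.
  move/(congr1 (fun w => (a * a) *: w)).
  by rewrite !scalerA -invfM mulfV ?mulf_neq0 // scale1r -mulrA mulfV // mulr1.
- by rewrite h1 -scalemx1 scalerA -invfM -expr2 mulVf ?scale1r // expf_neq0.
- by move=> u v; rewrite !actZ imcrossZl imcrossZr h2 !scalerA mulfVK.
Qed.

Lemma G2_ev M q z : G2_poly M q -> q.[z] != 0 -> G2 ((q.[z])^-1 *: ev z M).
Proof.
move=> [h1 h2] qz; apply/G2_scale => //; split.
  by rewrite -ev_tr -evM h1 ev_scalar horner_exp.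
move=> u v; have := congr1 (fun w => ev z w) (h2 u v).
by rewrite ev_imcross evZ !ev_mxact !ev_cst.
Qed.

Lemma G2_inv (g : 'M[K]_7) : G2 g -> invmx g = g^T.
Proof.
move=> /G2P[gg _]; have [_ gu] := mulmx1_unit gg.
by rewrite -[RHS](mulmxK gu) gg mul1mx.
Qed.

End Evaluation.

Section RationalLoops.
Variable R : realType.
Local Notation K := (Cplx R).
Implicit Types (z w : K) (M : 'M[{poly K}]_7) (q : {poly K}) (g h : loop_rep R).

Definition conj_poly q : {poly K} := map_poly Num.conj q.

(** The value at infinity is that of a negative loop. *)
Definition frac_loop M q : loop_rep R :=
  fun p => if p is Some z then (q.[z])^-1 *: ev z M else 1%:M.

(** M / q is a rational G2-loop satisfying the reality condition and equal to 1
    at infinity. *)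
Definition loop_frac M q := [/\ q != 0, G2_poly M q,
  conj_poly q *: M = q *: map_mx conj_poly M &
  forall i j, (size (M i j - q *+ (i == j))%R < size q)%N].

(** Identities between polynomial matrices are read off from values on a dense set. *)
Lemma mx_poly_eq m n (A B : 'M[{poly K}]_(m, n)) (D : set K) : dense D ->
  (forall z, D z -> ev z A = ev z B) -> A = B.
Proof.
move=> dD H; apply/matrixP => i j; apply/eqP; rewrite -subr_eq0; apply/eqP.
apply: (dense_poly0 dD) => z /H /matrixP/(_ i j).
by rewrite !evE hornerD hornerN => ->; rewrite subrr.
Qed.

Lemma horner_conj q z : (conj_poly q).[Num.conj z] = Num.conj q.[z].
Proof. exact: horner_map. Qed.

Lemma ev_conj (z : K) m n (A : 'M[{poly K}]_(m, n)) :
  ev (Num.conj z) (map_mx conj_poly A) = cplx_conjmx (ev z A).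
Proof. by apply/matrixP => i j; rewrite !mxE; exact: horner_conj. Qed.

(** The polynomial w ^ e p (1 / w), for a polynomial p of degree at most e. *)
Definition reversed (e : nat) q : {poly K} := \poly_(k < e.+1) q`_(e - k).

Lemma reversedE e q w : (size q <= e.+1)%N -> w != 0 ->
  (reversed e q).[w] = w ^+ e * q.[w^-1].
Proof.
move=> sq w0; rewrite horner_poly (horner_coef_wide _ sq) mulr_sumr.
rewrite (reindex_inj rev_ord_inj) /=; apply: eq_bigr => i _.
have ie : (i <= e)%N by rewrite -ltnS.
rewrite subSS subKn // exprVn mulrCA; congr (_ * _).
have we : w ^+ e = w ^+ (e - i) * w ^+ i by rewrite -exprD subnK.
by rewrite we mulfK // expf_neq0.
Qed.

Lemma reversed0 e q : (reversed e q).[0] = q`_e.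
Proof. by rewrite horner_coef0 coef_poly /= subn0. Qed.

Lemma derivable_quotient (p q : {poly K}) z : q.[z] != 0 ->
  derivable (fun w => q.[w]^-1 * p.[w]) z 1.
Proof.
move=> qz.
have dV : derivable (fun w : K => (horner q w)^-1) z 1.
  by apply: derivableV => //; exact: derivable_poly.
have dp : derivable (horner p : K -> K) z 1 by exact: derivable_poly.
have h : derivable ((fun w : K => (horner q w)^-1) * (horner p : K -> K)) z 1.
  by apply: derivableM; [exact: dV|exact: dp].
exact: h.
Qed.

Lemma near_nonroot q z : q.[z] != 0 -> \forall w \near z, q.[w] != 0.
Proof.
move=> qz; have q0 : q != 0 by apply: contraNneq qz => ->; rewrite horner0.
have [+ _] := nonroots_open_dense q0; rewrite openE => /(_ z qz).
by [].
Qed.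

Lemma holomorphic_quotient (p q : {poly K}) z : q.[z] != 0 ->
  holomorphic (fun w => q.[w]^-1 * p.[w]) z.
Proof.
by move=> /near_nonroot; apply: filterS => w; exact: derivable_quotient.
Qed.

Lemma near_eq_holomorphic (f1 f2 : K -> K) z : (\forall w \near z, f1 w = f2 w) ->
  holomorphic f1 z -> holomorphic f2 z.
Proof.
move=> /near_join e h; apply: filterS2 e h => w.
exact: near_eq_derivable.
Qed.

End RationalLoops.

(** * Negative real rational loops as fractions *)

Section Correspondence.
Variable R : realType.
Local Notation K := (Cplx R).
Implicit Types (z w : K) (M : 'M[{poly K}]_7) (q : {poly K}) (g h : loop_rep R).

Definition rational_G2_loop g :=
  exists M q, loop_frac M q /\ loop_eq g (frac_loop M q).

Lemma frac_loopE M q (i j : 'I_7) (z : K) :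
  frac_loop M q (pt z) i j = q.[z]^-1 * (M i j).[z].
Proof. by rewrite !mxE. Qed.

Lemma ev_conjE q z : (conj_poly q).[z] = Num.conj q.[Num.conj z].
Proof. by rewrite -horner_conj conjCK. Qed.

Lemma frac_loop_conj M q z : q.[z] != 0 -> q.[Num.conj z] != 0 ->
  conj_poly q *: M = q *: map_mx (@conj_poly R) M ->
  cplx_conjmx (frac_loop M q (pt (Num.conj z))) = frac_loop M q (pt z).
Proof.
move=> qz qz' H; apply/matrixP => i j; rewrite mxE !frac_loopE.
have -> : Num.conj (q.[Num.conj z]^-1 * (M i j).[Num.conj z]) =
    (conj_poly q).[z]^-1 * (conj_poly (M i j)).[z].
  by rewrite !ev_conjE -fmorphV -rmorphM.
have := congr1 (fun A : 'M[{poly K}]_7 => (A i j).[z]) H; rewrite !mxE !hornerM => e.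
have qc : (conj_poly q).[z] != 0 by rewrite ev_conjE fmorph_eq0.
apply: (mulfI qz); apply: (mulfI qc); rewrite mulVKf // e mulrCA mulVKf //.
Qed.

(** In the chart at infinity M / q is a quotient of reversed polynomials whose
    denominator has the leading coefficient of q as its value at 0. *)
Lemma frac_chart_infty M q (i j : 'I_7) w : loop_frac M q ->
  let d := (size q).-1 in
  (frac_loop M q \o @chart_infty R) w i j =
    (reversed d q).[w]^-1 * (reversed d (M i j)).[w].
Proof.
move=> [q0 _ _ sz] d.
have sq : (size q = d.+1)%N by rewrite prednK // lt0n size_poly_eq0.
have sM : (size (M i j) <= d.+1)%N.
  rewrite -[M i j](subrK (q *+ (i == j))).
  apply: leq_trans (size_polyD _ _) _; rewrite geq_max -sq.
  by rewrite (ltnW (sz i j)) /=; case: (i == j); rewrite ?size_poly0.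
rewrite /= /chart_infty; have [->|w0] := eqVneq w 0.
  rewrite !reversed0 /= mxE -/(lead_coef q).
  have /eqP : (M i j - q *+ (i == j))`_d = 0.
    by apply: nth_default; rewrite -ltnS -sq sz.
  rewrite coefB coefMn subr_eq0 => /eqP ->; rewrite mulrnAr mulVf //.
  by rewrite lead_coef_eq0.
rewrite frac_loopE !reversedE ?sq // invfM mulrACA mulVf ?mul1r //.
by rewrite expf_neq0.
Qed.

Lemma frac_loop_meromorphic M q p : loop_frac M q -> mx_meromorphic (frac_loop M q) p.
Proof.
move=> H i j; case: p => [a|] /=.
  have [q0 _ _ _] := H.
  have [n [r /implyP/(_ q0) ra qE]] := multiplicity_XsubC q a.
  exists n, (fun w => r.[w]^-1 * (M i j).[w]); split.
    exact: holomorphic_quotient.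
  apply/near'_nrm; exists 1 => // w wa _.
  rewrite /= frac_loopE qE hornerM horner_exp !hornerE invfM.
  by rewrite mulrAC.
exists 0%N, (fun w => (frac_loop M q \o @chart_infty R) w i j); split; last first.
  by apply/near'_nrm; exists 1 => // w _ _; rewrite /= expr0 divr1.
rewrite (_ : (fun w => _) =
    fun w => (reversed (size q).-1 q).[w]^-1 * (reversed (size q).-1 (M i j)).[w]).
  by apply: holomorphic_quotient; rewrite reversed0 lead_coef_eq0; case: H.
by apply/funext => w; rewrite frac_chart_infty.
Qed.

Lemma frac_loop_holomorphic_infty M q : loop_frac M q ->
  mx_holomorphic (frac_loop M q) (infty R).
Proof.
move=> H i j /=.
rewrite (_ : _ \o _ =
    fun w => (reversed (size q).-1 q).[w]^-1 * (reversed (size q).-1 (M i j)).[w]).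
  by apply: holomorphic_quotient; rewrite reversed0 lead_coef_eq0; case: H.
by apply/funext => w; rewrite -frac_chart_infty.
Qed.

Lemma rational_G2_loop_Lminus g : rational_G2_loop g -> Lminus_tau g.
Proof.
move=> [M [q [H gE]]]; have [q0 HG Hr Hs] := H.
have [V [oV dV VE]] := (loop_eqP _ _).1 gE.
have [oq dq] := nonroots_open_dense q0.
split.
- pose D := V `&` [set z | q.[z] != 0].
  have [oD dD] := open_denseI oV dV oq dq.
  exists (@pt R @` D); split; [exact: open_image|exact: dense_image| |].
    move=> _ [z [Vz qz] <-] i j /=.
    apply: near_eq_holomorphic (holomorphic_quotient (M i j) qz).
    move: oV; rewrite openE => /(_ z Vz).
    by apply: filterS => w Vw; rewrite /= VE // frac_loopE.
  by move=> _ [z [Vz qz] <-]; rewrite VE //=; exact: G2_ev.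
- exists (frac_loop M q); split => // p; exact: frac_loop_meromorphic.
- exists (frac_loop M q); split => //; exact: frac_loop_holomorphic_infty.
apply/loop_eqP.
pose D := V `&` [set z | q.[z] != 0].
have [oD dD] := open_denseI oV dV oq dq; have [oD' dD'] := conj_open_dense oD dD.
exists (D `&` [set z : K | D (Num.conj z)]).
have [? ?] := open_denseI oD dD oD' dD'; split => // z [[Vz qz] [Vz' qz']].
by rewrite (VE z Vz) -(frac_loop_conj qz qz' Hr) -(VE _ Vz').
Qed.

Lemma G2_poly_dense M q (D : set K) : dense D ->
  (forall z, D z -> q.[z] != 0 /\ G2 ((q.[z])^-1 *: ev z M)) -> G2_poly M q.
Proof.
move=> dD H; split=> [|u v]; apply: (mx_poly_eq dD) => z /H[qz /(G2_scale _ qz)[e1 e2]].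
  by rewrite evM ev_tr e1 ev_scalar horner_exp.
by rewrite ev_imcross evZ !ev_mxact !ev_cst.
Qed.

Lemma conj_poly_dense M q (D : set K) : dense D ->
  (forall z, D z -> [/\ q.[z] != 0, q.[Num.conj z] != 0 &
     cplx_conjmx (frac_loop M q (pt (Num.conj z))) = frac_loop M q (pt z)]) ->
  conj_poly q *: M = q *: map_mx (@conj_poly R) M.
Proof.
move=> dD H; apply: (mx_poly_eq dD) => z /H[qz qz' e].
apply/matrixP => i j; have := congr1 (fun A : 'M[K]_7 => A i j) e.
rewrite mxE !frac_loopE.
have -> : Num.conj (q.[Num.conj z]^-1 * (M i j).[Num.conj z]) =
    (conj_poly q).[z]^-1 * (conj_poly (M i j)).[z].
  by rewrite !ev_conjE -fmorphV -rmorphM.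
rewrite !evE !mxE !hornerM => e'.
have qc : (conj_poly q).[z] != 0 by rewrite ev_conjE fmorph_eq0.
have := congr1 (fun x => q.[z] * ((conj_poly q).[z] * x)) e'.
by rewrite mulVKf // => ->; rewrite mulrCA mulVKf.
Qed.

(** The product of the denominators of all the entries is a common denominator. *)
Lemma mx_meromorphic_rational (m : loop_rep R) : (forall p, mx_meromorphic m p) ->
  exists (M : 'M[{poly K}]_7) q, q != 0 /\ loop_eq m (frac_loop M q).
Proof.
move=> mm.
have /choice[P /choice[Q /choice[t H]]] (ij : 'I_7 * 'I_7) :
    exists (P Q : {poly K}) (t : seq K), forall z, z \notin t ->
      Q.[z] != 0 /\ m (pt z) ij.1 ij.2 = P.[z] / Q.[z].
  by apply: (@meromorphic_rational R (fun p => m p ij.1 ij.2)) => p; exact: mm.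
pose q := \prod_ij Q ij.
pose M : 'M[{poly K}]_7 := \matrix_(i, j) (P (i, j) * \prod_(kl | kl != (i, j)) Q kl).
pose s := flatten [seq t ij | ij <- enum {: 'I_7 * 'I_7}].
have sP z : z \notin s -> forall ij, z \notin t ij.
  move=> zs ij; apply: contra zs => zt; apply/flattenP; exists (t ij) => //.
  by apply: map_f; rewrite mem_enum.
have qz z : z \notin s -> q.[z] != 0.
  move=> /sP zs; rewrite horner_prod; apply/prodf_neq0 => ij _.
  by have [] := H ij z (zs ij).
have [os ds] := cofinite_open_dense s.
have q0 : q != 0.
  have [a aS] := notin_exists s; apply: contraTneq (qz a aS) => ->.
  by rewrite horner0 eqxx.
exists M, q; split => //; apply/loop_eqP; exists [set z | z \notin s]; split => //.
move=> z /= zs; apply/matrixP => i j.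
have [Qz ->] := H (i, j) z (sP z zs (i, j)); rewrite frac_loopE mxE hornerM /=.
have := qz z zs; rewrite /q (bigD1 (i, j)) //= hornerM mulf_eq0 negb_or => /andP[_ q'z].
rewrite invfM mulrACA [X in _ = X]mulrC.
by rewrite mulVf // mul1r mulrC.
Qed.

Lemma near_infty_dense (D : set K) (r : R) : dense D -> 0 < r ->
  exists w : K, [/\ w != 0, nrm w < r & D w^-1].
Proof.
move=> /denseP_nrm dD r0; pose z0 : K := Complex (2 / r + 1) 0.
have [z zz0 Dz] := dD z0 1 ltr01.
have r20 : 0 < 2 / r by rewrite divr_gt0.
have z0E : nrm z0 = 2 / r + 1 by rewrite /nrm /= normr0 addr0 gtr0_norm // addr_gt0.
have zr : 2 / r < nrm z.
  have := nrmD (z0 - z) z; rewrite subrK ndist z0E; lra.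
have zp : 0 < nrm z by exact: lt_trans zr.
have z00 : z != 0 by apply: contraTneq zp => ->; rewrite nrm0 ltxx.
exists z^-1; split; [by rewrite invr_eq0| |by rewrite invrK].
rewrite -(ltr_pM2r zp); apply: le_lt_trans (nrmV z) _.
by rewrite mulrC -ltr_pdivrMr.
Qed.

(** A loop with value 1 at infinity: (M - q) / q vanishes there, which bounds the
    degrees of the entries of M - q. *)
Lemma frac_loop_degree M q (h : loop_rep R) : q != 0 -> loop_eq h (frac_loop M q) ->
  mx_holomorphic h (infty R) -> h (infty R) = 1%:M ->
  forall i j, (size (M i j - q *+ (i == j))%R < size q)%N.
Proof.
move=> q0 /loop_eqP[D [oD dD hE]] holh h1 i j; rewrite ltnNge; apply/negP => sN.
set N := M i j - _ in sN; pose e := (size N).-1.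
have N0 : N != 0.
  by apply: contraNneq q0 => N0; move: sN; rewrite N0 size_poly0 leqn0 size_poly_eq0.
have sNe : (size N = e.+1)%N by rewrite prednK // lt0n size_poly_eq0.
have sqe : (size q <= e.+1)%N by rewrite -sNe.
pose f w : K := (h \o @chart_infty R) w i j - (1%:M : 'M[K]_7) i j.
have df : derivable f 0 1.
  have /nbhs_singleton d1 := holh i j.
  have d2 : derivable ((fun w => (h \o @chart_infty R) w i j) - fun=> (1%:M : 'M[K]_7) i j) 0 1.
    by apply: derivableB; [exact: d1|exact: derivable_cst].
  exact: d2.
have [oq dq] := nonroots_open_dense q0.
have [oD' dD'] := open_denseI oD dD oq dq.
have : (reversed e N).[0] = (reversed e q).[0] * f 0.
  apply: (@eq_accumulation R (horner (reversed e N)) (fun w => (reversed e q).[w] * f w)).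
  - by apply: derivable_continuous; exact: derivable_poly.
  - by apply: derivable_continuous; exact: derivable_hornerM.
  move=> r r0; have [w [w0 wr [Dw qw]]] := near_infty_dense dD' r0.
  exists w; first by rewrite subr0.
  rewrite !reversedE ?sNe // /f /= /chart_infty (negPf w0) hE // frac_loopE.
  rewrite -mulrA; congr (_ * _); rewrite mulrBr mulVKf //.
  by rewrite hornerD hornerN hornerMn mxE mulr_natr.
rewrite !reversed0 /f /= /chart_infty eqxx h1 subrr mulr0 => /eqP.
by rewrite -/(lead_coef N) lead_coef_eq0 (negPf N0).
Qed.

Lemma Lminus_rational_G2_loop g : Lminus_tau g -> rational_G2_loop g.
Proof.
move=> [[U [oU dU _ UG]] [m [gm mm]] [h [gh holh h1]] gr].
have [M [q [q0 mE]]] := mx_meromorphic_rational mm.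
have gE := loop_eq_trans gm mE.
exists M, q; split => //; split => //.
- have /loop_eqP[V [oV dV VE]] := gE.
  have [oq dq] := nonroots_open_dense q0.
  have [oV' dV'] := open_denseI oV dV oq dq.
  have [oD dD] := open_denseI oV' dV' (open_trace oU) (dense_trace dU).
  apply: (G2_poly_dense dD) => z [[Vz qz] Uz].
  by split=> //; have := UG _ Uz; rewrite (VE z Vz).
- have /loop_eqP[V [oV dV VE]] := gE.
  have [oq dq] := nonroots_open_dense q0.
  have [oV' dV'] := open_denseI oV dV oq dq.
  have [oc dc] := conj_open_dense oV' dV'.
  have [oD dD] := open_denseI oV' dV' oc dc.
  have /loop_eqP[W [oW dW WE]] := gr.
  have [oE dE] := open_denseI oD dD oW dW.
  apply: (conj_poly_dense dE) => z [[[Vz qz] [Vz' qz']] Wz]; split => //.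
  by have := WE z Wz; rewrite -(VE z Vz) -(VE _ Vz').
exact: frac_loop_degree (loop_eq_trans (loop_eq_sym gh) gE) holh h1.
Qed.

End Correspondence.

(** * Group structure on fractions *)

Section G2Group.
Variable K : fieldType.
Implicit Types g h : 'M[K]_7.

Lemma mxactM n (g h : 'M[K]_n) (u : 'rV[K]_n) : mxact (g *m h) u = mxact g (mxact h u).
Proof. by rewrite /mxact trmx_mul mulmxA. Qed.

Lemma mxact1 n (u : 'rV[K]_n) : mxact 1%:M u = u.
Proof. by rewrite /mxact trmx1 mulmx1. Qed.

Lemma G2_one : @G2 K 1%:M.
Proof. by apply/G2P; rewrite trmx1 mul1mx; split=> // u v; rewrite !mxact1. Qed.

Lemma G2_mul g h : G2 g -> G2 h -> G2 (g *m h).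
Proof.
move=> /G2P[g1 g2] /G2P[h1 h2]; apply/G2P; split=> [|u v].
  by rewrite trmx_mul mulmxA -(mulmxA h^T) g1 mulmx1.
by rewrite !mxactM g2 h2.
Qed.

Lemma G2_tr g : G2 g -> G2 g^T.
Proof.
move=> /G2P[g1 g2]; have g1' := mulmx1C g1; apply/G2P; split=> [|u v].
  by rewrite trmxK.
have K1 w : mxact g (mxact g^T w) = w by rewrite -mxactM g1' mxact1.
have K2 w : mxact g^T (mxact g w) = w by rewrite -mxactM g1 mxact1.
by rewrite -[LHS]K2 -g2 !K1.
Qed.

End G2Group.

Section RationalGroup.
Variable R : realType.
Local Notation K := (Cplx R).
Implicit Types (z w : K) (M : 'M[{poly K}]_7) (q : {poly K}) (g h : loop_rep R).

Lemma G2_poly_nonroots M q : q != 0 ->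
  (forall z, q.[z] != 0 -> G2 ((q.[z])^-1 *: ev z M)) -> G2_poly M q.
Proof.
move=> q0 H; have [_ dq] := nonroots_open_dense q0.
by apply: (G2_poly_dense dq) => z qz; split => //; exact: H.
Qed.

Lemma conj_polyM p q : @conj_poly R (p * q) = conj_poly p * conj_poly q.
Proof. exact: rmorphM. Qed.

Lemma size_entry M q : (forall i j, (size (M i j - q *+ (i == j))%R < size q)%N) ->
  forall i j, (size (M i j) <= size q)%N.
Proof.
move=> H i j; rewrite -[M i j](subrK (q *+ (i == j))).
apply: leq_trans (size_polyD _ _) _; rewrite geq_max (ltnW (H i j)) /=.
by case: (i == j); rewrite ?size_poly0.
Qed.

Lemma loop_frac_one : loop_frac (1%:M : 'M[{poly K}]_7) 1.
Proof.
split.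
- exact: oner_neq0.
- apply: G2_poly_nonroots => [|z _]; first exact: oner_neq0.
  by rewrite hornerE invr1 scale1r ev_scalar hornerE; exact: G2_one.
- rewrite /conj_poly rmorph1 !scale1r; apply/matrixP => i j.
  by rewrite !mxE rmorphMn /= rmorph1.
move=> i j; have -> : (1%:M : 'M[{poly K}]_7) i j - 1 *+ (i == j) = 0.
  by rewrite mxE; exact: subrr.
apply: (@leq_ltn_trans 0%N); first by rewrite size_poly0.
by rewrite size_poly_gt0; exact: oner_neq0.
Qed.

Lemma conj_mxM m n k (A : 'M[{poly K}]_(m, n)) (B : 'M[{poly K}]_(n, k)) :
  map_mx (@conj_poly R) (A *m B) = map_mx (@conj_poly R) A *m map_mx (@conj_poly R) B.
Proof. exact: (map_mxM (map_poly (Num.conj : K -> K))). Qed.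

Lemma size_mul_lt (a b q p : {poly K}) : (size a < size q)%N -> (size b <= size p)%N ->
  p != 0 -> (size (a * b)%R < size (q * p)%R)%N.
Proof.
move=> aq bp p0; have q0 : q != 0 by rewrite -size_poly_gt0; exact: leq_trans aq.
have qp : (1 < size q + size p)%N by apply: (@leq_add 1 1); rewrite size_poly_gt0.
rewrite (size_mul q0 p0) -subn1; have [->|a0] := eqVneq a 0.
  by rewrite mul0r size_poly0 subn_gt0.
have [->|b0] := eqVneq b 0; first by rewrite mulr0 size_poly0 subn_gt0.
rewrite size_mul // -subn1 ltn_sub2r //.
by rewrite -addSn leq_add.
Qed.

Lemma loop_frac_mul M q N p : loop_frac M q -> loop_frac N p ->
  loop_frac (M *m N) (q * p).
Proof.
move=> [q0 HM rM sM] [p0 HN rN sN]; have qp0 : q * p != 0 by rewrite mulf_neq0.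
split => //.
- apply: G2_poly_nonroots => // z; rewrite hornerM mulf_eq0 negb_or => /andP[qz pz].
  rewrite evM invfM -scalerA (scalemxAr (p.[z]^-1)) scalemxAl.
  by apply: G2_mul; exact: G2_ev.
- rewrite conj_polyM -scalerA (scalemxAr (conj_poly p)) rN (scalemxAl (conj_poly q)) rM.
  by rewrite -scalemxAl -scalemxAr scalerA conj_mxM.
move=> i j; have -> : (M *m N) i j - q * p *+ (i == j) =
    \sum_k (M i k - q *+ (i == k)) * N k j + q * (N i j - p *+ (i == j)).
  have -> : (M *m N) i j = \sum_k ((M i k - q *+ (i == k)) * N k j + q *+ (i == k) * N k j).
    by rewrite mxE; apply: eq_bigr => k _; rewrite -mulrDl subrK.
  rewrite big_split /= -addrA; congr (_ + _).
  rewrite (bigD1 i) //= big1 => [|k /negPf ki]; last by rewrite eq_sym ki mul0r.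
  by rewrite eqxx mulr1n addr0 mulrBr mulrnAr.
apply: leq_ltn_trans (size_polyD _ _) _; rewrite gtn_max; apply/andP; split.
  have s0 : (0 < size (q * p)%R)%N by rewrite size_poly_gt0.
  apply: leq_ltn_trans (size_sum _ _ _) _.
  apply: (big_ind (fun n => n < size (q * p)%R)%N) => // [m n mn nn|k _].
    by rewrite gtn_max mn.
  by apply: size_mul_lt => //; exact: size_entry.
by rewrite mulrC (mulrC q); apply: size_mul_lt.
Qed.

Lemma loop_frac_tr M q : loop_frac M q -> loop_frac M^T q.
Proof.
move=> [q0 HM rM sM]; split => //.
- apply: G2_poly_nonroots => // z qz; rewrite ev_tr.
  by have := G2_tr (G2_ev HM qz); rewrite linearZ.
- by have := congr1 trmx rM; rewrite !linearZ /= map_trmx.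
by move=> i j; rewrite mxE eq_sym.
Qed.

Lemma rational_G2_loop_one : rational_G2_loop (@loop_one R).
Proof.
exists 1%:M, 1; split; first exact: loop_frac_one.
exists setT; split; [exact: openT|by move=> O [p Op] _; exists p|].
by case=> [z|] _ //=; rewrite hornerE invr1 scale1r ev_scalar hornerE.
Qed.

Lemma rational_G2_loop_mul g h : rational_G2_loop g -> rational_G2_loop h ->
  rational_G2_loop (loop_mul g h).
Proof.
move=> [M [q [HM gE]]] [N [p [HN hE]]]; exists (M *m N), (q * p).
split; first exact: loop_frac_mul.
apply: loop_eq_trans (loop_eq_mul gE hE) _.
exists setT; split; [exact: openT|by move=> O [x Ox] _; exists x|].
case=> [z|] _; rewrite /loop_mul /= ?mul1mx //.
by rewrite evM hornerM invfM -scalemxAl -scalemxAr scalerA.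
Qed.

Lemma rational_G2_loop_inv g : rational_G2_loop g -> rational_G2_loop (loop_inv g).
Proof.
move=> [M [q [HM gE]]]; exists M^T, q; split; first exact: loop_frac_tr.
apply: loop_eq_trans (loop_eq_inv gE) _; have [q0 HG _ _] := HM.
have [oq dq] := nonroots_open_dense q0.
apply/loop_eqP; exists [set z | q.[z] != 0]; split => // z /= qz.
by rewrite /loop_inv /= (G2_inv (G2_ev HG qz)) ev_tr linearZ.
Qed.

Lemma rational_G2_loop_eq g h : rational_G2_loop g -> loop_eq g h -> rational_G2_loop h.
Proof.
move=> [M [q [HM gE]]] gh; exists M, q; split => //.
exact: loop_eq_trans (loop_eq_sym gh) gE.
Qed.

End RationalGroup.

(** * The seven-dimensional cross product *)

Section CrossProduct.
Variable K : fieldType.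
Implicit Types x y z u v w : 'rV[K]_7.

Lemma cross_crossE x y : imcross x (imcross x y) = dotv x y *: x - dotv x x *: y.
Proof.
have rowE (w : 'rV[K]_7) : exists f : nat -> K, forall i, w 0 i = f (val i).
  by exists (fun n => w 0 (inord n)) => i; rewrite inord_val.
apply/rowP => i; rewrite !mxE /dotv !big_ord_recl !big_ord0.
have [[f uE] [g vE]] := (rowE x, rowE y).
rewrite !uE !vE.
case: i => -[|[|[|[|[|[|[|//]]]]]]] ? /=; rewrite /bump /=;
move: (f 0%N) (f 1%N) (f 2%N) (f 3%N) (f 4%N) (f 5%N) (f 6%N) => ? ? ? ? ? ? ?;
move: (g 0%N) (g 1%N) (g 2%N) (g 3%N) (g 4%N) (g 5%N) (g 6%N) => ? ? ? ? ? ? ?;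
ring.
Qed.

Lemma dotv_crossA x y z : dotv (imcross x y) z = dotv x (imcross y z).
Proof.
have rowE (w : 'rV[K]_7) : exists f : nat -> K, forall i, w 0 i = f (val i).
  by exists (fun n => w 0 (inord n)) => i; rewrite inord_val.
rewrite /dotv !big_ord_recl !big_ord0 !mxE.
have [[f uE] [[g vE] [h wE]]] := (rowE x, (rowE y, rowE z)).
rewrite !uE !vE !wE /= /bump /=.
move: (f 0%N) (f 1%N) (f 2%N) (f 3%N) (f 4%N) (f 5%N) (f 6%N) => ? ? ? ? ? ? ?.
move: (g 0%N) (g 1%N) (g 2%N) (g 3%N) (g 4%N) (g 5%N) (g 6%N) => ? ? ? ? ? ? ?.
move: (h 0%N) (h 1%N) (h 2%N) (h 3%N) (h 4%N) (h 5%N) (h 6%N) => ? ? ? ? ? ? ?.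
ring.
Qed.

End CrossProduct.

Section CrossProductFacts.
Variable K : fieldType.
Implicit Types x y z u v w : 'rV[K]_7.

Lemma crossxx x : imcross x x = 0.
Proof. by apply/rowP => i; rewrite !mxE; ring. Qed.

Lemma crossNr u v : imcross u (- v) = - imcross u v.
Proof. by rewrite -scaleN1r imcrossZr scaleN1r. Qed.

Lemma dotvNr n (u w : 'rV[K]_n) : dotv w (- u) = - dotv w u.
Proof. by rewrite dotvC dotvNl dotvC. Qed.

Lemma dotv0r n (u : 'rV[K]_n) : dotv u 0 = 0.
Proof. by rewrite dotvC dotv0l. Qed.

(** Polarization of x (x y) = <x, y> x - <x, x> y. *)
Lemma cross_cross_sym x y z : imcross x (imcross y z) + imcross y (imcross x z) =
  dotv x z *: y + dotv y z *: x - (2 * dotv x y) *: z.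
Proof.
have := cross_crossE (x + y) z.
rewrite !imcrossDl !imcrossDr !cross_crossE.
rewrite !dotvDl !dotvDr (dotvC y x).
move: (imcross x (imcross y z)) (imcross y (imcross x z)) (dotv x y) => A B d.
move: (dotv x x) (dotv y y) (dotv x z) (dotv y z) => a b c e.
move=> /rowP h; apply/rowP => i; have /eqP := h i; rewrite !mxE -subr_eq0 => /eqP k.
by apply/eqP; rewrite -subr_eq0 -[X in _ == X]k; apply/eqP; ring.
Qed.

Lemma dotv_crossC x y z : dotv (imcross x y) z = - dotv y (imcross x z).
Proof. by rewrite imcrossC dotvNl dotv_crossA. Qed.

End CrossProductFacts.

Lemma mxact_addl (K : comPzRingType) n (g h : 'M[K]_n) (x : 'rV[K]_n) :
  mxact (g + h) x = mxact g x + mxact h x.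
Proof. by rewrite /mxact linearD mulmxDr. Qed.

Lemma mxact_scalel (K : comPzRingType) n k (g : 'M[K]_n) (x : 'rV[K]_n) :
  mxact (k *: g) x = k *: mxact g x.
Proof. by rewrite /mxact linearZ /= -scalemxAr. Qed.

(** * Orthogonality and conjugation *)

Section Perp.
Variables (K : fieldType) (n : nat).
Implicit Types (U V : 'M[K]_n) (x y : 'rV[K]_n).

Lemma perpP U x : reflect (forall y, (y <= U)%MS -> dotv x y = 0) (x <= perp U)%MS.
Proof.
apply: (iffP sub_kermxP) => [h y /submxP[z ->]|h].
  have : (dotv x (z *m U))%:M = 0%:M :> 'M[K]_1.
    by rewrite dotvE trmx_mul mulmxA h mul0mx raddf0.
  by move/matrixP/(_ 0 0); rewrite !mxE eqxx !mulr1n.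
apply/rowP => i; have := h (row i U) (row_sub i U).
move=> e; rewrite [RHS]mxE -[RHS]e mxE.
by apply: eq_bigr => j _; rewrite !mxE.
Qed.

Lemma rank_perp U : \rank (perp U) = (n - \rank U)%N.
Proof. by rewrite mxrank_ker mxrank_tr. Qed.

Lemma cap_neq0 U V : (n < \rank U + \rank V)%N ->
  exists x, [/\ x != 0, (x <= U)%MS & (x <= V)%MS].
Proof.
rewrite -mxrank_sum_cap => h.
have : (0 < \rank (U :&: V)%MS)%N.
  rewrite -(ltn_add2l (\rank (U + V)%MS)) addn0; apply: leq_ltn_trans h.
  exact: rank_leq_row.
rewrite lt0n mxrank_eq0 => /rowV0Pn[x]; rewrite sub_capmx => /andP[xU xV] x0.
by exists x.
Qed.

End Perp.

Section Hermitian.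
Variables (K : numClosedFieldType) (n : nat).
Implicit Types (x y : 'rV[K]_n).

Lemma cplx_conjK m p (A : 'M[K]_(m, p)) : cplx_conjmx (cplx_conjmx A) = A.
Proof. by apply/matrixP => i j; rewrite !mxE conjCK. Qed.

Lemma cplx_conjD m p (A B : 'M[K]_(m, p)) :
  cplx_conjmx (A + B) = cplx_conjmx A + cplx_conjmx B.
Proof. by apply/matrixP => i j; rewrite !mxE rmorphD. Qed.

Lemma cplx_conjZ m p k (A : 'M[K]_(m, p)) :
  cplx_conjmx (k *: A) = Num.conj k *: cplx_conjmx A.
Proof. by apply/matrixP => i j; rewrite !mxE rmorphM. Qed.

Lemma conj_mxact (A : 'M[K]_n) x :
  cplx_conjmx (mxact A x) = mxact (cplx_conjmx A) (cplx_conjmx x).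
Proof. by rewrite /mxact /cplx_conjmx map_mxM map_trmx. Qed.

Lemma dotv_conj x y : dotv (cplx_conjmx x) (cplx_conjmx y) = Num.conj (dotv x y).
Proof. by rewrite rmorph_sum; apply: eq_bigr => i _; rewrite !mxE rmorphM. Qed.

Lemma dotv_herm_eq0 x : (dotv x (cplx_conjmx x) == 0) = (x == 0).
Proof.
rewrite /dotv psumr_eq0 => [|i _]; last by rewrite mxE mul_conjC_ge0.
apply/allP/eqP => [h|-> i _]; last by rewrite /= !mxE mul0r eqxx.
apply/rowP => i; have := h i (mem_index_enum i).
by rewrite /= !mxE mul_conjC_eq0 => /eqP.
Qed.

Lemma conj_sub m p (A : 'M[K]_(m, n)) (B : 'M[K]_(p, n)) :
  (cplx_conjmx A <= cplx_conjmx B)%MS = (A <= B)%MS.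
Proof. exact: map_submx. Qed.

Lemma conj_sub_swap m p (A : 'M[K]_(m, n)) (B : 'M[K]_(p, n)) :
  (A <= cplx_conjmx B)%MS = (cplx_conjmx A <= B)%MS.
Proof. by rewrite -[in RHS]conj_sub cplx_conjK. Qed.

Lemma rank_conj m (A : 'M[K]_(m, n)) : \rank (cplx_conjmx A) = \rank A.
Proof. exact: mxrank_map. Qed.

End Hermitian.

Lemma cross_conj (K : numClosedFieldType) (u v : 'rV[K]_7) :
  cplx_conjmx (imcross u v) = imcross (cplx_conjmx u) (cplx_conjmx v).
Proof. by apply/rowP => i; rewrite !mxE !(rmorphD, rmorphN, rmorphM). Qed.

(** * The decomposition attached to a coassociative plane *)

Section CoassociativePlane.
Variable K : numClosedFieldType.
Implicit Types (x y z u v a c : 'rV[K]_7).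

Local Notation "A ^~" := (cplx_conjmx A) (at level 2, format "A ^~").

Lemma conj_coassociative (U : 'M[K]_7) : coassociative U -> coassociative U^~.
Proof.
move=> [rU iU mU]; split; first by rewrite rank_conj.
- move=> x y; rewrite !conj_sub_swap => xU yU.
  by rewrite -[x]cplx_conjK -[y]cplx_conjK dotv_conj iU // rmorph0.
move=> x y; rewrite !conj_sub_swap !improdE => xU yU.
rewrite -[x]cplx_conjK -[y]cplx_conjK -cross_conj.
by have := mU _ _ xU yU; rewrite improdE => ->; apply/rowP => i; rewrite !mxE rmorph0.
Qed.

Variable U : 'M[K]_7.
Hypothesis hU : coassociative U.
Local Notation V := (U^~).
Local Notation A := (perp (U + U^~)%MS).

Lemma coass_dotUU x y : (x <= U)%MS -> (y <= U)%MS -> dotv x y = 0.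
Proof. by case: hU => _ iU _; exact: iU. Qed.

Lemma coass_crossUU x y : (x <= U)%MS -> (y <= U)%MS -> imcross x y = 0.
Proof. by case: hU => _ _ mU xU yU; rewrite -improdE mU. Qed.

Lemma coass_dotVV x y : (x <= V)%MS -> (y <= V)%MS -> dotv x y = 0.
Proof. by case: (conj_coassociative hU) => _ iU _; exact: iU. Qed.

Lemma coass_crossVV x y : (x <= V)%MS -> (y <= V)%MS -> imcross x y = 0.
Proof. by case: (conj_coassociative hU) => _ _ mU xU yU; rewrite -improdE mU. Qed.

Lemma coass_dotAU a x : (a <= A)%MS -> (x <= U)%MS -> dotv a x = 0.
Proof. by move=> /perpP aA xU; apply: aA; rewrite (submx_trans xU) ?addsmxSl. Qed.

Lemma coass_dotAV a x : (a <= A)%MS -> (x <= V)%MS -> dotv a x = 0.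
Proof. by move=> /perpP aA xV; apply: aA; rewrite (submx_trans xV) ?addsmxSr. Qed.

Lemma coass_memA a : (forall x, (x <= U)%MS -> dotv a x = 0) ->
  (forall x, (x <= V)%MS -> dotv a x = 0) -> (a <= A)%MS.
Proof.
move=> hu hv; apply/perpP => y /sub_addsmxP[[p q] /= ->].
by rewrite dotvDr hu ?hv ?addr0 // submxMl.
Qed.

Lemma coass_conjA a : (a^~ <= A)%MS = (a <= A)%MS.
Proof.
suff h (b : 'rV[K]_7) : (b <= A)%MS -> (b^~ <= A)%MS.
  by apply/idP/idP => [/h|/h //]; rewrite cplx_conjK.
move=> bA; apply: coass_memA => x.
  rewrite -[U]cplx_conjK conj_sub_swap => xV.
  by rewrite -[x]cplx_conjK dotv_conj coass_dotAV ?rmorph0.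
rewrite conj_sub_swap => xU.
by rewrite -[x]cplx_conjK dotv_conj coass_dotAU ?rmorph0.
Qed.

Lemma coass_capUV : (U :&: V)%MS = 0.
Proof.
apply/eqP; rewrite -submx0; apply/row_subP => i; set x := row i _.
have : (x <= U :&: V)%MS by exact: row_sub.
rewrite sub_capmx conj_sub_swap => /andP[xU xV].
by rewrite submx0 -dotv_herm_eq0 coass_dotUU.
Qed.

(** U + V is stable under conjugation, so a vector in it that is orthogonal to it is
    orthogonal to its own conjugate. *)
Lemma coass_capA : ((U + V) :&: A)%MS = 0.
Proof.
apply/eqP; rewrite -submx0; apply/row_subP => i; set x := row i _.
have : (x <= (U + V) :&: A)%MS by exact: row_sub.
rewrite sub_capmx => /andP[xUV xA].
rewrite submx0 -dotv_herm_eq0; apply/eqP; apply: (perpP _ _ xA).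
have : (x^~ <= ((U + V)%MS)^~)%MS by rewrite conj_sub.
have -> : (x^~ <= ((U + V)%MS)^~)%MS = (x^~ <= V + V^~)%MS by rewrite map_addsmx.
by rewrite cplx_conjK addsmxC.
Qed.

Lemma coass_rankUV : \rank (U + V)%MS = 4%N.
Proof.
have := mxrank_sum_cap U V; rewrite coass_capUV mxrank0 addn0 rank_conj.
by case: hU => -> _ _ ->.
Qed.

Lemma coass_rankA : \rank A = 3%N.
Proof. by rewrite rank_perp coass_rankUV. Qed.

Lemma coass_full : ((U + V) + A :=: 1%:M)%MS.
Proof.
apply/eqmxP; rewrite submx1 sub1mx row_full_unit -row_free_unit /row_free.
have := mxrank_sum_cap (U + V)%MS A.
by rewrite coass_capA mxrank0 addn0 coass_rankUV coass_rankA => ->.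
Qed.

Lemma coass_crossUV x y : (x <= U)%MS -> (y <= V)%MS -> (imcross x y <= A)%MS.
Proof.
move=> xU yV; apply: coass_memA => z zW.
  by rewrite dotv_crossC (coass_crossUU xU zW) dotvC dotv0l oppr0.
by rewrite dotv_crossA (coass_crossVV yV zW) dotvC dotv0l.
Qed.

Lemma coass_cross_UUV x y z : (x <= U)%MS -> (y <= U)%MS -> (z <= V)%MS ->
  (imcross x (imcross y z) <= U)%MS.
Proof.
move=> xU yU zV; rewrite (imcrossC y) crossNr.
have := cross_cross_sym x z y; rewrite (coass_crossUU xU yU) imcross0r addr0 => ->.
rewrite (coass_dotUU xU yU) scale0r add0r eqmx_opp.
by rewrite addmx_sub ?eqmx_opp ?scalemx_sub.
Qed.

(** A Hermitian-orthogonal basis c, d of the plane makes c c', c d', d c'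
    (conjugates on the right) a basis of A: their Gram matrix is invertible. *)
Lemma coass_spanA : exists c d, [/\ (c <= U)%MS, (d <= U)%MS &
  (A <= col_mx (imcross c c^~) (col_mx (imcross c d^~) (imcross d c^~)))%MS].
Proof.
have [c cU c0] : exists2 c : 'rV[K]_7, (c <= U)%MS & c != 0.
  by apply/rowV0Pn; rewrite -mxrank_eq0; case: hU => ->.
have [|d [d0 dU dc]] := @cap_neq0 K 7 U (perp <<c^~>>%MS).
  by rewrite rank_perp mxrank_gen rank_conj rank_rV c0; case: hU => ->.
have {}dc : dotv d c^~ = 0 by move/perpP: dc; apply; rewrite genmxE.
have cd : dotv c d^~ = 0 by rewrite dotvC -[c]cplx_conjK dotv_conj dc rmorph0.
exists c, d; split => //.
have cV : (c^~ <= V)%MS by rewrite conj_sub.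
have dV : (d^~ <= V)%MS by rewrite conj_sub.
set u := imcross c c^~; set v := imcross c d^~; set w := imcross d c^~.
have n1 : dotv c c^~ != 0 by rewrite dotv_herm_eq0.
have n2 : dotv d d^~ != 0 by rewrite dotv_herm_eq0.
have uu : dotv u u = - (dotv c c^~) ^+ 2.
  rewrite /u dotv_crossA (imcrossC c) crossNr cross_crossE (dotvC c^~ c).
  rewrite (coass_dotVV cV cV) scale0r subr0 dotvNr dotvZr.
  by rewrite expr2.
have vv : dotv v v = 0.
  rewrite /v dotv_crossA (imcrossC c) crossNr cross_crossE (dotvC d^~ c) cd.
  by rewrite (coass_dotVV dV dV) !scale0r subr0 oppr0 dotv0r.
have ww : dotv w w = 0.
  rewrite /w dotv_crossA (imcrossC d) crossNr cross_crossE (dotvC c^~ d) dc.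
  by rewrite (coass_dotVV cV cV) !scale0r subr0 oppr0 dotv0r.
have vw : dotv v w = - (2 * dotv d d^~) * dotv c c^~.
  rewrite /v /w dotv_crossA.
  have := cross_cross_sym d^~ d c^~; rewrite (coass_crossVV dV cV) imcross0r addr0 => ->.
  by rewrite (coass_dotVV dV cV) dc !scale0r !add0r (dotvC d^~) dotvNr dotvZr mulNr.
have uv : dotv u v = 0.
  rewrite /u /v dotv_crossA.
  have := cross_cross_sym c^~ c d^~; rewrite (coass_crossVV cV dV) imcross0r addr0 => ->.
  rewrite (coass_dotVV cV dV) cd !scale0r !add0r dotvNr dotvZr cd.
  by rewrite mulr0 oppr0.
have uw : dotv u w = 0.
  rewrite /u /w dotv_crossA (imcrossC d) crossNr cross_crossE (dotvC c^~ d) dc.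
  by rewrite (coass_dotVV cV cV) !scale0r subr0 oppr0 dotv0r.
set T := col_mx u _.
have TA : (T <= A)%MS by rewrite !col_mx_sub !coass_crossUV.
have rT : \rank T = 3%N.
  apply/eqP; apply: (@inj_row_free _ (1 + (1 + 1)) 7 T) => x.
  have k0 : - (2 * dotv d d^~) * dotv c c^~ != 0.
    by rewrite mulf_neq0 // oppr_eq0 mulf_neq0 // pnatr_eq0.
  move: (- (2 * dotv d d^~) * dotv c c^~) k0 vw => k k0 vw.
  rewrite -[x]hsubmxK -[rsubmx x]hsubmxK.
  move: (lsubmx x) (lsubmx (rsubmx x)) (rsubmx (rsubmx x)) => r s t.
  rewrite !mul_row_col [r]mx11_scalar [s]mx11_scalar [t]mx11_scalar !mul_scalar_mx => xT.
  have := congr1 (fun y => dotv y u) xT; have := congr1 (fun y => dotv y v) xT.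
  have := congr1 (fun y => dotv y w) xT.
  rewrite /= !dotvDl !dotvZl !dotv0l uu vv ww vw uv uw (dotvC v u) (dotvC w u) (dotvC w v).
  rewrite uv uw vw !mulr0 !addr0 !add0r => /eqP s0 /eqP t0 /eqP r0.
  move: s0 t0 r0; rewrite !mulf_eq0 (negPf k0) oppr_eq0 expf_eq0 (negPf n1) !orbF.
  by move=> /eqP -> /eqP -> /eqP ->; rewrite !raddf0 !row_mx0.
by have := mxrank_leqif_sup TA; rewrite rT coass_rankA => -[_ <-].
Qed.

(** A is spanned by products of a vector of U and one of its conjugate. *)
Lemma coass_crossUA x a : (x <= U)%MS -> (a <= A)%MS -> (imcross x a <= U)%MS.
Proof.
move=> xU aA; have [c [d [cU dU sA]]] := coass_spanA.
have cV : (c^~ <= V)%MS by rewrite conj_sub.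
have dV : (d^~ <= V)%MS by rewrite conj_sub.
have /submxP[y ->] := submx_trans aA sA.
rewrite -[y]hsubmxK -[rsubmx y]hsubmxK.
move: (lsubmx y) (lsubmx (rsubmx y)) (rsubmx (rsubmx y)) => r s t.
rewrite !mul_row_col [r]mx11_scalar [s]mx11_scalar [t]mx11_scalar !mul_scalar_mx !imcrossDr !imcrossZr.
by apply: addmx_sub; last apply: addmx_sub; apply: scalemx_sub;
  exact: coass_cross_UUV.
Qed.

Lemma coass_crossVA x a : (x <= V)%MS -> (a <= A)%MS -> (imcross x a <= V)%MS.
Proof.
rewrite !conj_sub_swap -coass_conjA cross_conj; exact: coass_crossUA.
Qed.

Lemma coass_crossAA a b : (a <= A)%MS -> (b <= A)%MS -> (imcross a b <= A)%MS.
Proof.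
move=> aA bA; apply: coass_memA => x xW.
  by rewrite dotv_crossA imcrossC dotvNr coass_dotAU ?oppr0 // coass_crossUA.
by rewrite dotv_crossA imcrossC dotvNr coass_dotAV ?oppr0 // coass_crossVA.
Qed.

Lemma coass_decomp x : exists u v a,
  [/\ (u <= U)%MS, (v <= V)%MS, (a <= A)%MS & x = u + v + a].
Proof.
have : (x <= (U + V) + A)%MS by rewrite coass_full submx1.
case/sub_addsmxP => -[p q] /= ->.
have /sub_addsmxP[[r s] /= ->] : (p *m (U + V)%MS <= U + V)%MS by rewrite submxMl.
by exists (r *m U), (s *m V), (q *m A); rewrite !submxMl.
Qed.

(** The automorphism acting by t, 1 and 1 / t on the conjugate plane, on A and
    on the plane. *)
Definition coass_scale (t : K) : 'M[K]_7 :=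
  t *: proj_along V (U + A)%MS + proj_along A (U + V)%MS
  + t^-1 *: proj_along U (A + V)%MS.

Lemma coass_proj_act : forall u v a : 'rV[K]_7,
  (u <= U)%MS -> (v <= V)%MS -> (a <= A)%MS ->
  [/\ mxact (proj_along U (A + V)%MS) (u + v + a) = u,
      mxact (proj_along V (U + A)%MS) (u + v + a) = v &
      mxact (proj_along A (U + V)%MS) (u + v + a) = a].
Proof.
have capA := coass_capA; have capUV := coass_capUV.
have capV : (V :&: (U + A))%MS = 0.
  apply/eqP; rewrite -submx0; apply/row_subP => i; set x := row i _.
  have : (x <= V :&: (U + A))%MS by exact: row_sub.
  rewrite sub_capmx => /andP[xV /sub_addsmxP[[r s] /= xE]].
  have : (s *m A <= (U + V) :&: A)%MS.
    rewrite sub_capmx submxMl andbT (_ : s *m A = x - r *m U); last first.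
      by rewrite xE addrC addKr.
    by rewrite addmx_sub ?eqmx_opp ?(submx_trans xV) ?addsmxSr ?(submx_trans (submxMl _ _)) ?addsmxSl.
  rewrite capA submx0 => /eqP s0.
  by rewrite -capUV sub_capmx xV xE s0 addr0 submxMl.
have capU : (U :&: (A + V))%MS = 0.
  apply/eqP; rewrite -submx0; apply/row_subP => i; set x := row i _.
  have : (x <= U :&: (A + V))%MS by exact: row_sub.
  rewrite sub_capmx => /andP[xU /sub_addsmxP[[s r] /= xE]].
  have : (s *m A <= (U + V) :&: A)%MS.
    rewrite sub_capmx submxMl andbT (_ : s *m A = x - r *m V); last first.
      by rewrite xE addrK.
    by rewrite addmx_sub ?eqmx_opp ?(submx_trans xU) ?addsmxSl ?(submx_trans (submxMl _ _)) ?addsmxSr.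
  rewrite capA submx0 => /eqP s0.
  by rewrite -capUV sub_capmx xU xE s0 add0r submxMl.
have capA' : (A :&: (U + V))%MS = 0 by rewrite capmxC capA.
move=> u v a uU vV aA.
have pV : mxact (proj_along V (U + A)%MS) (u + v + a) = v.
  rewrite /mxact /proj_along trmxK [u + v]addrC -addrA mulmxDl proj_mx_id // proj_mx_0 ?addr0 //.
  by rewrite addmx_sub_adds.
have pA : mxact (proj_along A (U + V)%MS) (u + v + a) = a.
  rewrite /mxact /proj_along trmxK mulmxDl proj_mx_0 // ?add0r ?proj_mx_id //.
  by rewrite addmx_sub_adds.
have pU : mxact (proj_along U (A + V)%MS) (u + v + a) = u.
  rewrite /mxact /proj_along trmxK -addrA mulmxDl proj_mx_id // proj_mx_0 ?addr0 //.
  by rewrite [v + a]addrC addmx_sub_adds.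
by split.
Qed.

Lemma coass_scale_act t : forall u v a : 'rV[K]_7,
  (u <= U)%MS -> (v <= V)%MS -> (a <= A)%MS ->
  mxact (coass_scale t) (u + v + a) = t^-1 *: u + t *: v + a.
Proof.
move=> u v a uU vV aA; have [pU pV pA] := coass_proj_act uU vV aA.
rewrite /coass_scale !mxact_addl !mxact_scalel pV pA pU.
by rewrite [LHS]addrC addrA.
Qed.

(** The products U x U and V x V vanish, U x V and A x A lie in A, U x A in U and
    V x A in V: the weights of the scaling are additive. *)
Lemma coass_scale_G2 t : t != 0 -> G2 (coass_scale t).
Proof.
move=> t0; set g := coass_scale t.
have gU u : (u <= U)%MS -> mxact g u = t^-1 *: u.
  by move=> uU; have := coass_scale_act t uU (sub0mx _ _) (sub0mx _ _); rewrite !addr0 scaler0 addr0.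
have gV v : (v <= V)%MS -> mxact g v = t *: v.
  by move=> vV; have := coass_scale_act t (sub0mx _ _) vV (sub0mx _ _); rewrite !(addr0, add0r) scaler0 add0r.
have gA a : (a <= A)%MS -> mxact g a = a.
  by move=> aA; have := coass_scale_act t (sub0mx _ _) (sub0mx _ _) aA; rewrite !(addr0, add0r) !scaler0 !add0r.
apply/G2P; split=> [|x y].
  apply/trmx_inj; rewrite trmx_mul trmxK trmx1; apply/row_matrixP => i.
  rewrite row1 rowE; apply: dotvI => y; rewrite mulmxA dotv_mulmx.
  rewrite -/(mxact g _) -/(mxact g _).
  have [u [v [a [uU vV aA ->]]]] := coass_decomp (delta_mx 0 i).
  have [u' [v' [a' [uU' vV' aA' ->]]]] := coass_decomp y.
  rewrite !mxactD (gU _ uU) (gU _ uU') (gV _ vV) (gV _ vV') (gA _ aA) (gA _ aA').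
  rewrite !dotvDl !dotvDr !dotvZl !dotvZr.
  rewrite (coass_dotUU uU uU') (coass_dotVV vV vV') (coass_dotAU aA uU').
  rewrite (coass_dotAV aA vV') (dotvC u a') (dotvC v a') (coass_dotAU aA' uU).
  rewrite (coass_dotAV aA' vV).
  by rewrite !mulr0 !addr0 !add0r mulVKf // mulKf.
have [u [v [a [uU vV aA ->]]]] := coass_decomp x.
have [u' [v' [a' [uU' vV' aA' ->]]]] := coass_decomp y.
rewrite !mxactD (gU _ uU) (gU _ uU') (gV _ vV) (gV _ vV') (gA _ aA) (gA _ aA').
rewrite !imcrossDl !imcrossDr !imcrossZl !imcrossZr !mxactD.
rewrite (coass_crossUU uU uU') (coass_crossVV vV vV').
have VU b c : (b <= V)%MS -> (c <= U)%MS -> (imcross b c <= A)%MS.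
  by move=> bV cU; rewrite imcrossC eqmx_opp coass_crossUV.
have AU b c : (b <= A)%MS -> (c <= U)%MS -> (imcross b c <= U)%MS.
  by move=> bA cU; rewrite imcrossC eqmx_opp coass_crossUA.
have AV b c : (b <= A)%MS -> (c <= V)%MS -> (imcross b c <= V)%MS.
  by move=> bA cV; rewrite imcrossC eqmx_opp coass_crossVA.
have := gA _ (coass_crossUV uU vV'); have := gU _ (coass_crossUA uU aA').
have := gV _ (coass_crossVA vV aA'); have := gA _ (coass_crossAA aA aA').
have := gA _ (VU _ _ vV uU'); have := gU _ (AU _ _ aA uU'); have := gV _ (AV _ _ aA vV').
move: (imcross u v') (imcross u a') (imcross v a') (imcross a a').
move: (imcross v u') (imcross a u') (imcross a v').
move=> x1 x2 x3 x4 x5 x6 x7 e3 e2 e1 e7 e6 e5 e4.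
have g0 : mxact g 0 = 0 by rewrite /mxact mul0mx.
rewrite g0 e1 e2 e3 e4 e5 e6 e7 !scaler0 !scalerA mulVf // mulfV // !scale1r.
by [].
Qed.

End CoassociativePlane.

Lemma mxact_inj (K : fieldType) n (g h : 'M[K]_n) :
  (forall x : 'rV[K]_n, mxact g x = mxact h x) -> g = h.
Proof.
by move=> H; apply/trmx_inj/row_matrixP => i; rewrite !rowE; exact: H.
Qed.

(** * Simple elements as fractions *)

Section SimpleElement.
Variable R : realType.
Local Notation K := (Cplx R).
Variables (alpha : K) (U : 'M[K]_7).
Hypothesis alpha_nreal : alpha \isn't Num.real.
Hypothesis hU : coassociative U.
Local Notation V := (cplx_conjmx U).
Local Notation A := (perp (U + V)%MS).

Lemma conj_neq : alpha != Num.conj alpha.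
Proof. by apply: contra alpha_nreal => /eqP e; apply/CrealP. Qed.

Definition pole_poly : {poly K} := ('X - alpha%:P) * ('X - (Num.conj alpha)%:P).

Definition pi_plane : 'M[K]_7 := proj_along U (A + V)%MS.
Definition pi_conj : 'M[K]_7 := proj_along V (U + A)%MS.

(** pole_poly times the simple element, written so that its difference with pole_poly
    visibly has smaller degree: (z - conj alpha)^2 - (z - alpha) (z - conj alpha) is
    (alpha - conj alpha) (z - conj alpha). *)
Definition simple_poly : 'M[{poly K}]_7 :=
  pole_poly%:M + ((alpha - Num.conj alpha) *: ('X - (Num.conj alpha)%:P)) *: cst_mx pi_conj
  - ((alpha - Num.conj alpha) *: ('X - alpha%:P)) *: cst_mx pi_plane.

Lemma pole_polyE z : pole_poly.[z] = (z - alpha) * (z - Num.conj alpha).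
Proof. by rewrite /pole_poly !hornerE. Qed.

Lemma coass_scale1 : coass_scale U 1 = 1%:M.
Proof.
apply: mxact_inj => x; rewrite mxact1.
have [u [v [a [uU vV aA ->]]]] := coass_decomp hU x.
by rewrite (coass_scale_act hU) // invr1 !scale1r.
Qed.

Lemma coass_scaleE t : coass_scale U t = 1%:M + (t - 1) *: pi_conj + (t^-1 - 1) *: pi_plane.
Proof.
rewrite -coass_scale1 /coass_scale -/pi_conj -/pi_plane invr1.
move: pi_conj pi_plane (proj_along A _) => P Q S.
by apply/matrixP => i j; rewrite !mxE; ring.
Qed.

(** A simple element takes its values in the one-parameter group coass_scale. *)
Definition ratio_at (z : K) : K := (z - Num.conj alpha) / (z - alpha).

Lemma simple_element_at z : simple_element alpha U (pt z) = coass_scale U (ratio_at z).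
Proof. by rewrite /simple_element /coass_scale /linear_ratio /= /ratio_at invf_div. Qed.

Lemma simple_poly_at z : z != alpha -> z != Num.conj alpha ->
  (pole_poly.[z])^-1 *: ev z simple_poly = coass_scale U (ratio_at z).
Proof.
rewrite -subr_eq0 -[z == Num.conj _]subr_eq0 => z1 z2.
rewrite coass_scaleE /simple_poly; move: pi_conj pi_plane => P Q.
apply/matrixP => i j; set S := _ - _.
have e : ev z S i j = pole_poly.[z] *+ (i == j)
    + (alpha - Num.conj alpha) * (z - Num.conj alpha) * P i j
    - (alpha - Num.conj alpha) * (z - alpha) * Q i j.
  by rewrite evE !mxE hornerD hornerN hornerD hornerMn !hornerM !hornerZ !hornerE.
rewrite mxE e pole_polyE !mxE; case: (i == j); rewrite ?mulr1n ?mulr0n /ratio_at;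
  by field; rewrite z1 z2.
Qed.

Lemma ratio_at_neq0 z : z != alpha -> z != Num.conj alpha -> ratio_at z != 0.
Proof. by move=> z1 z2; rewrite mulf_neq0 ?invr_eq0 // subr_eq0. Qed.

Lemma conj_coass_scale t : cplx_conjmx (coass_scale U t) = coass_scale U (Num.conj t)^-1.
Proof.
apply: mxact_inj => x.
have -> : mxact (cplx_conjmx (coass_scale U t)) x =
    cplx_conjmx (mxact (coass_scale U t) (cplx_conjmx x)).
  by rewrite conj_mxact cplx_conjK.
have [u [v [a [uU vV aA ->]]]] := coass_decomp hU x.
have uV : (cplx_conjmx u <= V)%MS by rewrite conj_sub.
have vU : (cplx_conjmx v <= U)%MS by rewrite -conj_sub_swap.
have aA' : (cplx_conjmx a <= A)%MS by rewrite coass_conjA.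
rewrite (coass_scale_act hU _ uU vV aA) !cplx_conjD.
rewrite [cplx_conjmx u + _]addrC (coass_scale_act hU _ vU uV aA').
rewrite !cplx_conjD !cplx_conjZ !cplx_conjK fmorphV invrK.
by rewrite [X in X + a]addrC.
Qed.

Lemma pole_poly_neq0 : pole_poly != 0.
Proof. by rewrite mulf_neq0 // polyXsubC_eq0. Qed.

Lemma size_pole_poly : size pole_poly = 3%N.
Proof. by rewrite size_mul ?polyXsubC_eq0 // !size_XsubC. Qed.

Lemma pole_nonroots z : pole_poly.[z] != 0 -> z != alpha /\ z != Num.conj alpha.
Proof. by rewrite pole_polyE mulf_eq0 negb_or !subr_eq0 => /andP[]. Qed.

Lemma loop_frac_simple : loop_frac simple_poly pole_poly.
Proof.
have [oD dD] := nonroots_open_dense pole_poly_neq0.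
split; first exact: pole_poly_neq0.
- apply: (G2_poly_nonroots pole_poly_neq0) => z /[dup] qz /pole_nonroots[z1 z2].
  by rewrite simple_poly_at //; apply: coass_scale_G2; rewrite ?ratio_at_neq0.
- apply: (conj_poly_dense dD) => z /= /[dup] qz /pole_nonroots[z1 z2].
  have z1' : Num.conj z != alpha by rewrite -(inj_eq (can_inj conjCK)) conjCK.
  have z2' : Num.conj z != Num.conj alpha by rewrite (inj_eq (can_inj conjCK)).
  split=> //; first by rewrite pole_polyE mulf_neq0 // subr_eq0.
  rewrite !simple_poly_at // conj_coass_scale; congr (coass_scale _ _).
  have cB (x y : K) : Num.conj (x - y) = Num.conj x - Num.conj y by exact: rmorphB.
  have cD (x y : K) : Num.conj (x / y) = Num.conj x / Num.conj y by exact: fmorph_div.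
  by rewrite /ratio_at cD !cB !conjCK invf_div.
move=> i j; rewrite size_pole_poly.
rewrite /simple_poly; move: pi_conj pi_plane (alpha - _) => P Q d; rewrite !mxE.
have -> (a b c : {poly K}) : a + b - c - a = b - c by ring.
rewrite ![_ * _%:P]mulrC !mul_polyC !scalerA ![_ * d]mulrC -!scalerA -scalerBr.
apply: leq_ltn_trans (size_scale_leq _ _) _.
apply: leq_ltn_trans (size_polyD _ _) _; rewrite size_polyN gtn_max.
by rewrite !(leq_ltn_trans (size_scale_leq _ _)) // size_XsubC.
Qed.

Lemma simple_element_frac : loop_eq (simple_element alpha U) (frac_loop simple_poly pole_poly).
Proof.
have [oD dD] := nonroots_open_dense pole_poly_neq0.
apply/loop_eqP; exists [set z | pole_poly.[z] != 0]; split => // z /= /pole_nonroots[z1 z2].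
by rewrite simple_element_at simple_poly_at.
Qed.

Lemma simple_element_rational : rational_G2_loop (simple_element alpha U).
Proof.
exists simple_poly, pole_poly; split; first exact: loop_frac_simple.
exact: simple_element_frac.
Qed.

End SimpleElement.

(** * Annihilators of null vectors *)

Section Annihilator.
Variable K : numClosedFieldType.
Implicit Types w x y z c u v : 'rV[K]_7.

(** Left multiplication by w, acting on rows from the right. *)
Definition cross_mx w : 'M[K]_7 := \matrix_i imcross w (delta_mx 0 i).

Lemma cross_mxE w y : y *m cross_mx w = imcross w y.
Proof.
rewrite mulmx_sum_row {2}(row_sum_delta y).
rewrite (@big_morph _ _ (imcross w) 0 +%R 0 +%R); last 2 first.
- by move=> a b; exact: imcrossDr.
- exact: imcross0r.
by apply: eq_bigr => i _; rewrite imcrossZr rowK.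
Qed.

Definition annihilator w : 'M[K]_7 := kermx (cross_mx w).

Lemma annihilatorP w y : reflect (imcross w y = 0) (y <= annihilator w)%MS.
Proof. by rewrite -cross_mxE; exact: sub_kermxP. Qed.

Lemma null_dot w : w != 0 -> exists z, dotv w z = 1.
Proof.
move=> w0; exists ((dotv w (cplx_conjmx w))^-1 *: cplx_conjmx w).
by rewrite dotvZr mulVf // dotv_herm_eq0.
Qed.

Lemma annihilator_perp w y : w != 0 -> dotv w w = 0 -> imcross w y = 0 -> dotv w y = 0.
Proof.
move=> w0 ww wy; have := cross_crossE w y.
rewrite wy imcross0r ww scale0r subr0 => /esym/eqP.
by rewrite scaler_eq0 (negPf w0) orbF => /eqP.
Qed.

(** By polarization w (y z) = <y, z> w, and the left side is skew in y and z. *)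
Lemma annihilator_isotropic w y z : w != 0 -> dotv w w = 0 ->
  imcross w y = 0 -> imcross w z = 0 -> dotv y z = 0.
Proof.
move=> w0 ww wy wz.
have H a b : imcross w a = 0 -> imcross w b = 0 ->
    imcross w (imcross a b) = dotv a b *: w.
  move=> wa wb; have := cross_cross_sym w a b.
  rewrite wb imcross0r addr0 => ->.
  by rewrite !(annihilator_perp w0 ww) // mulr0 !scale0r add0r subr0.
have /eqP := H y z wy wz; have /eqP := H z y wz wy.
rewrite (imcrossC z y) crossNr (H y z wy wz) -subr_eq0 (dotvC z y) -opprD oppr_eq0.
rewrite -scalerDl scaler_eq0 (negPf w0) orbF -mulr2n mulrn_eq0 /=.
by move=> /eqP.
Qed.

(** With <w, z> = 1 one has w (w z) = w, so that y - s w z is in the annihilator, as c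
    is; and <c, w z> = - <w c, z> = 0. *)
Lemma annihilator_eigen w y c s : w != 0 -> dotv w w = 0 -> imcross w c = 0 ->
  imcross w y = s *: w -> dotv c y = 0.
Proof.
move=> w0 ww wc wy; have [z wz] := null_dot w0.
have k0 : imcross w (y - s *: imcross w z) = 0.
  by rewrite imcrossDr crossNr imcrossZr cross_crossE wz ww scale1r scale0r subr0 wy subrr.
have := annihilator_isotropic w0 ww wc k0.
rewrite dotvDr dotvNr dotvZr dotvC -[dotv c (imcross w z)]dotvC dotv_crossC.
by rewrite [dotv z _]dotvC wc dotv0l oppr0 mulr0 subr0 dotvC.
Qed.

(** At most 3 by isotropy.  At least 3 because the square of left multiplication by a
    null vector has rank one. *)
Lemma rank_annihilator w : w != 0 -> dotv w w = 0 -> \rank (annihilator w) = 3%N.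
Proof.
move=> w0 ww; apply/eqP; rewrite eqn_leq; apply/andP; split.
  have : (annihilator w <= perp (annihilator w))%MS.
    apply/row_subP => i; apply/perpP => y /annihilatorP wy.
    apply: (annihilator_isotropic w0 ww) => //; apply/annihilatorP; exact: row_sub.
  move=> /mxrankS; rewrite rank_perp; have := rank_leq_row (annihilator w).
  by case: (\rank _) => [|[|[|[|[|[|[|[|]]]]]]]].
have := mxrank_mul_min (cross_mx w) (cross_mx w).
have : (\rank (cross_mx w *m cross_mx w) <= 1)%N.
  have sub : (cross_mx w *m cross_mx w <= w)%MS.
    apply/row_subP => i; rewrite row_mul cross_mxE rowK cross_crossE ww scale0r subr0.
    exact: scalemx_sub.
  by apply: leq_trans (mxrankS sub) (rank_leq_row _).
rewrite /annihilator mxrank_ker; have := rank_leq_row (cross_mx w).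
case: (\rank (cross_mx w)) => [|[|[|[|[|[|[|[|]]]]]]]] //= _ h1 h2.
all: by have := leq_trans h2 h1.
Qed.

Lemma null_pair_cross w c z : imcross w c = 0 -> dotv w c = 0 ->
  imcross w (imcross c z) = (2 * dotv w z) *: c - dotv c z *: w.
Proof.
move=> wc dwc; have := cross_cross_sym w z c.
rewrite wc imcross0r addr0 dwc scale0r add0r (dotvC z c) => h.
by rewrite (imcrossC c) crossNr h opprB.
Qed.

(** If b0, b1, b2 in W are independent, W is the annihilator of b0.  With z_i dual
    to b_i and y_i = b_i z_i, the products b_j y_i are 2 delta_ij b_i - b_j, so that
    y0 + y1 is annihilated by b0, hence belongs to W, but is not annihilated by
    b2. *)
Lemma null_rank_le2 (W : 'M[K]_7) : isotropic W ->
  (forall x y, (x <= W)%MS -> (y <= W)%MS -> imcross x y = 0) -> (\rank W <= 2)%N.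
Proof.
move=> iW cW; rewrite leqNgt; apply/negP => r3.
pose B : 'M[K]_(3, 7) := pid_mx 3 *m row_base W.
have BW : (B <= W)%MS by rewrite /B (submx_trans (submxMl _ _)) // eq_row_base.
have fB : row_free B.
  by rewrite /row_free /B mxrankMfree ?row_base_free // rank_pid_mx.
pose b i := row i B; pose z i := row i (pinvmx B)^T.
have bW i : (b i <= W)%MS by exact: submx_trans (row_sub _ _) BW.
have bz i j : dotv (b i) (z j) = (i == j)%:R.
  have /matrixP/(_ i j) := mulmxVp fB; rewrite !mxE => <-.
  by apply: eq_bigr => k _; rewrite !mxE.
have b0 i : b i != 0.
  apply/eqP => e; have := bz i i; rewrite e dotv0l eqxx => /esym/eqP.
  by rewrite oner_eq0.
pose y i := imcross (b i) (z i).
have by_ i j : imcross (b j) (y i) = (2 * (j == i)%:R) *: b i - b j.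
  rewrite /y null_pair_cross ?bz ?eqxx ?scale1r //; first exact: cW.
  exact: iW.
pose i0 : 'I_3 := inord 0; pose i1 : 'I_3 := inord 1; pose i2 : 'I_3 := inord 2.
have [n01 n20 n21] : [/\ i0 == i1 = false, i2 == i0 = false & i2 == i1 = false].
  by rewrite -!val_eqE /= !inordK.
have nb : dotv (b i0) (b i0) = 0 by exact: iW.
have WA : (W == annihilator (b i0))%MS.
  have sWA : (W <= annihilator (b i0))%MS.
    by apply/row_subP => i; apply/annihilatorP/cW => //; exact: row_sub.
  have := mxrank_leqif_eq sWA; rewrite rank_annihilator // => -[h e].
  by rewrite -e eqn_leq h.
have sW : ((y i0 + y i1)%R <= W)%MS.
  have /andP[_ sAW] := WA; apply: (submx_trans _ sAW).
  apply/annihilatorP; rewrite imcrossDr !by_ eqxx n01.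
  by rewrite mulr0 scale0r sub0r mulr1 scaler_nat mulr2n addrK subrr.
have := cW _ _ (bW i2) sW; rewrite imcrossDr !by_ n20 n21 mulr0 !scale0r !sub0r.
move=> /eqP; rewrite -opprD oppr_eq0 -mulr2n -scaler_nat scaler_eq0 pnatr_eq0 /=.
by rewrite (negPf (b0 i2)).
Qed.

End Annihilator.

(** * Planes adapted to a pole *)

Section Planes.
Variable K : numClosedFieldType.
Implicit Types w x y z c u v : 'rV[K]_7.

Definition plane w c : 'M[K]_7 := (<<w>> + <<c>>)%MS.

Lemma planeP w c x : (x <= plane w c)%MS -> exists a b, x = a *: w + b *: c.
Proof.
move=> /sub_addsmxP[[p q] /= ->].
have /sub_rVP[a ->] : (p *m <<w>>%MS <= w)%MS.
  by rewrite (submx_trans (submxMl _ _)) // genmxE.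
have /sub_rVP[b ->] : (q *m <<c>>%MS <= c)%MS.
  by rewrite (submx_trans (submxMl _ _)) // genmxE.
by exists a, b.
Qed.

Lemma plane_l w c : (w <= plane w c)%MS.
Proof. by rewrite (submx_trans _ (addsmxSl _ _)) // genmxE. Qed.

Lemma plane_r w c : (c <= plane w c)%MS.
Proof. by rewrite (submx_trans _ (addsmxSr _ _)) // genmxE. Qed.

Lemma rank_plane w c : w != 0 -> c != 0 -> dotv c (cplx_conjmx w) = 0 ->
  \rank (plane w c) = 2%N.
Proof.
move=> w0 c0 cw; have := mxrank_sum_cap <<w>>%MS <<c>>%MS.
rewrite -/(plane w c) !mxrank_gen !rank_rV w0 c0 /=.
suff -> : (<<w>> :&: <<c>>)%MS = 0 by rewrite mxrank0 addn0.
apply/eqP; rewrite -submx0; apply/row_subP => i; set x := row i _.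
have : (x <= <<w>> :&: <<c>>)%MS by exact: row_sub.
rewrite sub_capmx !genmxE => /andP[/sub_rVP[a xa] /sub_rVP[b xb]].
rewrite submx0 -dotv_herm_eq0 {2}xa xb cplx_conjZ dotvZl dotvZr cw !mulr0.
by rewrite eqxx.
Qed.

(** Hermitian orthogonality makes w and c independent. *)
Lemma coassociative_plane w c : w != 0 -> c != 0 -> dotv c (cplx_conjmx w) = 0 ->
  dotv w w = 0 -> imcross w c = 0 -> dotv c c = 0 -> coassociative (plane w c).
Proof.
move=> w0 c0 cw ww wc cc.
have dwc : dotv w c = 0 := annihilator_perp w0 ww wc.
split; first exact: rank_plane.
  move=> x y /planeP[a [b ->]] /planeP[a' [b' ->]].
  rewrite !dotvDl !dotvDr !dotvZl !dotvZr ww cc (dotvC c w) dwc.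
  by rewrite !mulr0 !addr0.
move=> x y /planeP[a [b ->]] /planeP[a' [b' ->]]; rewrite improdE.
rewrite !imcrossDl !imcrossDr !imcrossZl !imcrossZr !crossxx (imcrossC c w) wc.
by rewrite oppr0 !scaler0 !addr0.
Qed.

End Planes.

(** P0 and P1 are the first two Taylor coefficients at a pole of the numerator of a
    loop; the hypotheses are the lowest order terms of the equations of G2. *)

Section PoleData.
Variables (K : numClosedFieldType) (M0 M1 : 'M[K]_7) (s : K).
Implicit Types w x y z c e u v : 'rV[K]_7.
Local Notation P0 := (mxact M0).
Local Notation P1 := (mxact M1).
Hypothesis P00 : forall u v, dotv (P0 u) (P0 v) = 0.
Hypothesis P01 : forall u v, dotv (P0 u) (P1 v) + dotv (P1 u) (P0 v) = 0.
Hypothesis X00 : forall u v, imcross (P0 u) (P0 v) = 0.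
Hypothesis X01 : forall u v,
  imcross (P1 u) (P0 v) + imcross (P0 u) (P1 v) = s *: P0 (imcross u v).
Hypothesis M00 : M0 != 0.

(** The tilt: it measures the failure of the image of P0 to be orthogonal to that
    of P1. *)
Let B u v := dotv (P0 u) (P1 v).

Lemma tilt_skew u v : B u v = - B v u.
Proof. by apply/eqP; rewrite -addr_eq0 /B (dotvC (P0 v)) P01. Qed.

Lemma tilt_diag u : B u u = 0.
Proof.
have /eqP := tilt_skew u u; rewrite -addr_eq0 -mulr2n mulrn_eq0 /=.
by move=> /eqP.
Qed.

Lemma image_isotropic : isotropic M0^T.
Proof. by move=> x y /submxP[u ->] /submxP[v ->]; exact: P00. Qed.

Lemma image_cross0 x y : (x <= M0^T)%MS -> (y <= M0^T)%MS -> imcross x y = 0.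
Proof. by move=> /submxP[u ->] /submxP[v ->]; exact: X00. Qed.

Lemma mem_image u : (P0 u <= M0^T)%MS.
Proof. exact: submxMl. Qed.

Lemma rank_image : (0 < \rank M0^T <= 2)%N.
Proof.
rewrite null_rank_le2 ?andbT; first by rewrite lt0n mxrank_eq0 trmx_eq0.
- exact: image_isotropic.
- by move=> x y; exact: image_cross0.
Qed.

(** The planes U whose simple element cancels the pole entirely. *)
Definition cancelling (U : 'M[K]_7) := [/\ coassociative U, (M0^T <= U)%MS &
  forall c u, (c <= U)%MS -> dotv c (P1 u) = 0].

(** The image is spanned by w = P0 u0, and P1 is orthogonal to w by skewness.  A
    vector c of the three-dimensional annihilator of w can be chosen orthogonal to
    P1 u0 and to conj w.  On the kernel of P0, the first order term of the
    product equation gives w x P1 v = r w, so that c is orthogonal to P1 v there too. *)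
Lemma cancelling_rank1 : \rank M0^T = 1%N -> exists U, cancelling U.
Proof.
move=> r1; have [w wM w0] : exists2 w : 'rV[K]_7, (w <= M0^T)%MS & w != 0.
  by apply/rowV0Pn; rewrite -mxrank_eq0 r1.
have [u0 wE] : exists u0, w = P0 u0 by have /submxP[u0 ->] := wM; exists u0.
have Mw : (M0^T <= w)%MS.
  by have := mxrank_leqif_sup wM; rewrite r1 rank_rV w0 => -[_ /esym/idP].
have ww : dotv w w = 0 by rewrite wE P00.
have xi u : exists a, P0 u = a *: w.
  by apply/sub_rVP; exact: submx_trans (mem_image u) Mw.
have [|c [c0 cw cP]] := @cap_neq0 K 7 (annihilator w) (perp (plane (P1 u0) (cplx_conjmx w))).
  rewrite rank_annihilator // rank_perp /plane.
  have := mxrank_adds_leqif <<P1 u0>>%MS <<cplx_conjmx w>>%MS.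
  rewrite !mxrank_gen !rank_rV => -[+ _] => h.
  have {}h : (\rank (<<P1 u0>> + <<cplx_conjmx w>>)%MS <= 2)%N.
    by apply: leq_trans h _; apply: (@leq_add _ _ 1 1); case: (_ != 0).
  by case: (\rank _) h => [|[|[|]]].
move/annihilatorP: cw => wc; move/perpP: cP => cP.
have cu0 : dotv c (P1 u0) = 0 by apply: cP; exact: plane_l.
have cw : dotv c (cplx_conjmx w) = 0 by apply: cP; exact: plane_r.
have cc : dotv c c = 0 := annihilator_isotropic w0 ww wc wc.
exists (plane w c); split; first exact: coassociative_plane.
  by rewrite (submx_trans Mw) // plane_l.
have wP1 v : dotv w (P1 v) = 0.
  have := tilt_skew u0 v; rewrite /B; have [a ->] := xi v.
  by rewrite -wE dotvZl {2}wE -/(B u0 u0) tilt_diag mulr0 oppr0.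
move=> x v /planeP[a [b ->]]; rewrite dotvDl !dotvZl wP1 mulr0 add0r.
have [t vt] := xi v; pose v' := v - t *: u0.
have v'0 : P0 v' = 0 by rewrite /v' mxactD -scaleNr mxactZ vt -wE scaleNr subrr.
have [r rE] := xi (imcross u0 v').
have := X01 u0 v'; rewrite v'0 imcross0r add0r rE scalerA -wE.
move=> /(annihilator_eigen w0 ww wc) cv'.
have -> : v = v' + t *: u0 by rewrite subrK.
by rewrite mxactD mxactZ dotvDr dotvZr cu0 cv' !(mulr0, addr0).
Qed.

Lemma cancelling_rank2 : \rank M0^T = 2%N -> (forall u v, B u v = 0) ->
  cancelling M0^T.
Proof.
move=> r2 B0; split => //.
  split; [exact: r2|exact: image_isotropic|].
  by move=> x y xM yM; rewrite improdE image_cross0.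
by move=> c u /submxP[v ->]; exact: B0.
Qed.

(** The image is spanned by w and e, Hermitian orthogonal, and U by w and a vector of
    its annihilator that is Hermitian orthogonal to w and e: then w lies in U and e in
    the complement A of U + conj U.  Multiplication by the simple element of U turns
    the tilt into zero. *)
Lemma untilting_plane : \rank M0^T = 2%N -> exists w e U,
  [/\ coassociative U, (w <= U)%MS, (e <= perp (U + cplx_conjmx U)%MS)%MS,
      exists u1 u2, w = P0 u1 /\ e = P0 u2 &
      forall u, exists a b, P0 u = a *: w + b *: e].
Proof.
move=> r2; have [w wM w0] : exists2 w : 'rV[K]_7, (w <= M0^T)%MS & w != 0.
  by apply/rowV0Pn; rewrite -mxrank_eq0 r2.
have [|e [e0 eM eP]] := @cap_neq0 K 7 M0^T (perp <<cplx_conjmx w>>%MS).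
  by rewrite r2 rank_perp mxrank_gen rank_conj rank_rV w0.
have ew : dotv e (cplx_conjmx w) = 0 by move/perpP: eP; apply; rewrite genmxE.
have ww : dotv w w = 0 by exact: image_isotropic.
have we : imcross w e = 0 by exact: image_cross0.
have [|c [c0 cw cP]] := @cap_neq0 K 7 (annihilator w)
    (perp (plane (cplx_conjmx w) (cplx_conjmx e))).
  rewrite rank_annihilator // rank_perp rank_plane //.
  - by rewrite map_mx_eq0.
  - by rewrite map_mx_eq0.
  - by rewrite dotv_conj ew rmorph0.
move/annihilatorP: cw => wc; move/perpP: cP => cP.
have cw : dotv c (cplx_conjmx w) = 0 by apply: cP; exact: plane_l.
have ce : dotv c (cplx_conjmx e) = 0 by apply: cP; exact: plane_r.
have cc : dotv c c = 0 := annihilator_isotropic w0 ww wc wc.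
have hU := coassociative_plane w0 c0 cw ww wc cc.
exists w, e, (plane w c); split => //; first exact: plane_l.
- apply: coass_memA => x.
    move=> /planeP[a [b ->]]; rewrite dotvDr !dotvZr.
    rewrite (annihilator_isotropic w0 ww we wc) dotvC image_isotropic //.
    by rewrite !mulr0 addr0.
  rewrite conj_sub_swap => /planeP[a [b xE]].
  rewrite -[x]cplx_conjK xE cplx_conjD !cplx_conjZ dotvDr !dotvZr ew.
  by rewrite -[e]cplx_conjK dotv_conj dotvC ce rmorph0 !mulr0 addr0.
- have /submxP[u1 w1] := wM; have /submxP[u2 e2] := eM.
  by exists u1, u2.
move=> u; apply: planeP; apply: submx_trans (mem_image u) _.
have sub : (plane w e <= M0^T)%MS by rewrite addsmx_sub !genmxE wM.
have := mxrank_leqif_sup sub; rewrite r2 rank_plane // => -[_ /esym/idP].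
by [].
Qed.

End PoleData.

(** * Taylor coefficients at a pole *)

Section Taylor.
Variable K : fieldType.
Implicit Types (a : K) (p q : {poly K}).

Definition dmx m n (A : 'M[{poly K}]_(m, n)) : 'M[{poly K}]_(m, n) := map_mx (@deriv K) A.

Lemma dmxM m n k (A : 'M[{poly K}]_(m, n)) (B : 'M[{poly K}]_(n, k)) :
  dmx (A *m B) = dmx A *m B + A *m dmx B.
Proof.
apply/matrixP => i j; rewrite !mxE raddf_sum -big_split; apply: eq_bigr => l _ /=.
by rewrite derivM !mxE.
Qed.

Lemma dmxD m n (A B : 'M[{poly K}]_(m, n)) : dmx (A + B) = dmx A + dmx B.
Proof. by apply/matrixP => i j; rewrite !mxE derivD. Qed.

Lemma dmxZ m n p (A : 'M[{poly K}]_(m, n)) : dmx (p *: A) = p^`() *: A + p *: dmx A.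
Proof. by apply/matrixP => i j; rewrite !mxE derivM. Qed.

Lemma dmx_cst m n (A : 'M[K]_(m, n)) : dmx (cst_mx A) = 0.
Proof. by apply/matrixP => i j; rewrite !mxE derivC. Qed.

Lemma dmx_tr m n (A : 'M[{poly K}]_(m, n)) : dmx A^T = (dmx A)^T.
Proof. by rewrite /dmx map_trmx. Qed.

Lemma dmx_scalar n p : dmx (p%:M : 'M[{poly K}]_n) = (p^`())%:M.
Proof. by apply/matrixP => i j; rewrite !mxE derivMn. Qed.

Lemma dmx_imcross (u v : 'rV[{poly K}]_7) :
  dmx (imcross u v) = imcross (dmx u) v + imcross u (dmx v).
Proof.
apply/rowP => i; rewrite !mxE !(derivD, derivN, derivM).
ring.
Qed.

Lemma dmx_mxact (M : 'M[{poly K}]_7) (u : 'rV[K]_7) :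
  dmx (mxact M (cst_mx u)) = mxact (dmx M) (cst_mx u).
Proof. by rewrite /mxact dmxM dmx_cst mul0mx add0r dmx_tr. Qed.

Lemma evD a m n (A B : 'M[{poly K}]_(m, n)) : ev a (A + B) = ev a A + ev a B.
Proof. exact: map_mxD. Qed.

Variables (M : 'M[{poly K}]_7) (q : {poly K}) (a : K).
Hypothesis HG : G2_poly M q.
Hypothesis qa : q.[a] = 0.
Local Notation P0 := (mxact (ev a M)).
Local Notation P1 := (mxact (ev a (dmx M))).

Lemma pole_dot00 u v : dotv (P0 u) (P0 v) = 0.
Proof.
have [h _] := HG; have := congr1 (fun A => ev a A) h.
rewrite evM ev_tr ev_scalar horner_exp qa expr0n /= raddf0 => e.
by rewrite /mxact dotv_mulmx trmxK -mulmxA e mulmx0 dotv0r.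
Qed.

(** The equations of G2 can also be differentiated once at a root of q.  As q^2 has a double
    root, only the equation of the product sees the derivative of q. *)
Lemma pole_dot01 u v : dotv (P0 u) (P1 v) + dotv (P1 u) (P0 v) = 0.
Proof.
have [h _] := HG; have := congr1 (fun A => ev a (dmx A)) h.
rewrite dmxM dmx_tr dmx_scalar evD !evM !ev_tr ev_scalar expr2 derivM.
rewrite hornerD !hornerM qa mul0r mulr0 addr0 raddf0 => e.
rewrite /mxact !dotv_mulmx !trmxK -!mulmxA -dotvDr -mulmxDr addrC.
by rewrite [X in _ *m X]addrC e mulmx0 dotv0r.
Qed.

Lemma pole_cross00 u v : imcross (P0 u) (P0 v) = 0.
Proof.
have [_ h] := HG; have := congr1 (fun w => ev a w) (h u v).
by rewrite ev_imcross evZ !ev_mxact !ev_cst qa scale0r.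
Qed.

Lemma pole_cross01 u v :
  imcross (P1 u) (P0 v) + imcross (P0 u) (P1 v) = q^`().[a] *: P0 (imcross u v).
Proof.
have [_ h] := HG; have := congr1 (fun w => ev a (dmx w)) (h u v).
rewrite dmx_imcross dmxZ !evD !ev_imcross !evZ !dmx_mxact !ev_mxact !ev_cst qa.
by rewrite scale0r addr0.
Qed.

End Taylor.

(** * Common factors and real fractions *)

Section Fractions.
Variable R : realType.
Local Notation K := (Cplx R).
Implicit Types (z w : K) (M N : 'M[{poly K}]_7) (p q : {poly K}) (g h : loop_rep R).

Lemma scaled_frac_at M p q z : p.[z] != 0 ->
  ((p * q).[z])^-1 *: ev z (p *: M) = (q.[z])^-1 *: ev z M.
Proof. by move=> pz; rewrite hornerM evZ scalerA invfM mulrAC mulVf // mul1r. Qed.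

Lemma frac_loop_scale M p q : p != 0 -> loop_eq (frac_loop (p *: M) (p * q)) (frac_loop M q).
Proof.
move=> /nonroots_open_dense[op dp]; apply/loop_eqP; exists [set z | p.[z] != 0].
by split => // z pz; exact: scaled_frac_at.
Qed.

Lemma loop_frac_scale M p q : p != 0 -> loop_frac (p *: M) (p * q) <-> loop_frac M q.
Proof.
move=> p0; have [op dp] := nonroots_open_dense p0.
have pc0 : conj_poly p != 0 by rewrite map_poly_eq0.
split=> -[q0 HG Hr Hs].
  have {}q0 : q != 0 by move: q0; rewrite mulf_eq0 negb_or => /andP[].
  split => //.
  - have [oq dq] := nonroots_open_dense q0.
    apply: (G2_poly_dense (open_denseI op dp oq dq).2) => z [pz qz]; split => //.
    by rewrite -(scaled_frac_at _ _ pz); apply: G2_ev HG _; rewrite hornerM mulf_neq0.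
  - apply/matrixP => i j; have := congr1 (fun A : 'M[{poly K}]_7 => A i j) Hr.
    rewrite !mxE !conj_polyM => e; apply: (mulfI p0); apply: (mulfI pc0).
    by apply: (etrans (etrans _ e)); ring.
  move=> i j; have := Hs i j; rewrite mxE -mulrnAr -mulrBr.
  have [-> //|N0] := eqVneq (M i j - q *+ (i == j)) 0.
    by rewrite size_poly0 size_poly_gt0.
  rewrite !size_mul // -!subn1 ltn_sub2rE ?ltn_add2l //.
  by rewrite addn_gt0 size_poly_gt0 p0.
split; first by rewrite mulf_neq0.
- have [opq dpq] := nonroots_open_dense (mulf_neq0 p0 q0).
  apply: (G2_poly_dense dpq) => z /= pqz.
  have [pz qz] : p.[z] != 0 /\ q.[z] != 0.
    by move: pqz; rewrite hornerM mulf_eq0 negb_or => /andP.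
  split => //; by rewrite scaled_frac_at //; exact: G2_ev.
- apply/matrixP => i j; have := congr1 (fun A : 'M[{poly K}]_7 => A i j) Hr.
  rewrite !mxE !conj_polyM => e.
  by rewrite mulrACA e; ring.
move=> i j; rewrite mxE -mulrnAr -mulrBr mulrC (mulrC p).
by apply: size_mul_lt.
Qed.

Lemma real_numerator M q : loop_frac M q -> conj_poly q = q ->
  map_mx (@conj_poly R) M = M.
Proof.
move=> [q0 _ Hr _] qr; apply/matrixP => i j.
have := congr1 (fun A : 'M[{poly K}]_7 => A i j) Hr.
by rewrite qr !mxE => /(mulfI q0).
Qed.

Lemma mx_dvdp p M : (forall i j, p %| M i j) -> exists N, M = p *: N.
Proof.
move=> H; exists (\matrix_(i, j) (M i j %/ p)).
by apply/matrixP => i j; rewrite !mxE mulrC divpK.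
Qed.

(** A real polynomial vanishes at conj alpha along with alpha. *)
Lemma pole_poly_dvdp (alpha : K) p : alpha \isn't Num.real -> conj_poly p = p ->
  p.[alpha] = 0 -> pole_poly alpha %| p.
Proof.
move=> ar pr pa; rewrite Gauss_dvdp; last first.
  by rewrite coprimep_XsubC root_XsubC eq_sym conj_neq.
rewrite !dvdp_XsubCl /root pa eqxx /=.
by rewrite -pr horner_conj pa rmorph0.
Qed.

Lemma conj_polyXsubC (a : K) : @conj_poly R ('X - a%:P) = 'X - (Num.conj a)%:P.
Proof. by rewrite /conj_poly rmorphB /= map_polyX map_polyC. Qed.

Lemma conj_pole_poly (alpha : K) : conj_poly (pole_poly alpha) = pole_poly alpha.
Proof. by rewrite /pole_poly conj_polyM !conj_polyXsubC conjCK mulrC. Qed.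

Lemma real_divisible (alpha : K) N : alpha \isn't Num.real ->
  map_mx (@conj_poly R) N = N -> ev alpha N = 0 ->
  exists N', N = pole_poly alpha *: N'.
Proof.
move=> ar Nr Na; apply: mx_dvdp => i j; apply: pole_poly_dvdp => //.
  by rewrite -[in RHS]Nr mxE.
by rewrite -evE Na mxE.
Qed.

End Fractions.

(** * Multiplication by a simple element *)

Section SimpleFactor.
Variable R : realType.
Local Notation K := (Cplx R).
Variables (alpha : K) (U : 'M[K]_7).
Hypothesis alpha_nreal : alpha \isn't Num.real.
Hypothesis hU : coassociative U.
Local Notation V := (cplx_conjmx U).
Local Notation A := (perp (U + V)%MS).
Local Notation piU := (pi_plane U).
Local Notation piV := (pi_conj U).
Local Notation S := (simple_poly alpha U).
Local Notation d := (alpha - Num.conj alpha).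

Lemma residue_neq0 : d != 0.
Proof. by rewrite subr_eq0 conj_neq. Qed.

Lemma mxact_opp (g : 'M[K]_7) x : mxact (- g) x = - mxact g x.
Proof. by rewrite -scaleN1r mxact_scalel scaleN1r. Qed.

Lemma evN a m n (B : 'M[{poly K}]_(m, n)) : ev a (- B) = - ev a B.
Proof. exact: map_mxN. Qed.

Lemma dmxN m n (B : 'M[{poly K}]_(m, n)) : dmx (- B) = - dmx B.
Proof. by apply/matrixP => i j; rewrite !mxE derivN. Qed.

Lemma deriv_pole_poly : ((pole_poly alpha)^`()).[alpha] = d.
Proof.
rewrite /pole_poly derivM !derivXsubC mul1r mulr1 hornerD !hornerXsubC.
by rewrite subrr addr0.
Qed.

Lemma deriv2_pole_poly : ((pole_poly alpha)^`()^`()).[alpha] = 2.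
Proof.
rewrite /pole_poly derivM !derivXsubC mul1r mulr1 derivD !derivXsubC.
by rewrite hornerD !hornerC.
Qed.

(** The simple polynomial and its derivatives at alpha: it is a multiple of the
    projection on conj U there, which is what kills the image of P0 when that image is
    orthogonal to U. *)
Lemma ev_simple : ev alpha S = d ^+ 2 *: piV.
Proof.
rewrite /simple_poly; move: piV piU => P Q.
rewrite evD evD evN !evZ !ev_cst ev_scalar pole_polyE !hornerZ !hornerXsubC.
by rewrite subrr mul0r mulr0 raddf0 add0r scale0r subr0 expr2.
Qed.

Lemma dmx2M m n k (A : 'M[{poly K}]_(m, n)) (B : 'M[{poly K}]_(n, k)) :
  dmx (dmx (A *m B)) =
  dmx (dmx A) *m B + dmx A *m dmx B + (dmx A *m dmx B + A *m dmx (dmx B)).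
Proof. by rewrite dmxM dmxD !dmxM. Qed.

Lemma dmx2Z m n p (A : 'M[{poly K}]_(m, n)) :
  dmx (dmx (p *: A)) =
  p^`()^`() *: A + p^`() *: dmx A + (p^`() *: dmx A + p *: dmx (dmx A)).
Proof. by rewrite dmxZ dmxD !dmxZ. Qed.

Lemma dmx_affine (a b c : {poly K}) (P Q : 'M[K]_7) :
  dmx (a%:M + b *: cst_mx P - c *: cst_mx Q) =
  a^`()%:M + b^`() *: cst_mx P - c^`() *: cst_mx Q.
Proof.
by rewrite dmxD dmxD dmxN !dmxZ !dmx_cst !scaler0 !addr0 dmx_scalar.
Qed.

Lemma ev_dmx_simple : ev alpha (dmx S) = d *: (1%:M + piV - piU).
Proof.
rewrite /simple_poly; move: piV piU => P Q.
rewrite dmx_affine.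
rewrite evD evD evN !evZ !ev_cst ev_scalar !derivZ !derivXsubC !hornerZ !hornerC !mulr1.
have -> : ((pole_poly alpha)^`()).[alpha] = d.
  exact: deriv_pole_poly.
by rewrite -scalemx1 scalerBr scalerDr.
Qed.

Lemma ev_dmx2_simple : ev alpha (dmx (dmx S)) = 2%:M.
Proof.
have d1 : (1 : {poly K})^`() = 0 by exact: derivC.
rewrite /simple_poly; move: piV piU => P Q.
rewrite !dmx_affine.
rewrite !derivZ !derivXsubC !d1 !scaler0 !scale0r addr0 subr0 ev_scalar.
by rewrite deriv2_pole_poly.
Qed.

Variables (M M' : 'M[{poly K}]_7).
Hypothesis SM : pole_poly alpha *: M' = S *m M.
Local Notation P0 := (mxact (ev alpha M)).
Local Notation P1 := (mxact (ev alpha (dmx M))).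
Local Notation P2 := (mxact (ev alpha (dmx (dmx M)))).
Local Notation Q0 := (mxact (ev alpha M')).
Local Notation Q1 := (mxact (ev alpha (dmx M'))).

(** First and second order terms at alpha of pole_poly M' = S M: pole_poly has a simple
    zero there, so the derivatives of M' appear one order later than those of M. *)
Lemma simple_factor0 u :
  Q0 u = P0 u + mxact piV (P0 u) - mxact piU (P0 u) + d *: mxact piV (P1 u).
Proof.
apply: (scalerI residue_neq0); have := congr1 (fun B => mxact (ev alpha (dmx B)) u) SM.
rewrite dmxM dmxZ !evD !evM !evZ ev_simple ev_dmx_simple pole_polyE subrr mul0r scale0r addr0.
have -> : ((pole_poly alpha)^`()).[alpha] = d.
  exact: deriv_pole_poly.
rewrite mxact_scalel mxact_addl !mxactM !mxact_scalel !mxact_addl mxact1 => ->.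
rewrite mxact_opp.
by rewrite [in RHS]scalerDr scalerA -expr2.
Qed.

Lemma simple_factor1 u : d *: Q1 u = P0 u - Q0 u
  + d *: (P1 u + mxact piV (P1 u) - mxact piU (P1 u)) + (d ^+ 2 / 2) *: mxact piV (P2 u).
Proof.
have n2 : (2 : K) != 0 by rewrite pnatr_eq0.
apply: (scalerI n2); have := congr1 (fun B => mxact (ev alpha (dmx (dmx B))) u) SM.
rewrite dmx2M dmx2Z !evD !evM !evZ ev_simple ev_dmx_simple ev_dmx2_simple.
rewrite pole_polyE subrr mul0r scale0r addr0.
have -> : ((pole_poly alpha)^`()).[alpha] = d.
  exact: deriv_pole_poly.
have -> : ((pole_poly alpha)^`()^`()).[alpha] = 2.
  exact: deriv2_pole_poly.
move: (ev _ M') (ev _ (dmx M')) (ev _ M) (ev _ (dmx M)) (ev _ (dmx (dmx M))) => N0 N1 L0 L1 L2.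
move: piV piU residue_neq0 => P Q; move: d => r r0.
have -> : (2%:M : 'M[K]_7) = 2 *: 1%:M by rewrite scalemx1.
rewrite !mxact_addl !mxactM !mxact_scalel !mxact_addl !mxact1 mxact_opp.
have -> : r ^+ 2 *: mxact P (mxact L2 u) = 2 *: ((r ^+ 2 / 2) *: mxact P (mxact L2 u)).
  by rewrite scalerA mulrCA mulfV // mulr1.
move: (mxact L1 u + _ - _) (_ *: mxact P (mxact L2 u)) => x w.
move: (r *: x) (r *: mxact N1 u) (mxact N0 u) (mxact L0 u) => {}x y q p e.
apply/rowP => i; have /rowP/(_ i) := e; rewrite !mxE => {}e.
have -> : 2 * y 0 i = 2 * q 0 i + y 0 i + y 0 i - 2 * q 0 i by ring.
by rewrite e; ring.
Qed.

End SimpleFactor.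

(* From here on only the characterizations of these matrices are used. *)
Opaque pi_plane pi_conj simple_poly.

Section PoleReduction.
Variable R : realType.
Local Notation K := (Cplx R).
Implicit Types (z : K) (M N : 'M[{poly K}]_7) (p q : {poly K}) (g h : loop_rep R).

Local Notation generated := (loop_generated (@simple_elements R)).

Section OneFactor.
Variables (alpha : K) (U : 'M[K]_7).
Hypothesis alpha_nreal : alpha \isn't Num.real.
Hypothesis hU : coassociative U.
Local Notation V := (cplx_conjmx U).
Local Notation A := (perp (U + V)%MS).
Local Notation piU := (pi_plane U).
Local Notation piV := (pi_conj U).
Local Notation d := (alpha - Num.conj alpha).

Lemma pi_act (u v a : 'rV[K]_7) : (u <= U)%MS -> (v <= V)%MS -> (a <= A)%MS ->
  mxact piU (u + v + a) = u /\ mxact piV (u + v + a) = v.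
Proof.
by move=> uU vV aA; have [eU eV _] := coass_proj_act hU uU vV aA; exact: conj eU eV.
Qed.

Lemma pi_mem x : exists u v a, [/\ (u <= U)%MS, (v <= V)%MS, (a <= A)%MS &
  [/\ x = u + v + a, mxact piU x = u & mxact piV x = v]].
Proof.
have [u [v [a [uU vV aA xE]]]] := coass_decomp hU x.
have [eU eV] := pi_act uU vV aA.
by exists u, v, a; split => //; rewrite xE; split.
Qed.

Lemma pi_conj_eq0 x : (forall c, (c <= U)%MS -> dotv c x = 0) -> mxact piV x = 0.
Proof.
move=> H; have [u [v [a [uU vV aA [xE _ ->]]]]] := pi_mem x.
apply/eqP; rewrite -dotv_herm_eq0 dotvC; apply/eqP.
have vU : (cplx_conjmx v <= U)%MS by rewrite -conj_sub_swap.
have := H _ vU; rewrite xE !dotvDr (coass_dotUU hU vU uU) add0r.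
by rewrite [X in _ + X]dotvC (coass_dotAU aA vU) addr0.
Qed.

(** When the image of P0 is orthogonal to U, the product with the simple element can be
    written with the same denominator: S M is real and vanishes at alpha, hence is
    divisible by pole_poly. *)
Lemma simple_factor_step M q g : loop_frac M q -> conj_poly q = q ->
  (forall c u, (c <= U)%MS -> dotv c (mxact (ev alpha M) u) = 0) ->
  loop_eq g (frac_loop M q) ->
  exists N, [/\ loop_frac N q,
    loop_eq (loop_mul (simple_element alpha U) g) (frac_loop N q) &
    pole_poly alpha *: N = simple_poly alpha U *m M].
Proof.
move=> HM qr orth gE.
have HSM := loop_frac_mul (loop_frac_simple alpha hU) HM.
have := real_numerator HSM; rewrite conj_polyM conj_pole_poly qr => /(_ erefl) SMr.
have SM0 : ev alpha (simple_poly alpha U *m M) = 0.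
  rewrite evM ev_simple -scalemxAl; apply/eqP; rewrite scaler_eq0; apply/orP; right.
  apply/eqP/mxact_inj => u; rewrite mxactM pi_conj_eq0 ?/mxact ?trmx0 ?mulmx0 //.
  by move=> c cU; exact: orth.
have [N NE] := real_divisible alpha_nreal SMr SM0.
rewrite NE in HSM; exists N; split=> //; first by move: HSM => /loop_frac_scale; apply; exact: pole_poly_neq0.
apply: loop_eq_trans (frac_loop_scale N q (pole_poly_neq0 alpha)).
apply: loop_eq_trans (loop_eq_mul (simple_element_frac alpha hU) gE) _.
rewrite -NE; exists setT; split; [exact: openT|by move=> O [x Ox] _; exists x|].
case=> [z|] _; rewrite /loop_mul /= ?mul1mx //.
have -> : (pole_poly alpha * q).[z] = (pole_poly alpha).[z] * q.[z] by exact: hornerM.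
by rewrite evM invfM -scalemxAl -scalemxAr scalerA.
Qed.

Lemma generated_factor g : generated (loop_mul (simple_element alpha U) g) -> generated g.
Proof.
move=> H; have Hs : generated (simple_element alpha U).
  by apply: Gen_incl; exists alpha, U.
apply: Gen_eq (Gen_mul (Gen_inv Hs) H) _.
have [oD dD] := nonroots_open_dense (pole_poly_neq0 alpha).
apply/loop_eqP; exists [set z | (pole_poly alpha).[z] != 0].
split => // z /= /pole_nonroots[z1 z2].
rewrite /loop_mul /loop_inv simple_element_at mulKmx //.
have /G2P[gg _] := coass_scale_G2 hU (ratio_at_neq0 z1 z2).
by have [] := mulmx1_unit gg.
Qed.

(** P1 u is orthogonal to U, so it has no component along conj U, while P0 u is its own
    component along U: the terms of simple_factor0 cancel. *)
Lemma simple_factor_cancels M N : pole_poly alpha *: N = simple_poly alpha U *m M ->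
  cancelling (ev alpha M) (ev alpha (dmx M)) U -> ev alpha N = 0.
Proof.
move=> NE [_ MU orth]; apply: mxact_inj => u.
rewrite (simple_factor0 alpha_nreal NE) (pi_conj_eq0 (x := mxact (ev alpha (dmx M)) u)); last first.
  by move=> c cU; exact: orth.
have P0U : (mxact (ev alpha M) u <= U)%MS by rewrite (submx_trans _ MU) // submxMl.
have := pi_act P0U (sub0mx _ _) (sub0mx _ _); rewrite !addr0 => -[-> ->].
by rewrite addr0 subrr scaler0 addr0 /mxact trmx0 mulmx0.
Qed.

End OneFactor.
End PoleReduction.

Section Untilting.
Variable R : realType.
Local Notation K := (Cplx R).
Variables (alpha : K) (U : 'M[K]_7).
Hypothesis alpha_nreal : alpha \isn't Num.real.
Hypothesis hU : coassociative U.
Local Notation V := (cplx_conjmx U).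
Local Notation A := (perp (U + V)%MS).
Local Notation piU := (pi_plane U).
Local Notation piV := (pi_conj U).
Local Notation d := (alpha - Num.conj alpha).
Variables (M N : 'M[{poly K}]_7) (w e u1 u2 : 'rV[K]_7).
Local Notation P0 := (mxact (ev alpha M)).
Local Notation P1 := (mxact (ev alpha (dmx M))).
Local Notation Q0 := (mxact (ev alpha N)).
Local Notation Q1 := (mxact (ev alpha (dmx N))).
Hypothesis P00 : forall u v, dotv (P0 u) (P0 v) = 0.
Hypothesis P01 : forall u v, dotv (P0 u) (P1 v) + dotv (P1 u) (P0 v) = 0.
Hypothesis NE : pole_poly alpha *: N = simple_poly alpha U *m M.
Hypotheses (wU : (w <= U)%MS) (eA : (e <= A)%MS).
Hypotheses (w1 : w = P0 u1) (e2 : e = P0 u2).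
Hypothesis im : forall u, exists a b, P0 u = a *: w + b *: e.

(** With E u and F u the components of Q0 u in A and conj U, the new tilt of u and v is,
    up to a factor, <P1 u, pi_U P0 v> + <pi_A P0 u, P1 v>.  By skewness of the old tilt
    it is the sum of opposite multiples of B (u1, u2). *)
Lemma simple_factor_untilts u v : dotv (Q0 u) (Q1 v) = 0.
Proof.
apply: (mulfI (residue_neq0 alpha_nreal)); rewrite mulr0 -dotvZr.
have Q1E := simple_factor1 alpha_nreal NE v.
have Q0u := simple_factor0 alpha_nreal NE u; have Q0v := simple_factor0 alpha_nreal NE v.
have [a [b uE]] := im u; have [a' [b' vE]] := im v.
have pi_im r s : mxact piU (r *: w + s *: e) = r *: w /\ mxact piV (r *: w + s *: e) = 0.
  have := pi_act hU (scalemx_sub r wU) (sub0mx _ V) (scalemx_sub s eA).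
  by rewrite addr0.
have [x [f [y [xU fV yA [xE _ piVu]]]]] := pi_mem hU (P1 u).
have [x' [f' [y' [xU' fV' yA' [xE' piUv piVv]]]]] := pi_mem hU (P1 v).
have [x2 [f2 [y2 [_ fV2 _ [_ _ piVv2]]]]] := pi_mem hU (mxact (ev alpha (dmx (dmx M))) v).
move: piU piV pi_im piVu piUv piVv piVv2 Q1E Q0u Q0v => P Q pi_im piVu piUv piVv piVv2 Q1E Q0u Q0v.
have [PU PV] : mxact P (P0 u) = a *: w /\ mxact Q (P0 u) = 0 by rewrite uE; exact: pi_im.
have [PU' PV'] : mxact P (P0 v) = a' *: w /\ mxact Q (P0 v) = 0 by rewrite vE; exact: pi_im.
rewrite Q1E Q0u Q0v; rewrite PU PV PU' PV' piVu piVv piUv piVv2.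
have Hew : dotv e w = 0 := coass_dotAU eA wU.
have HeV g : (g <= V)%MS -> dotv e g = 0 := coass_dotAV eA.
have HVV g : (g <= V)%MS -> dotv f g = 0 := coass_dotVV hU fV.
have Hfy : dotv f y' = 0 by rewrite dotvC (coass_dotAV yA' fV).
have ey : dotv e y' = dotv e (P1 v).
  by rewrite xE' !dotvDr (coass_dotAU eA xU') (HeV _ fV') !add0r.
have fw : dotv f w = dotv (P1 u) w.
  by rewrite xE !dotvDl (coass_dotUU hU xU wU) (coass_dotAU yA wU) add0r addr0.
have Huv : a' * dotv (P1 u) w + b * dotv e (P1 v) = 0.
  have B11 := tilt_diag P01 u1; have B22 := tilt_diag P01 u2.
  have B12 := tilt_skew P01 u1 u2.
  have -> : dotv (P1 u) w = - (b * dotv (P0 u2) (P1 u1)).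
    rewrite dotvC w1 (tilt_skew P01) uE dotvDl !dotvZl {1}w1 e2.
    by rewrite B11 mulr0 add0r.
  have -> : dotv e (P1 v) = - (a' * dotv (P0 u1) (P1 u2)).
    rewrite e2 (tilt_skew P01) vE dotvDl !dotvZl e2 w1.
    by rewrite B22 mulr0 addr0.
  by rewrite B12; ring.
have eU : P0 u + 0 - a *: w + d *: f = b *: e + d *: f by rewrite uE addr0 [a *: w + _]addrC addrK.
rewrite eU.
have -> : P0 v - (P0 v + 0 - a' *: w + d *: f') + d *: (P1 v + f' - x') + d ^+ 2 / 2 *: f2
  = a' *: w + d *: y' + (d *: f' + d ^+ 2 / 2 *: f2).
  rewrite xE'; move: (P0 v) d => p r.
  by apply/rowP => i; rewrite !mxE; ring.
have gV : ((d *: f' + (d ^+ 2 / 2) *: f2)%R <= V)%MS.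
  by rewrite addmx_sub ?scalemx_sub.
move: (d *: f' + _) gV => h hV.
rewrite !dotvDl !dotvDr !dotvZl !dotvZr Hew ey fw Hfy (HeV _ hV) (HVV _ hV).
transitivity (d * (a' * dotv (P1 u) w + b * dotv e (P1 v))); first by ring.
by rewrite Huv mulr0.
Qed.

End Untilting.

(** * Removing the poles one by one *)

Section Reduction.
Variable R : realType.
Local Notation K := (Cplx R).
Local Notation generated := (loop_generated (@simple_elements R)).
Implicit Types (M N : 'M[{poly K}]_7) (p q : {poly K}) (g h : loop_rep R).

(** Some h that generates g has the same denominator, but a numerator that vanishes at
    alpha. *)
Definition reducible_pole (alpha : K) M q g := exists N h,
  [/\ loop_frac N q, ev alpha N = 0, loop_eq h (frac_loop N q) & generated h -> generated g].

Lemma cancelling_reducible alpha M q g U : alpha \isn't Num.real ->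
  loop_frac M q -> conj_poly q = q -> loop_eq g (frac_loop M q) ->
  cancelling (ev alpha M) (ev alpha (dmx M)) U -> reducible_pole alpha M q g.
Proof.
move=> ar HM qr gE HU; have [hU MU _] := HU.
have [|N [HN hE NE]] := simple_factor_step ar hU HM qr _ gE.
  move=> c u cU; apply: (coass_dotUU hU cU).
  by rewrite (submx_trans _ MU) // submxMl.
exists N, (loop_mul (simple_element alpha U) g); split => //.
  exact: simple_factor_cancels NE HU.
exact: generated_factor.
Qed.

(** One factor suffices unless the image of P0 is a plane with nonzero tilt, where two
    are used; the first one may already cancel the pole or lower the rank. *)
Lemma nonreal_pole_reducible alpha M q g : alpha \isn't Num.real ->
  loop_frac M q -> conj_poly q = q -> q.[alpha] = 0 -> loop_eq g (frac_loop M q) ->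
  reducible_pole alpha M q g.
Proof.
move=> ar HM qr qa gE.
have [M0|M0] := eqVneq (ev alpha M) 0; first by exists M, g.
have [_ HG _ _] := HM.
have P00 := pole_dot00 HG qa; have P01 := pole_dot01 HG qa.
have X00 := pole_cross00 HG qa; have X01 := pole_cross01 HG qa.
have := rank_image P00 X00 M0.
case rE : (\rank _) => [|[|[|k]]] // _.
  by have [U] := cancelling_rank1 P00 P01 X01 rE; exact: cancelling_reducible.
have [w [e [U [hU wU eA [u1 [u2 [w1 e2]]] im]]]] := untilting_plane P00 X00 rE.
have [|N [HN hE NE]] := simple_factor_step ar hU HM qr _ gE.
  move=> c u cU; have [a [b ->]] := im u.
  rewrite dotvDr !dotvZr (coass_dotUU hU cU wU) dotvC (coass_dotAU eA cU).
  by rewrite !mulr0 addr0.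
have B0 := simple_factor_untilts ar hU P01 NE wU eA w1 e2 im.
have gen := generated_factor ar hU (g := g).
have [N0|N0] := eqVneq (ev alpha N) 0.
  by exists N, (loop_mul (simple_element alpha U) g).
suff [U' HU'] : exists U', cancelling (ev alpha N) (ev alpha (dmx N)) U'.
  have [N' [h [HN' N'0 hN' hg]]] := cancelling_reducible ar HN qr hE HU'.
  by exists N', h; split => // /hg.
have [_ HGN _ _] := HN.
have Q00 := pole_dot00 HGN qa; have Y00 := pole_cross00 HGN qa.
have := rank_image Q00 Y00 N0.
case rN : (\rank _) => [|[|[|k]]] // _.
  exact: (cancelling_rank1 Q00 (pole_dot01 HGN qa) (pole_cross01 HGN qa) rN).
by exists (ev alpha N)^T; exact: (cancelling_rank2 Q00 Y00 rN B0).
Qed.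

(** At a real point M is real with isotropic image, so that the image of u is orthogonal
    to its own conjugate, which is the image of conj u. *)
Lemma real_pole_zero (a : K) M q : a \is Num.real -> loop_frac M q -> conj_poly q = q ->
  q.[a] = 0 -> ev a M = 0.
Proof.
move=> ar HM qr qa; have Mr := real_numerator HM qr; have [_ HG _ _] := HM.
apply: mxact_inj => u; apply: trmx_inj; apply/eqP; rewrite /mxact trmx0 mulmx0.
have ac : Num.conj a = a by exact/CrealP.
have Mc : cplx_conjmx (ev a M) = ev a M.
  by rewrite -ev_conj ac Mr.
have cE : cplx_conjmx (mxact (ev a M) u) = mxact (ev a M) (cplx_conjmx u).
  by rewrite conj_mxact Mc.
rewrite trmx0 trmx_eq0 -dotv_herm_eq0; apply/eqP.
by rewrite cE (pole_dot00 HG qa).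
Qed.

Lemma loop_frac_no_root M q : loop_frac M q -> (size q <= 1)%N -> M = q%:M.
Proof.
move=> [_ _ _ Hs] sq; apply/matrixP => i j; rewrite !mxE; apply/eqP; rewrite -subr_eq0.
by rewrite -size_poly_leq0 -ltnS (leq_trans (Hs i j)).
Qed.

(** Induction on the degree of the denominator: its real roots are removable, and its
    nonreal roots become removable after multiplication by simple elements. *)
Lemma real_frac_generated n M q g : (size q <= n)%N -> loop_frac M q ->
  conj_poly q = q -> loop_eq g (frac_loop M q) -> generated g.
Proof.
elim: n M q g => [|n IH] M q g sq HM qr gE.
  by have [q0 _ _ _] := HM; move: q0; rewrite -size_poly_leq0 sq.
have reduce p N q' h : p != 0 -> (1 < size p)%N -> conj_poly p = p -> q = p * q' ->
    loop_frac (p *: N) q -> loop_eq h (frac_loop (p *: N) q) -> generated h.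
  move=> p0 sp pr qE HN hE; rewrite qE in HN hE.
  have q0 : p * q' != 0 by case: HN.
  apply: (IH N q').
  - have q'0 : q' != 0 by move: q0; rewrite mulf_eq0 negb_or => /andP[].
    move: sq; rewrite qE size_mul // => sq; rewrite -ltnS (leq_trans _ sq) //.
    move: sp; case: (size p) => [|[|k]] // _.
    by rewrite !addSn /= ltnS leq_addl.
  - exact: (loop_frac_scale N q' p0).1.
  - by apply: (mulfI p0); rewrite -{1}pr -conj_polyM -qE.
  - exact: loop_eq_trans hE (frac_loop_scale N q' p0).
have [sq1|sq1] := leqP (size q) 1.
  apply: Gen_eq (Gen_one _) _; apply: loop_eq_sym; apply: loop_eq_trans gE _.
  have [q0 _ _ _] := HM; have [oq dq] := nonroots_open_dense q0.
  apply/loop_eqP; exists [set z | q.[z] != 0]; split => // z qz.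
  rewrite /= (loop_frac_no_root HM sq1) ev_scalar -scalemx1 scalerA mulVf //.
  by rewrite scale1r.
have [a /rootP qa] : exists a, root q a by apply/closed_rootP; rewrite gtn_eqF.
have [ar|ar] := boolP (a \is Num.real).
  have Ma := real_pole_zero ar HM qr qa.
  have [|N NE] := mx_dvdp (p := 'X - a%:P) (M := M).
    by move=> i j; rewrite dvdp_XsubCl /root -evE Ma mxE.
  have /factor_theorem[q' qE] : root q a by apply/rootP.
  rewrite NE in HM gE; apply: (reduce ('X - a%:P) N q') gE => //.
  - by rewrite polyXsubC_eq0.
  - by rewrite size_XsubC.
  - by rewrite conj_polyXsubC (CrealP ar).
  - by rewrite mulrC.
have [N [h [HN N0 hE]]] := nonreal_pole_reducible ar HM qr qa gE; apply.
have [N' NE] := real_divisible ar (real_numerator HN qr) N0.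
have /dvdpP[q' qE] := pole_poly_dvdp ar qr qa.
rewrite NE in HN hE; apply: (reduce (pole_poly a) N' q') hE => //.
- exact: pole_poly_neq0.
- by rewrite size_pole_poly.
- exact: conj_pole_poly.
- by rewrite mulrC.
Qed.

End Reduction.

Section Generation.
Variable R : realType.

Lemma rational_G2_loop_generated (g : loop_rep R) :
  rational_G2_loop g -> loop_generated (@simple_elements R) g.
Proof.
move=> [M [q [HM gE]]]; have [q0 _ _ _] := HM.
have qc0 : conj_poly q != 0 by rewrite map_poly_eq0.
apply: (@real_frac_generated R _ (conj_poly q *: M) (conj_poly q * q)) => //.
- exact: (loop_frac_scale M q qc0).2.
- rewrite conj_polyM mulrC; congr (_ * _).
  by apply/polyP => i; rewrite !coef_map /= conjCK.
exact: loop_eq_trans gE (loop_eq_sym (frac_loop_scale M q qc0)).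
Qed.

Lemma generated_rational_G2_loop (g : loop_rep R) :
  loop_generated (@simple_elements R) g -> rational_G2_loop g.
Proof.
elim=> {g} [g [alpha [U [ar hU ->]]]| |g h _ rg _ rh|g _ rg|g h _ rg gh].
- exact: simple_element_rational.
- exact: rational_G2_loop_one.
- exact: rational_G2_loop_mul.
- exact: rational_G2_loop_inv.
- exact: rational_G2_loop_eq gh.
Qed.

End Generation.

Theorem theorem6p8 (R : realType) (g : loop_rep R) :
  @Lminus_tau R g <-> loop_generated (@simple_elements R) g.
Proof.
split=> [/Lminus_rational_G2_loop|/generated_rational_G2_loop].
  exact: rational_G2_loop_generated.
exact: rational_G2_loop_Lminus.
Qed.
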